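(* Let $M=G/K$ be a homogeneous space with $G$ a compact connected semisimple Lie group and $K$ a closed connected subgroup, $G$ acting almost-effectively on $M$, and consider any reductive decomposition $\mathfrak g=\mathfrak k\oplus\mathfrak p$. (i) Each bi-invariant symmetric bilinear form $Q$ on $\mathfrak g$ such that $Q|_{\mathfrak k\times\mathfrak k}=0$ defines a closed $3$-form $H_Q\in(\Lambda^3\mathfrak p^* )^K$ by $$H_Q(X,Y,Z):=4Q([X,Y],Z)-Q([X,Y]_{\mathfrak p},Z)+Q([X,Z]_{\mathfrak p},Y)-Q([Y,Z]_{\mathfrak p},X)$$ $$=Q([X,Y],Z)+Q([X,Y]_{\mathfrak k},Z)-Q([X,Z]_{\mathfrak k},Y)+Q([Y,Z]_{\mathfrak k},X),\qquad\forall X,Y,Z\in\mathfrak p.$$ Equivalently, $\pi^*H_Q=\overline Q+\hat d\alpha_Q$, where $\overline Q:=Q([\cdot,\cdot],\cdot)\in\Lambda^3\mathfrak g^*$ and $\alpha_Q\in\Lambda^2\mathfrak g^*$ is defined by $$\alpha_Q|_{\mathfrak k\times\mathfrak k}=0,\qquad\alpha_Q|_{\mathfrak p\times\mathfrak p}=0,\qquad\alpha_Q(X,Z)=Q(X,Z)\quad\forall X\in\mathfrak p,\ Z\in\mathfrak k.$$ (ii) Every class in the real de Rham cohomology $H^3(G/K)$ has a unique representative of the form $H_Q$ as in part (i), that is, $$H^3(G/K)\simeq\{Q\in\mathrm{sym}^2(\mathfrak g)^G:Q|_{\mathfrak k\times\mathfrak k}=0\}\qquad\text{and}\qquad b_3(G/K)=s-d_{G/K},$$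 where $s$ is the number of simple ideals of $\mathfrak g$ and $$d_{G/K}:=\dim\{Q|_{\mathfrak k\times\mathfrak k}:Q\text{ is a bi-invariant symmetric bilinear form on }\mathfrak g\}.$$
   Context: $\mathfrak g,\mathfrak k$ are the Lie algebras of $G,K$. A reductive decomposition is $\mathfrak g=\mathfrak k\oplus\mathfrak p$ with $\mathfrak p$ an $\mathrm{Ad}(K)$-invariant subspace; subscripts $\mathfrak k,\mathfrak p$ denote components. $\mathrm{sym}^2(\mathfrak g)^G$ is the space of bi-invariant (i.e. $\mathrm{Ad}(G)$-invariant) symmetric bilinear forms on $\mathfrak g$. $G$-invariant $k$-forms on $M$ are identified with the space $(\Lambda^k\mathfrak p^* )^K$ of $\mathrm{Ad}(K)$-invariant $k$-forms on $\mathfrak p$, with differential $d\alpha(X_1,\dots,X_{k+1})=\sum_{i<j}(-1)^{i+j}\alpha([X_i,X_j]_{\mathfrak p},X_1,\dots,\hat X_i,\dots,\hat X_j,\dots,X_{k+1})$, and $H^k(G/K)$ is computed by this complex; $b_3$ is the third Betti number. $\pi:G\to G/K$ is the projection; $\pi^*$ identifies $(\Lambda^k\mathfrak p^* )^K$ with the $\mathrm{Ad}(K)$-invariant $\beta\in\Lambda^k\mathfrak g^*$ satisfying $\beta(Z,\cdot,\dots,\cdot)=0$ for all $Z\in\mathfrak k$. $\hat d$ is the differential of left-invariant forms on $G$, given by the same formula with $[X_i,X_j]$ in place of $[X_i,X_j]_{\mathfrak p}$. *)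

(* Defs.v *)
From HB Require Import structures.
From mathcomp Require Import all_boot all_order all_algebra.
From mathcomp Require Import all_classical all_reals all_analysis.

Set Implicit Arguments.
Unset Strict Implicit.
Unset Printing Implicit Defensive.

Import Order.TTheory GRing.Theory Num.Theory.
Import numFieldNormedType.Exports.

Local Open Scope classical_set_scope.
Local Open Scope ring_scope.

(* [Ck k A f]: f is of class C^k on A; meant for open sets A and
   finite-dimensional V. *)
Fixpoint Ck (R : realType) (V W : normedModType R) (k : nat) (A : set V)
    (f : V -> W) : Prop :=
  match k with
  | 0 => forall x, A x -> {for x, continuous f}
  | k'.+1 => (forall x, A x -> differentiable f x) /\
             (forall v, Ck k' A (fun x => 'D_v f x))
  end.

Definition smooth_on (R : realType) (V W : normedModType R) (A : set V)
  (f : V -> W) : Prop := forall k, Ck k A f.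

(* Coordinate systems are total functions; only the values of [cmap] on [cdom]
   and of [cinv] on [cimg] matter. *)
Record chart (R : realType) (n : nat) (G : topologicalType) := Chart {
  cdom : set G;
  cmap : G -> 'rV[R]_n;
  cinv : 'rV[R]_n -> G;
  cdom_open : open cdom;
  cimg_open : open (cmap @` cdom);
  cmapK : forall g, cdom g -> cinv (cmap g) = g;
  cmap_continuous : {within cdom, continuous cmap};
  cinv_continuous : {within cmap @` cdom, continuous cinv} }.

Definition cimg (R : realType) (n : nat) (G : topologicalType)
  (c : chart R n G) : set 'rV[R]_n := cmap c @` cdom c.

HB.mixin Record isLieGroup (R : realType) (n : nat) G
    of Topological G & Group G := {
  lie_hausdorff : hausdorff_space G;
  lie_second_countable : @second_countable G;
  atlas : set (chart R n G);
  atlas_cover : forall g : G, exists2 c, atlas c & cdom c g;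
  atlas_compatible : forall a b, atlas a -> atlas b ->
    smooth_on (cmap a @` (cdom a `&` cdom b)) (cmap b \o cinv a);
  mulg_continuous : continuous (fun gh : G * G => (gh.1 * gh.2)%g);
  invg_continuous : continuous (fun g : G => g^-1%g);
  mulg_smooth : forall a b c, atlas a -> atlas b -> atlas c ->
    smooth_on [set xy : 'rV[R]_n * 'rV[R]_n |
                [/\ cimg a xy.1, cimg b xy.2 &
                    cdom c (cinv a xy.1 * cinv b xy.2)%g]]
      (fun xy => cmap c (cinv a xy.1 * cinv b xy.2)%g);
  invg_smooth : forall a b, atlas a -> atlas b ->
    smooth_on [set x | cimg a x /\ cdom b (cinv a x)^-1%g]
      (fun x => cmap b (cinv a x)^-1%g) }.

#[short(type="lieGroupType")]
HB.structure Definition LieGroup (R : realType) (n : nat) :=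
  { G of isLieGroup R n G & Topological G & Group G }.

(* The tangent space at 1 is 'rV[R]_n, through the differential of a chart c
   of the atlas whose domain contains 1. *)
Section LieAlgebra.
Variables (R : realType) (n : nat) (G : lieGroupType R n) (c : chart R n G).

Definition chart_at_one : Prop := atlas c /\ cdom c 1%g.

Definition Ad (g : G) (Y : 'rV[R]_n) : 'rV[R]_n :=
  'D_Y (fun y => cmap c (g * cinv c y * g^-1)%g) (cmap c 1%g).

(* [X, Y] = ad X Y, where ad is the differential of Ad at 1. *)
Definition lie_bracket (X Y : 'rV[R]_n) : 'rV[R]_n :=
  'D_X (fun x => Ad (cinv c x) Y) (cmap c 1%g).

(* gamma(t) = exp(tX) *)
Definition one_parameter_subgroup (gamma : R -> G) (X : 'rV[R]_n) : Prop :=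
  [/\ continuous gamma,
      forall s t, gamma (s + t) = (gamma s * gamma t)%g &
      is_derive (0 : R) (1 : R) (cmap c \o gamma) X].

(* k = { X | exp(tX) \in K for all t }; for closed K this set is a linear
   subspace, by Cartan's closed subgroup theorem. *)
Definition is_lie_algebra_of (K : set G) (k : {vspace 'rV[R]_n}) : Prop :=
  forall X, X \in k <->
    exists2 gamma, one_parameter_subgroup gamma X & forall t, K (gamma t).

Definition is_subgroup (K : set G) : Prop :=
  [/\ K 1%g, forall g h, K g -> K h -> K (g * h)%g &
      forall g, K g -> K g^-1%g].

(* g fixes every coset xK iff x^-1 g x \in K for all x. *)
Definition action_kernel (K : set G) : set G :=
  [set g | forall x, K (x^-1 * g * x)%g].

Definition almost_effective (K : set G) : Prop :=
  forall g, action_kernel K g -> isolated (action_kernel K) g.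

Definition reductive_decomposition (K : set G) (k p : {vspace 'rV[R]_n})
    : Prop :=
  [/\ is_lie_algebra_of K k, (k + p)%VS = fullv, (k :&: p)%VS = 0%VS &
      forall h X, K h -> X \in p -> Ad h X \in p].

End LieAlgebra.

Section Ideals.
Variables (R : realType) (V : vectType R) (br : V -> V -> V).

Definition is_ideal (a : {vspace V}) : Prop :=
  forall X Y, Y \in a -> br X Y \in a.

Definition is_abelian (a : {vspace V}) : Prop :=
  forall X Y, X \in a -> Y \in a -> br X Y = 0.

Definition is_semisimple : Prop :=
  forall a, is_ideal a -> is_abelian a -> a = 0%VS.

Definition is_simple_ideal (a : {vspace V}) : Prop :=
  [/\ is_ideal a, ~ is_abelian a &
      forall b : {vspace V}, (b <= a)%VS ->
        (forall X Y, X \in a -> Y \in b -> br X Y \in b) ->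
        b = 0%VS \/ b = a].

End Ideals.

Notation ext_form R V k := (('I_k -> V) -> R^o).

Section Forms.
Variables (R : realType) (V : vectType R).

Definition is_alternating_form (k : nat) (a : ext_form R V k) : Prop :=
  (forall x i, scalar (fun v => a [eta x with i |-> v])) /\
  (forall x i j, i != j -> x i = x j -> a x = 0).

Definition is_invariant_form (T : Type) (act : T -> V -> V) (S : set T)
    (k : nat) (a : ext_form R V k) : Prop :=
  forall h, S h -> forall x, a (fun i => act h (x i)) = a x.

Definition form3 (f : V -> V -> V -> R) : ext_form R V 3 :=
  fun x => f (x ord0) (x (inord 1)) (x (inord 2)).

(* Counting indices from 0 instead of 1 does not change the signs (-1)^(i+j).
   [bump j (bump i l)] is the l-th index different from i and j, for i < j. *)
Definition ext_diff (br : V -> V -> V) (k : nat) (a : ext_form R V k) :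
    ext_form R V k.+1 :=
  fun x => \sum_(i < k.+1) \sum_(j < k.+1 | (i < j)%N)
    (-1) ^+ (i + j) *
    a (fun l : 'I_k => if l == 0 :> nat then br (x i) (x j)
                       else x (inord (bump j (bump i l.-1)))).

End Forms.

(* dim (A / B) = d, for subspaces B and A of W *)
Definition has_dim_quot (R : realType) (W : lmodType R) (A B : set W)
    (d : nat) : Prop :=
  exists e : 'I_d -> W, (forall i, A (e i)) /\
    forall w, A w ->
      exists! t : 'rV[R]_d, B (w - \sum_(i < d) t ord0 i *: e i).

Definition has_dim (R : realType) (W : lmodType R) (A : set W) (d : nat)
  : Prop := has_dim_quot A [set 0] d.

Section Homogeneous.
Variables (R : realType) (n : nat) (G : lieGroupType R n) (c : chart R n G).
Variables (K : set G) (k p : {vspace 'rV[R]_n}).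

Local Notation g := 'rV[R]_n.
Local Notation br := (lie_bracket c).

Definition comp_k (X : g) : g := daddv_pi k p X.
Definition comp_p (X : g) : g := daddv_pi p k X.

Definition biinvariant_form : set (g -> g -> R^o) :=
  [set Q | [/\ forall X, scalar (Q X), forall Y, scalar (Q ^~ Y),
               forall X Y, Q X Y = Q Y X &
               forall h X Y, Q (Ad c h X) (Ad c h Y) = Q X Y]].

Definition biinvariant_form_k0 : set (g -> g -> R^o) :=
  [set Q | biinvariant_form Q /\
           (forall X Y, X \in k -> Y \in k -> Q X Y = 0)].

Definition restr_k (Q : g -> g -> R^o) : subvs_of k -> subvs_of k -> R^o :=
  fun X Y => Q (vsval X) (vsval Y).

Definition bracket_p (X Y : subvs_of p) : subvs_of p :=
  vsproj p (comp_p (br (vsval X) (vsval Y))).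

Definition Ad_p (h : G) (X : subvs_of p) : subvs_of p :=
  vsproj p (Ad c h (vsval X)).

(* The complex computing H^*(G/K): (Lambda^m p^* )^K with its differential. *)
Definition invariant_forms (m : nat) : set (ext_form R (subvs_of p) m) :=
  [set a | is_alternating_form a /\ is_invariant_form Ad_p K a].

Definition closed_forms (m : nat) : set (ext_form R (subvs_of p) m) :=
  [set a | invariant_forms a /\ ext_diff bracket_p a = 0].

Definition exact_forms (m : nat) : set (ext_form R (subvs_of p) m) :=
  match m with
  | 0 => [set 0]
  | m'.+1 => [set ext_diff bracket_p b | b in @invariant_forms m']
  end.

Definition coh_class (m : nat) (a : ext_form R (subvs_of p) m) :
    set (ext_form R (subvs_of p) m) :=
  [set b | exact_forms (b - a)].

Definition cohomology (m : nat) : set (set (ext_form R (subvs_of p) m)) :=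
  [set coh_class a | a in @closed_forms m].

Definition is_betti (m b : nat) : Prop :=
  has_dim_quot (@closed_forms m) (@exact_forms m) b.

Definition pullback (m : nat) (a : ext_form R (subvs_of p) m) : ext_form R g m :=
  fun x => a (fun i => vsproj p (comp_p (x i))).

Definition H_fun (Q : g -> g -> R^o) (X Y Z : g) : R :=
  4 * Q (br X Y) Z - Q (comp_p (br X Y)) Z + Q (comp_p (br X Z)) Y
  - Q (comp_p (br Y Z)) X.

Definition H_form (Q : g -> g -> R^o) : ext_form R (subvs_of p) 3 :=
  form3 (fun X Y Z => H_fun Q (vsval X) (vsval Y) (vsval Z)).

Definition Qbar (Q : g -> g -> R^o) : ext_form R g 3 :=
  form3 (fun X Y Z => Q (br X Y) Z).

Definition is_alphaQ (Q : g -> g -> R^o) (alpha : ext_form R g 2) : Prop :=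
  [/\ is_alternating_form alpha,
      forall x, (forall i, x i \in k) -> alpha x = 0,
      forall x, (forall i, x i \in p) -> alpha x = 0 &
      forall x, x ord0 \in p -> x (inord 1) \in k ->
        alpha x = Q (x ord0) (x (inord 1))].

End Homogeneous.

Arguments invariant_forms {R n G} c K p m.
Arguments closed_forms {R n G} c K k p m.
Arguments exact_forms {R n G} c K k p m.
Arguments cohomology {R n G} c K k p m.
Arguments restr_k {R n} k Q X Y.
Arguments H_form {R n G} c k p Q x.

(* Main.v *)
Require Import Defs.
From HB Require Import structures.
From mathcomp Require Import all_boot all_order all_algebra.
From mathcomp Require Import all_classical all_reals all_analysis.
From mathcomp Require Import ring lra.

Set Implicit Arguments.
Unset Strict Implicit.
Unset Printing Implicit Defensive.

Import Order.TTheory GRing.Theory Num.Theory.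
Import numFieldNormedType.Exports.

Local Open Scope classical_set_scope.
Local Open Scope ring_scope.

(** The proof compares invariant forms on G/K with left-invariant forms on G and
    uses harmonic representatives on the Lie algebra.

    Lie theory. Written in charts, the multiplication gives the adjoint action,
    its derivative in the point and the second order expression
    [bracket_mul_ch] of the bracket; the symmetry of second derivatives makes
    the bracket alternating ([bracket_alternating]), and differentiating
    homomorphism properties of Ad gives the Jacobi identity. Forms invariant
    under Ad are invariant under ad ([infinitesimal2], [infinitesimal3]), for G
    as well as for K and k, and the converse holds for G since G is connected
    ([Ad_invariant_of_ad_invariant]).

    Compactness. Ad(G) is bounded, so it preserves an inner product. It is found
    as the minimiser of an invariant strictly convex function on a convex set of
    forms ([fixed_point], [invariant_inner_product]), which takes the place of
    an average over G.

    Forms on the Lie algebra. Lie derivatives are skew for this inner product and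
    exact on closed forms, so the representative of a class orthogonal to the
    exact forms is ad-invariant ([harmonic2], [harmonic3]). As semisimplicity
    makes the algebra centerless and equal to the span of its brackets,
    invariant 2-forms vanish, and invariant 3-forms are Q([X, Y], Z) with Q
    symmetric and invariant. Thus every closed 3-form is such a form plus d t
    ([closed_alt3_decomposition]), and choosing t orthogonal to the closed
    2-forms makes it as symmetric as the 3-form ([invariant_primitive]).

    The homogeneous space. If Q vanishes on k x k, then
    Q([X, Y], Z) + d alpha_Q is closed, K-invariant and vanishes in the
    directions of k, so it is the pullback of a closed form, which is H_Q.
    Conversely the pullback of a closed form a is Q([X, Y], Z) + d t with t
    invariant under K. Its vanishing in the directions of k forces
    t(., Z) = Q(., Z) for Z in k; then Q is skew as well as symmetric on k x k,
    and alpha_Q - t descends to a primitive of H_Q - a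
    ([rp_class_representative]). If H_Q is exact, then so is Q([X, Y], Z), which
    has an invariant primitive; this primitive vanishes, and so does Q
    ([exact_invariant_eq0]).

    Counting. The algebra is the orthogonal sum of its simple ideals, and an
    invariant symmetric form is a multiple of the inner product on each of them
    ([simple_ideal_scalar]), so the bi-invariant forms have dimension s. Those
    vanishing on k x k are the kernel of a restriction map of rank d, whence
    b3 = s - d. *)

(** * Derivatives of multilinear expressions *)

Section Calculus.
Variable R : realType.
Implicit Types U V W : normedModType R.

Lemma near_eq_differentiable V W (f g : V -> W) (a : V) :
  (\near a, f a = g a) -> differentiable f a -> differentiable g a.
Proof.
move=> fg df; have /diff_locallyP[dc dfE] := df.
have H : g \o shift a = cst (g a) + 'd f a +o_ 0 id.
  apply/eqaddoP => e e0.
  have /eqaddoP/(_ e e0) := dfE.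
  have ga : f a = g a by exact: (nbhs_singleton fg).
  have fg0 : \forall h \near 0, f (h + a) = g (h + a).
    by move: fg; rewrite (near_shift 0) /=; apply: filterS => h /=; rewrite subr0.
  by apply: filterS2 fg0 => h /= fgh; rewrite !fctE /= fgh ga.
apply/diff_locallyP.
suff dE : 'd g a = 'd f a :> (V -> W) by rewrite dE; split.
exact: diff_unique.
Qed.

Lemma derive_comp U V W (f : U -> V) (g : V -> W) x v :
  differentiable f x -> differentiable g (f x) ->
  'D_v (g \o f) x = 'D_('D_v f x) g (f x).
Proof.
move=> df dg; rewrite (deriveE _ df) (deriveE _ dg) deriveE; last first.
  exact: differentiable_comp.
by rewrite diff_comp.
Qed.

Lemma derive_linear V W (f : V -> W) x : differentiable f x ->
  linear (fun v => 'D_v f x).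
Proof. by move=> df k u v; rewrite !deriveE// linearP. Qed.

Lemma scale_is_bilinear W :
  bilinear_for
    (GRing.Scale.Law.clone _ _ *:%R _) (GRing.Scale.Law.clone _ _ *:%R _)
    (@GRing.scale R W : R^o -> W -> W).
Proof.
split=> [u'|u] a x y /=.
- by rewrite scalerDl scalerA.
- by rewrite scalerDr !scalerA mulrC.
Qed.
Definition scale_bilinear W : {bilinear R^o -> W -> W} :=
  HB.pack (@GRing.scale R W : R^o -> W -> W) (bilinear_isBilinear.Build R R^o W W _ _ (@GRing.scale R W : R^o -> W -> W) (scale_is_bilinear W)).

Lemma is_diff_scale U W (k : U -> R^o) (g : U -> W) x :
  differentiable k x -> differentiable g x ->
  is_diff x (fun y => k y *: g y) (fun v => k x *: 'd g x v + 'd k x v *: g x).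
Proof.
move=> dk dg.
have sc : continuous (fun p : R^o * W => scale_bilinear W p.1 p.2).
  exact: scale_continuous.
have h1 := differentiable_bilin (f:=scale_bilinear W) (k x, g x) sc.
have h2 := diff_bilin (f:=scale_bilinear W) (k x, g x) sc.
have dp := differentiable_pair dk dg.
apply: DiffDef; first exact: (differentiable_comp dp h1).
rewrite (diff_comp dp h1).
apply/funext => v /=.
rewrite h2 diff_pair //=.
Qed.

(** Multilinear maps on row vectors are polynomial in the coordinates, so the
    product rule for scaling is all that their derivatives need. *)
Lemma linear_row_sum (W : lmodType R) n (L : 'rV[R]_n -> W) : linear L ->
  forall u, L u = \sum_(i < n) u ord0 i *: L (delta_mx ord0 i).
Proof.
move=> linL u.
pose lM := GRing.isLinear.Build _ _ _ _ _ linL.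
pose l : {linear 'rV[R]_n -> W} := HB.pack L lM.
rewrite -[L u]/(l u) {1}(row_sum_delta u) linear_sum.
by apply: eq_bigr => i _; rewrite linearZ.
Qed.

Lemma differentiable_row_coord U n (f : U -> 'rV[R]_n) x i :
  differentiable f x -> differentiable (fun y => f y ord0 i : R^o) x.
Proof.
move=> df; have dc := differentiable_coord (f x) ord0 i.
exact: (differentiable_comp df dc).
Qed.

Lemma derive_row_coord U n (f : U -> 'rV[R]_n) x v i :
  differentiable f x -> 'D_v (fun y => f y ord0 i : R^o) x = ('D_v f x) ord0 i.
Proof.
move=> df; rewrite derive_mx ?mxE//; exact: diff_derivable.
Qed.

Lemma derivative_sum U W n (h : 'I_n -> U -> W) x v (dh : 'I_n -> W) :
  (forall i, differentiable (h i) x) -> (forall i, 'D_v (h i) x = dh i) ->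
  differentiable (fun y => \sum_i h i y) x /\
  'D_v (fun y => \sum_i h i y) x = \sum_i dh i.
Proof.
move=> dfh dE.
have -> : (fun y => \sum_i h i y) = \sum_i h i.
  by apply/funext => y; rewrite fct_sumE.
split; first exact: differentiable_sum.
rewrite derive_sum => [|i]; first exact: eq_bigr.
exact: diff_derivable.
Qed.

Lemma derivative_scale U W (k : U -> R^o) (g : U -> W) x v :
  differentiable k x -> differentiable g x ->
  differentiable (fun y => k y *: g y) x /\
  'D_v (fun y => k y *: g y) x = k x *: 'D_v g x + 'D_v k x *: g x.
Proof.
move=> dk dg; have [d e] := is_diff_scale dk dg; split=> //.
by rewrite (deriveE _ d) e (deriveE _ dk) (deriveE _ dg).
Qed.

Lemma derivative_comb U W (k : R) (f g : U -> W) x v :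
  differentiable f x -> differentiable g x ->
  'D_v (fun y => k *: f y + g y) x = k *: 'D_v f x + 'D_v g x.
Proof.
move=> /diff_derivable df /diff_derivable dg.
rewrite -(deriveZ k (df v)) -deriveD//; exact: derivableZ.
Qed.

Lemma derivative_linear U W n (L : 'rV[R]_n -> W) (f : U -> 'rV[R]_n) x :
  linear L -> differentiable f x ->
  differentiable (fun y => L (f y)) x /\
  forall v, 'D_v (fun y => L (f y)) x = L ('D_v f x).
Proof.
move=> linL df.
pose h i y := f y ord0 i *: L (delta_mx ord0 i).
have -> : (fun y => L (f y)) = (fun y => \sum_i h i y).
  by apply/funext => y; rewrite linear_row_sum.
have dh i v : differentiable (h i) x /\
    'D_v (h i) x = ('D_v f x) ord0 i *: L (delta_mx ord0 i).
  have [d e] := derivative_scale v (differentiable_row_coord i df) (differentiable_cst (L (delta_mx ord0 i)) x).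
  by split=> //; rewrite e derive_cst scaler0 add0r derive_row_coord.
split=> [|v].
  by have [] := derivative_sum (fun i => (dh i 0).1) (fun i => (dh i 0).2).
have [_ ->] := derivative_sum (fun i => (dh i v).1) (fun i => (dh i v).2).
by rewrite [RHS]linear_row_sum.
Qed.

Lemma derivative_bilinear U W n m (B : 'rV[R]_n -> 'rV[R]_m -> W)
    (f : U -> 'rV[R]_n) (g : U -> 'rV[R]_m) x :
  (forall u, linear (B u)) -> (forall v, linear (B ^~ v)) ->
  differentiable f x -> differentiable g x ->
  differentiable (fun y => B (f y) (g y)) x /\
  forall v, 'D_v (fun y => B (f y) (g y)) x =
            B ('D_v f x) (g x) + B (f x) ('D_v g x).
Proof.
move=> linr linl df dg.
pose h i y := f y ord0 i *: B (delta_mx ord0 i) (g y).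
have -> : (fun y => B (f y) (g y)) = (fun y => \sum_i h i y).
  by apply/funext => y; rewrite (linear_row_sum (linl (g y))).
have dh i v : differentiable (h i) x /\
    'D_v (h i) x = f x ord0 i *: B (delta_mx ord0 i) ('D_v g x) +
                   ('D_v f x) ord0 i *: B (delta_mx ord0 i) (g x).
  have [dB eB] := derivative_linear (linr (delta_mx ord0 i)) dg.
  have [d e] := derivative_scale v (differentiable_row_coord i df) dB.
  by split=> //; rewrite e eB derive_row_coord.
split=> [|v].
  by have [] := derivative_sum (fun i => (dh i 0).1) (fun i => (dh i 0).2).
have [_ ->] := derivative_sum (fun i => (dh i v).1) (fun i => (dh i v).2).
by rewrite big_split /= addrC -(linear_row_sum (linl _)) -(linear_row_sum (linl _)).
Qed.

Lemma derivative_trilinear U W n (T : 'rV[R]_n -> 'rV[R]_n -> 'rV[R]_n -> W)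
    (f g k : U -> 'rV[R]_n) x :
  (forall u v, linear (T u v)) -> (forall u w, linear (T u ^~ w)) ->
  (forall v w, linear (fun u => T u v w)) ->
  differentiable f x -> differentiable g x -> differentiable k x ->
  differentiable (fun y => T (f y) (g y) (k y)) x /\
  forall v, 'D_v (fun y => T (f y) (g y) (k y)) x =
    T ('D_v f x) (g x) (k x) + T (f x) ('D_v g x) (k x)
    + T (f x) (g x) ('D_v k x).
Proof.
move=> lin3 lin2 lin1 df dg dk.
pose h i y := f y ord0 i *: T (delta_mx ord0 i) (g y) (k y).
have -> : (fun y => T (f y) (g y) (k y)) = (fun y => \sum_i h i y).
  by apply/funext => y; rewrite (linear_row_sum (lin1 (g y) (k y))).
have dh i v : differentiable (h i) x /\
    'D_v (h i) x = (f x ord0 i *: T (delta_mx ord0 i) ('D_v g x) (k x) +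
                   f x ord0 i *: T (delta_mx ord0 i) (g x) ('D_v k x)) +
                   ('D_v f x) ord0 i *: T (delta_mx ord0 i) (g x) (k x).
  have [dB eB] := derivative_bilinear (lin3 (delta_mx ord0 i))
    (lin2 (delta_mx ord0 i)) dg dk.
  have [d e] := derivative_scale v (differentiable_row_coord i df) dB.
  by split=> //; rewrite e eB derive_row_coord// scalerDr.
split=> [|v].
  by have [] := derivative_sum (fun i => (dh i 0).1) (fun i => (dh i 0).2).
have [_ ->] := derivative_sum (fun i => (dh i v).1) (fun i => (dh i v).2).
rewrite !big_split /= addrC -addrA.
by rewrite -(linear_row_sum (lin1 _ _)) -(linear_row_sum (lin1 _ _))
  -(linear_row_sum (lin1 _ _)) addrA.
Qed.

End Calculus.

(** * Mean values and second derivatives *)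

Section MeanValue.
Variable R : realType.
Implicit Types V : normedModType R.

Lemma is_derive_line V (f : V -> R^o) (q v : V) (t : R) :
  differentiable f (q + t *: v) ->
  is_derive t 1 (fun s : R => f (q + s *: v) : R^o) ('D_v f (q + t *: v)).
Proof.
move=> df.
have dl : is_diff t (fun s : R => q + s *: v) (fun s => s *: v).
  have h := is_diffD (is_diff_cst q t) (is_diff_scalel t v).
  by rewrite add0r in h.
have [dl1 dl2] := dl.
have dc := differentiable_comp dl1 df.
apply: DeriveDef; first exact: (diff_derivable dc).
have -> := derive_comp (1 : R) dl1 df.
by rewrite (deriveE _ dl1) dl2 scale1r.
Qed.

Lemma mean_value_line V (f : V -> R^o) (q v : V) (s : R) : 0 < s ->
  (forall t : R, 0 <= t <= s -> differentiable f (q + t *: v)) ->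
  exists2 c : R, 0 <= c <= s & f (q + s *: v) - f q = s * 'D_v f (q + c *: v).
Proof.
move=> s0 df.
have dl t : 0 <= t <= s -> is_derive t 1 (fun s : R => f (q + s *: v) : R^o)
    ('D_v f (q + t *: v)).
  by move=> /df; exact: is_derive_line.
have [|| c cs] := @MVT R (fun t => f (q + t *: v)) (fun t => 'D_v f (q + t *: v)) 0 s s0.
- by move=> x; rewrite in_itv /= => /andP[/ltW x0 /ltW xs]; apply: dl; rewrite x0.
- apply: derivable_within_continuous => x; rewrite in_itv /= => xs.
  by have [] := dl x xs.
rewrite scale0r addr0 subr0 mulrC => ->; exists c => //.
by move: cs; rewrite in_itv /= => /andP[/ltW -> /ltW ->].
Qed.

Lemma derive0_ball_cst V (f : V -> R^o) (q : V) (r : R) :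
  (forall y, ball q r y -> differentiable f y) ->
  (forall y v, ball q r y -> 'D_v f y = 0) ->
  forall y, ball q r y -> f y = f q.
Proof.
move=> df d0 y qy.
have inb t : 0 <= t <= 1 -> ball q r (q + t *: (y - q)).
  move=> /andP[t0 t1]; move: qy; rewrite -!ball_normE /= opprD addNKr normrN.
  rewrite normrZ distrC (ger0_norm t0) => /le_lt_trans; apply.
  by rewrite ler_piMl.
have [||c c1] := @mean_value_line V f q (y - q) 1 => //.
  by move=> t t1; apply: df; exact: inb.
rewrite d0; last exact: inb.
by rewrite mulr0 scale1r addrCA subrr addr0 => /eqP; rewrite subr_eq0 => /eqP.
Qed.

Lemma small_combination V (q u v : V) (A : set V) : nbhs q A ->
  exists2 d : R, 0 < d & forall a b : R, 0 <= a <= d -> 0 <= b <= d ->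
    A (q + a *: u + b *: v).
Proof.
move=> /nbhs_ballP[r /= r0 rA].
have n0 : 0 < `|u| + `|v| + 1 by rewrite ltr_wpDl// addr_ge0.
exists (r / (`|u| + `|v| + 1) / 2); first by rewrite divr_gt0// divr_gt0.
move=> a b /andP[a0 ad] /andP[b0 bd]; apply: rA.
rewrite -ball_normE /= -addrA opprD addNKr normrN.
apply: (le_lt_trans (ler_normD _ _)); rewrite !normrZ (ger0_norm a0) (ger0_norm b0).
set d := _ / 2 in ad bd; have d0 : 0 <= d by exact: le_trans a0 ad.
apply: (@le_lt_trans _ _ (d * (`|u| + `|v| + 1))).
  by rewrite mulrDr mulrDr mulr1 ler_wpDr// lerD// ler_wpM2r.
rewrite /d mulrAC divfK ?gt_eqF//.
by rewrite ltr_pdivrMr// ltr_pMr// ltr1n.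
Qed.

(** Both second derivatives are limits of the same second difference quotient,
    by two applications of the mean value theorem. *)
Lemma second_difference V (f fu fuv : V -> R^o) (u v q : V) (A : set V) :
  nbhs q A ->
  (forall y, A y -> differentiable f y) -> (forall y, A y -> 'D_u f y = fu y) ->
  (forall y, A y -> differentiable fu y) ->
  (forall y, A y -> 'D_v fu y = fuv y) ->
  exists2 d : R, 0 < d & forall s : R, 0 < s <= d ->
    exists c c' : R, [/\ 0 <= c <= s, 0 <= c' <= s &
      f (q + s *: u + s *: v) - f (q + s *: u) - (f (q + s *: v) - f q) =
        s * (s * fuv (q + c *: u + c' *: v))].
Proof.
move=> qA df fuE dfu fuvE; have [d d0 dA] := small_combination u v qA.
exists d => // s /andP[s0 sd].
have sd' : 0 <= s <= d by rewrite (ltW s0).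
have ts t : 0 <= t <= s -> 0 <= t <= d.
  by move=> /andP[-> ts] /=; exact: le_trans sd.
have d00 : (0 : R) <= 0 <= d by rewrite lexx ltW.
pose g y := f (y + s *: v) - f y.
have dsh y : A (y + s *: v) -> differentiable (fun y => f (y + s *: v)) y /\
    'D_u (fun y => f (y + s *: v)) y = fu (y + s *: v).
  move=> Ay.
  have ds : is_diff y (fun y => y + s *: v) id.
    have h := is_diffD (is_diff_id y) (is_diff_cst (s *: v) y).
    by rewrite addr0 in h.
  have [d1 d2] := ds; have dfy := df _ Ay.
  split; first exact: (differentiable_comp d1 dfy).
  have -> := derive_comp u d1 dfy.
  by rewrite (deriveE _ d1) d2 fuE.
have A0 t : 0 <= t <= s -> A (q + t *: u).
  by move=> /ts td; have := dA t 0 td d00; rewrite scale0r addr0.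
have As t : 0 <= t <= s -> A (q + t *: u + s *: v).
  by move=> /ts td; exact: dA.
have dg t : 0 <= t <= s -> differentiable g (q + t *: u) /\
   'D_u g (q + t *: u) = fu (q + t *: u + s *: v) - fu (q + t *: u).
  move=> t01; have [e1 e2] := dsh _ (As _ t01); have e3 := df _ (A0 _ t01).
  have h := differentiableB e1 e3.
  split; first exact: h.
  have -> : g = (fun y => f (y + s *: v)) - f by apply/funext.
  rewrite deriveB; [|exact: diff_derivable|exact: diff_derivable].
  by rewrite e2 (fuE _ (A0 _ t01)).
have [c cs] := mean_value_line s0 (fun t h => (dg t h).1).
rewrite (dg c cs).2 /g => E1.
have [t t01|c' cs' E2] := @mean_value_line _ fu (q + c *: u) v s s0.
  by apply: dfu; apply: dA; exact: ts.
exists c, c'; split=> //.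
rewrite E1 E2 fuvE //.
by apply: dA; exact: ts.
Qed.

(** The derivatives are given by separate functions because the formulas for
    them hold near q only. *)
Lemma symmetric_second_derivative V (f fu fv fuv fvu : V -> R^o)
    (u v q : V) (A : set V) :
  nbhs q A ->
  (forall y, A y -> differentiable f y) ->
  (forall y, A y -> 'D_u f y = fu y) -> (forall y, A y -> 'D_v f y = fv y) ->
  (forall y, A y -> differentiable fu y) ->
  (forall y, A y -> differentiable fv y) ->
  (forall y, A y -> 'D_v fu y = fuv y) -> (forall y, A y -> 'D_u fv y = fvu y) ->
  {for q, continuous fuv} -> {for q, continuous fvu} ->
  fuv q = fvu q.
Proof.
move=> qA df fuE fvE dfu dfv fuvE fvuE cuv cvu.
have [d1 d10 H1] := second_difference qA df fuE dfu fuvE.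
have [d2 d20 H2] := second_difference qA df fvE dfv fvuE.
apply/eqP; rewrite -subr_eq0 -normr_le0; apply/ler_addgt0Pr => /= e e0; rewrite add0r.
have e20 : 0 < e / 2 by rewrite divr_gt0.
have [d3 d30 H3] := small_combination u v (cuv _ (nbhsx_ballx _ _ e20)).
have [d4 d40 H4] := small_combination v u (cvu _ (nbhsx_ballx _ _ e20)).
pose s := Num.min (Num.min d1 d2) (Num.min d3 d4).
have s0 : 0 < s by rewrite !lt_min d10 d20 d30.
have [s1 s2 s3 s4] : [/\ s <= d1, s <= d2, s <= d3 & s <= d4].
  by rewrite /s !ge_min !lexx !orbT.
have [|a [b [as' bs E1]]] := H1 s; first by rewrite s0.
have [|a' [b' [as2 bs2 E2]]] := H2 s; first by rewrite s0.
have le t d : 0 <= t <= s -> s <= d -> 0 <= t <= d.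
  by move=> /andP[-> h] /(le_trans h).
have := H3 a b (le _ _ as' s3) (le _ _ bs s3).
have := H4 a' b' (le _ _ as2 s4) (le _ _ bs2 s4).
rewrite /= -!ball_normE /=.
have -> : fuv (q + a *: u + b *: v) = fvu (q + a' *: v + b' *: u).
  have sn0 : s != 0 by rewrite gt_eqF.
  apply: (mulfI sn0); apply: (mulfI sn0); rewrite -E1 -E2.
  by rewrite (addrAC q); lra.
set w := fvu (_ + _) => h1 h2.
have -> : fuv q - fvu q = (fuv q - w) - (fvu q - w) by lra.
rewrite (le_trans (ler_normB _ _))// ltW// (splitr e).
by rewrite ltrD.
Qed.

End MeanValue.

(** * Multiplication and inversion in charts *)

Section Charts.
Variables (R : realType) (n : nat) (G : lieGroupType R n).
Implicit Types a b d : chart R n G.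

Lemma cimgP a g : cdom a g -> cimg a (cmap a g).
Proof. by move=> ag; exists g. Qed.

Lemma cdom_cinv a x : cimg a x -> cdom a (cinv a x).
Proof. by move=> [g ag <-]; rewrite cmapK. Qed.

Lemma cinvK a x : cimg a x -> cmap a (cinv a x) = x.
Proof. by move=> [g ag <-]; rewrite cmapK. Qed.

Lemma cmap_continuous_at a g : cdom a g -> {for g, continuous (cmap a)}.
Proof.
move=> ag; have := @cmap_continuous R n G a.
by rewrite continuous_open_subspace; [apply; rewrite inE|exact: cdom_open].
Qed.

Lemma cinv_continuous_at a x : cimg a x -> {for x, continuous (cinv a)}.
Proof.
move=> ax; have := @cinv_continuous R n G a.
by rewrite continuous_open_subspace; [apply; rewrite inE|exact: cimg_open].
Qed.

Lemma near_cimg a x : cimg a x -> \near x, cimg a x.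
Proof. by move=> ax; apply: open_nbhs_nbhs; split=> //; exact: cimg_open. Qed.

Lemma near_cdom a g : cdom a g -> \near g, cdom a g.
Proof. by move=> ax; apply: open_nbhs_nbhs; split=> //; exact: cdom_open. Qed.

Lemma continuous_mulg (T : topologicalType) (f k : T -> G) x :
  {for x, continuous f} -> {for x, continuous k} ->
  {for x, continuous (fun t => f t * k t)%g}.
Proof.
move=> cf ck P Pxy.
have [[A B] [/= gA hB] AB] := @mulg_continuous R n G (f x, k x) P Pxy.
have h1 : nbhs x (f @^-1` A) by exact: cf.
have h2 : nbhs x (k @^-1` B) by exact: ck.
have : nbhs x [set t | P (f t * k t)%g].
  by apply: filterS2 h1 h2 => t ft kt; exact: (AB (f t, k t)).
exact.
Qed.

Lemma continuous_cstg (T : topologicalType) (h : G) (x : T) :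
  {for x, continuous (fun=> h)}.
Proof. exact: cst_continuous. Qed.

Definition mul_ch a b d (xy : 'rV[R]_n * 'rV[R]_n) : 'rV[R]_n :=
  cmap d (cinv a xy.1 * cinv b xy.2)%g.

Definition inv_ch a b (x : 'rV[R]_n) : 'rV[R]_n := cmap b (cinv a x)^-1%g.

Definition mul_dom a b d : set ('rV[R]_n * 'rV[R]_n) :=
  [set xy | [/\ cimg a xy.1, cimg b xy.2 & cdom d (cinv a xy.1 * cinv b xy.2)%g]].

Lemma near_mul_dom a b d xy : mul_dom a b d xy -> \near xy, mul_dom a b d xy.
Proof.
case: xy => x y [/= ax bx dxy].
have c1 : {for (x, y), continuous (fun xy : 'rV[R]_n * 'rV[R]_n =>
    (cinv a xy.1 * cinv b xy.2)%g)}.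
  apply: continuous_mulg => P nP.
    by exists (cinv a @^-1` P, setT) => [|[u v] [] //]; split;
      [exact: (cinv_continuous_at ax nP)|exact: filterT].
  by exists (setT, cinv b @^-1` P) => [|[u v] [] //]; split;
    [exact: filterT|exact: (cinv_continuous_at bx nP)].
have h1 : nbhs (x, y) [set xy : 'rV[R]_n * 'rV[R]_n |
    cdom d (cinv a xy.1 * cinv b xy.2)%g] := c1 _ (near_cdom dxy).
have h2 : nbhs (x, y) [set xy : 'rV[R]_n * 'rV[R]_n | cimg a xy.1]
    by exists (cimg a, setT) => [|[u v] [] //]; split; [exact: near_cimg|exact: filterT].
have h3 : nbhs (x, y) [set xy : 'rV[R]_n * 'rV[R]_n | cimg b xy.2]
    by exists (setT, cimg b) => [|[u v] [] //]; split; [exact: filterT|exact: near_cimg].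
by apply: filterS3 h1 h2 h3 => -[u v] *; split.
Qed.

Section Smooth.
Variables (a b d : chart R n G).
Hypotheses (aa : atlas a) (ab : atlas b) (ad : atlas d).

Lemma mul_ch_differentiable xy : mul_dom a b d xy ->
  differentiable (mul_ch a b d) xy.
Proof. by move=> h; have [/(_ _ h)] := mulg_smooth _ _ _ aa ab ad 1%N. Qed.

Lemma derive_mul_ch_differentiable v xy : mul_dom a b d xy ->
  differentiable ('D_v (mul_ch a b d)) xy.
Proof. by move=> h; have [_ /(_ v)[/(_ _ h)]] := mulg_smooth _ _ _ aa ab ad 2%N. Qed.

Lemma derive2_mul_ch_continuous v w xy : mul_dom a b d xy ->
  {for xy, continuous ('D_w ('D_v (mul_ch a b d)))}.
Proof.
by move=> h; have [_ /(_ v)[_ /(_ w)/(_ _ h)]] := mulg_smooth _ _ _ aa ab ad 2%N.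
Qed.

Lemma inv_ch_differentiable x : cimg a x -> cdom b (cinv a x)^-1%g ->
  differentiable (inv_ch a b) x.
Proof. by move=> ax bx; have [/(_ _ (conj ax bx))] := invg_smooth _ _ aa ab 1%N. Qed.

End Smooth.

End Charts.

(** * The adjoint action and the bracket *)

Lemma derivative_pair (R : realType) (U V W Z : normedModType R)
    (F : V * W -> Z) (f : U -> V) (g : U -> W) x :
  differentiable f x -> differentiable g x -> differentiable F (f x, g x) ->
  differentiable (fun u => F (f u, g u)) x /\
  forall v df dg, 'D_v f x = df -> 'D_v g x = dg ->
    'D_v (fun u => F (f u, g u)) x = 'D_(df, dg) F (f x, g x).
Proof.
move=> df dg dF; have dp := differentiable_pair df dg.
split; first exact: (differentiable_comp dp dF).
move=> v _ _ <- <-; have -> := derive_comp v dp dF.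
by rewrite (deriveE _ dp) diff_pair// -(deriveE _ df) -(deriveE _ dg).
Qed.

Lemma derivative_pairl (R : realType) (V W Z : normedModType R)
    (F : V * W -> Z) x y : differentiable F (x, y) ->
  differentiable (fun u => F (u, y)) x /\
  forall v, 'D_v (fun u => F (u, y)) x = 'D_(v, 0) F (x, y).
Proof.
move=> dF.
have [d e] := derivative_pair (ex_diff (is_diff_def := is_diff_id x))
  (differentiable_cst y x) dF.
split; [exact: d|move=> v; exact: (e v _ _ (derive_id x v) (derive_cst y x v))].
Qed.

Lemma derivative_pairr (R : realType) (V W Z : normedModType R)
    (F : V * W -> Z) x y : differentiable F (x, y) ->
  differentiable (fun u => F (x, u)) y /\
  forall v, 'D_v (fun u => F (x, u)) y = 'D_(0, v) F (x, y).
Proof.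
move=> dF.
have [d e] := derivative_pair (differentiable_cst x y)
  (ex_diff (is_diff_def := is_diff_id y)) dF.
split; [exact: d|move=> v; exact: (e v _ _ (derive_cst x y v) (derive_id y v))].
Qed.

Lemma derive_linearl (R : realType) (V W Z : normedModType R)
    (F : V * W -> Z) p : differentiable F p -> linear (fun v => 'D_(v, 0) F p).
Proof.
move=> dF k u v; rewrite -(derive_linear dF); congr ('D_ _ _ _).
by rewrite /GRing.add /GRing.scale /= /add_pair /scale_pair /= scaler0 addr0.
Qed.

Lemma near_pairr (S T : topologicalType) (x : S) (y : T) (P : set (S * T)) :
  nbhs (x, y) P -> \forall z \near y, P (x, z).
Proof.
move=> [[A B] [/= xA yB] AB]; apply: filterS yB => z Bz.
by apply: (AB (x, z)); split=> //=; exact: nbhs_singleton xA.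
Qed.

Lemma alternating_skew (R : nzRingType) (V W : lmodType R) (b : V -> V -> W) :
  (forall X, linear (b X)) -> (forall Y, linear (b ^~ Y)) ->
  (forall X, b X X = 0) -> forall X Y, b X Y = - b Y X.
Proof.
move=> lr ll alt X Y; have := alt (X + Y).
have := lr (X + Y) 1 X Y; rewrite !scale1r => ->.
have := ll X 1 X Y; rewrite /= !scale1r => ->.
have := ll Y 1 X Y; rewrite /= !scale1r => ->.
by rewrite !alt add0r addr0 addrC => /eqP; rewrite addr_eq0 => /eqP.
Qed.

Section AdjointAction.
Variables (R : realType) (n : nat) (G : lieGroupType R n) (c : chart R n G).
Hypothesis hc : chart_at_one c.
Local Notation x0 := (cmap c 1%g).
Local Notation g := 'rV[R]_n.

Let ac : atlas c. Proof. by case: hc. Qed.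
Let c1 : cdom c 1%g. Proof. by case: hc. Qed.
Let cx0 : cimg c x0. Proof. exact: cimgP. Qed.
Let cinvx0 : cinv c x0 = 1%g. Proof. by rewrite cmapK. Qed.

Definition conj_ch (h : G) (y : g) : g := cmap c (h * cinv c y * h^-1)%g.

Lemma conj_ch1 h : conj_ch h x0 = x0.
Proof. by rewrite /conj_ch cinvx0 mulg1 mulgV. Qed.

Lemma near_conj h : \forall y \near x0, cdom c (h * cinv c y * h^-1)%g.
Proof.
have cc : {for x0, continuous (fun y : g => (h * cinv c y * h^-1)%g : G)}.
  apply: continuous_mulg; last exact: continuous_cstg.
  by apply: continuous_mulg; [exact: continuous_cstg|exact: cinv_continuous_at].
by apply: cc; rewrite cinvx0 mulg1 mulgV; exact: near_cdom.
Qed.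

(** Conjugation is y |-> (h y) h^-1. Reading h in the chart a and h^-1 in the
    chart b makes both factors products in charts, so that the derivative is
    an iterated partial derivative of the multiplication in which h enters
    through its coordinates. *)
Lemma Ad_chart a b x : atlas a -> atlas b -> cimg a x -> cdom b (cinv a x)^-1%g ->
  differentiable (conj_ch (cinv a x)) x0 /\
  forall Y, Ad c (cinv a x) Y =
    'D_('D_(0, Y) (mul_ch a c a) (x, x0), 0) (mul_ch a b c) (x, inv_ch a b x).
Proof.
move=> aa ab ax bx; set h := cinv a x.
have d1 : mul_dom a c a (x, x0) by split=> //=; rewrite cinvx0 mulg1; exact: cdom_cinv.
have m1x : mul_ch a c a (x, x0) = x by rewrite /mul_ch /= cinvx0 mulg1 cinvK.
have d2 : mul_dom a b c (x, inv_ch a b x).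
  by split=> //=; [exact: cimgP|rewrite cmapK// mulgV].
pose F1 (y : g) := mul_ch a c a (x, y).
have [e1 f1] : differentiable F1 x0 /\ forall v, 'D_v F1 x0 = _ :=
  derivative_pairr (mul_ch_differentiable aa ac aa d1).
have F1x : F1 x0 = x by [].
have d2' : differentiable (mul_ch a b c) (F1 x0, inv_ch a b x).
  by rewrite F1x; exact: mul_ch_differentiable.
have [e2 f2] := derivative_pair e1 (differentiable_cst (inv_ch a b x) x0) d2'.
have near1 : \forall y \near x0,
   mul_ch a b c (F1 y, inv_ch a b x) = conj_ch h y.
  have nd : \forall y \near x0, mul_dom a c a (x, y).
    exact: (near_pairr (near_mul_dom d1)).
  apply: filterS nd => y [/= _ cy ay].
  by rewrite /mul_ch /F1 /mul_ch /= /inv_ch !cmapK.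
split; first exact: near_eq_differentiable near1 e2.
move=> Y; refine (etrans (esym (near_eq_derive _ near1)) _).
by have := f2 Y _ _ (f1 Y) (derive_cst _ x0 Y); rewrite F1x.
Qed.

Lemma conj_ch_differentiable h : differentiable (conj_ch h) x0.
Proof.
have [a aa ah] := atlas_cover h; have [b ab bh] := atlas_cover h^-1%g.
have := @Ad_chart a b (cmap a h) aa ab (cimgP ah).
by rewrite cmapK// => /(_ bh)[].
Qed.

Lemma AdE h Y : Ad c h Y = 'D_Y (conj_ch h) x0. Proof. by []. Qed.

Lemma Ad_linear h : linear (Ad c h).
Proof. exact: derive_linear (conj_ch_differentiable h). Qed.

Lemma Ad1 Y : Ad c 1%g Y = Y.
Proof.
rewrite AdE -[RHS](derive_id x0 Y); apply: near_eq_derive.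
apply: filterS (near_cimg cx0) => y cy.
by rewrite /conj_ch mul1g invg1 mulg1 cinvK.
Qed.

Lemma AdM h k Y : Ad c (h * k)%g Y = Ad c h (Ad c k Y).
Proof.
have dk := conj_ch_differentiable k.
have dh : differentiable (conj_ch h) (conj_ch k x0).
  by rewrite conj_ch1; exact: conj_ch_differentiable.
have := derive_comp Y dk dh; rewrite conj_ch1 => E; rewrite !AdE -E.
apply: near_eq_derive.
apply: filterS (near_conj k) => y cy.
by rewrite /conj_ch /= cmapK// invgM !mulgA.
Qed.

(** In [Ad_chart] the direction of the outer derivative depends on the point.
    Expanding that direction on the standard basis leaves derivatives in fixed
    directions, whose differentiability is the smoothness of the
    multiplication. *)
Lemma Ad_differentiable a h Y : atlas a -> cdom a h ->
  differentiable (fun x => Ad c (cinv a x) Y) (cmap a h).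
Proof.
move=> aa ah; have [b ab bh] := atlas_cover h^-1%g.
set x := cmap a h; have ax : cimg a x by exact: cimgP.
have xh : cinv a x = h by exact: cmapK.
pose W y := 'D_(0, Y) (mul_ch a c a) (y, x0).
pose F y := \sum_i W y ord0 i *:
  'D_(delta_mx ord0 i, 0) (mul_ch a b c) (y, inv_ch a b y).
have dom1 y : cimg a y -> mul_dom a c a (y, x0).
  by move=> ay; split=> //=; rewrite cinvx0 mulg1; exact: cdom_cinv.
have dom2 y : cimg a y -> cdom b (cinv a y)^-1%g ->
    mul_dom a b c (y, inv_ch a b y).
  by move=> ay by_; split=> //=; [exact: cimgP|rewrite cmapK// mulgV].
have nF : \forall y \near x, F y = Ad c (cinv a y) Y.
  have nb : \forall y \near x, cdom b (cinv a y)^-1%g.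
    have ci : {for x, continuous (fun y => (cinv a y)^-1%g)}.
      apply: (continuous_comp (cinv_continuous_at ax)); exact: invg_continuous.
    by apply: ci; rewrite xh; exact: near_cdom.
  apply: filterS2 (near_cimg ax) nb => y ay by_.
  have [_ ->] := @Ad_chart a b y aa ab ay by_.
  have lin := derive_linearl (mul_ch_differentiable aa ab ac (dom2 _ ay by_)).
  exact: (esym (linear_row_sum lin _)).
apply: near_eq_differentiable nF _.
have bx : cdom b (cinv a x)^-1%g by rewrite xh.
have [dW _] := derivative_pairl
  (derive_mul_ch_differentiable aa ac aa (0, Y) (dom1 _ ax)).
have dN i := derivative_pair
  (ex_diff (is_diff_def := is_diff_id x)) (inv_ch_differentiable aa ab ax bx)
  (derive_mul_ch_differentiable aa ab ac (delta_mx ord0 i, 0) (dom2 _ ax bx)).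
have dS i := (derivative_scale 0 (differentiable_row_coord i dW) (dN i).1).
by have [] := derivative_sum (fun i => (dS i).1) (fun i => (dS i).2).
Qed.

Lemma Ad_differentiable1 Y : differentiable (fun x => Ad c (cinv c x) Y) x0.
Proof. exact: Ad_differentiable. Qed.

Local Notation br := (lie_bracket c).

Lemma bracketE X Y : br X Y = 'D_X (fun x => Ad c (cinv c x) Y) x0.
Proof. by []. Qed.

Lemma bracket_linearl Y : linear (br ^~ Y).
Proof. exact: derive_linear (Ad_differentiable1 Y). Qed.

Lemma bracket_linearr X : linear (br X).
Proof.
move=> k Y Z.
have e := derivative_comb k X (Ad_differentiable1 Y) (Ad_differentiable1 Z).
refine (etrans _ e); rewrite bracketE; apply: near_eq_derive.
by apply: filterE => x; exact: Ad_linear.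
Qed.

(** Differentiating an identity of the adjoint action along a curve through 1
    replaces Ad by the bracket. *)
Lemma derive_Ad (U : normedModType R) (f : U -> g) u v Y :
  differentiable f u -> f u = x0 ->
  differentiable (fun t => Ad c (cinv c (f t)) Y) u /\
  'D_v (fun t => Ad c (cinv c (f t)) Y) u = br ('D_v f u) Y.
Proof.
move=> df fu; have dA := Ad_differentiable1 Y; rewrite -fu in dA.
split; first exact: (differentiable_comp df dA).
by have -> := derive_comp v df dA; rewrite fu.
Qed.

(** Differentiate Ad (h y h^-1) (Ad h Z) = Ad h (Ad y Z) at y = 1. *)
Lemma Ad_bracket h Y Z : Ad c h (br Y Z) = br (Ad c h Y) (Ad c h Z).
Proof.
have dh := conj_ch_differentiable h.
rewrite bracketE.
have [_ <-] := derivative_linear (Ad_linear h) (Ad_differentiable1 Z).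
have [_ <-] := derive_Ad Y (Ad c h Z) dh (conj_ch1 h).
apply: near_eq_derive; apply: filterS (near_conj h) => y cy.
rewrite -(AdM h) /conj_ch (cmapK cy) -AdM; congr (Ad c _ Z).
by rewrite mulgVK.
Qed.

(** Differentiate Ad x [Y, Z] = [Ad x Y, Ad x Z] at x = 1. *)
Lemma jacobi X Y Z : br X (br Y Z) = br (br X Y) Z + br Y (br X Z).
Proof.
rewrite [LHS]bracketE.
have -> : (fun x => Ad c (cinv c x) (br Y Z)) =
    (fun x => br (Ad c (cinv c x) Y) (Ad c (cinv c x) Z)).
  by apply/funext => x; exact: Ad_bracket.
have [_ ->] := derivative_bilinear bracket_linearr bracket_linearl
  (Ad_differentiable1 Y) (Ad_differentiable1 Z).
by rewrite cinvx0 !Ad1.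
Qed.

Local Notation m := (mul_ch c c c).

Let dom_l y : cimg c y -> mul_dom c c c (y, x0).
Proof. by move=> cy; split=> //=; rewrite cinvx0 mulg1; exact: cdom_cinv. Qed.

Let dom_r y : cimg c y -> mul_dom c c c (x0, y).
Proof. by move=> cy; split=> //=; rewrite cinvx0 mul1g; exact: cdom_cinv. Qed.

(** From x y = (x y x^-1) x, differentiated in y at 1. *)
Lemma derive_mul_swap x Y : cimg c x ->
  'D_(0, Y) m (x, x0) =
  \sum_i Ad c (cinv c x) Y ord0 i *: 'D_(delta_mx ord0 i, 0) m (x0, x).
Proof.
move=> cx; have dx := conj_ch_differentiable (cinv c x).
have [_ e1] := derivative_pairr (mul_ch_differentiable ac ac ac (dom_l cx)).
have dm : differentiable m (conj_ch (cinv c x) x0, x).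
  by rewrite conj_ch1; exact: mul_ch_differentiable (dom_r cx).
have [_ e2] := derivative_pair dx (differentiable_cst x x0) dm.
have lin := derive_linearl (mul_ch_differentiable ac ac ac (dom_r cx)).
refine (etrans _ (linear_row_sum lin _)); rewrite -e1.
have := e2 Y _ _ (erefl _) (derive_cst x x0 Y); rewrite conj_ch1 => <-.
apply: near_eq_derive; apply: filterS2 (near_conj (cinv c x)) (near_cimg cx0).
by move=> y cxy cy; rewrite /mul_ch /= /conj_ch cmapK// mulgVK.
Qed.

(** The bracket is the skew part of the second order term of the
    multiplication: differentiate [derive_mul_swap] in x at 1, where the
    derivative of the multiplication in its left factor is the identity. *)
Lemma bracket_mul_ch X Y :
  br X Y = 'D_(X, 0) ('D_(0, Y) m) (x0, x0) - 'D_(0, X) ('D_(Y, 0) m) (x0, x0).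
Proof.
have d00 := dom_l cx0.
pose e i : g := delta_mx ord0 i.
pose A i := 'D_(0, X) ('D_(e i, 0) m) (x0, x0).
have [_ E1] := derivative_pairl (derive_mul_ch_differentiable ac ac ac (0, Y) d00).
have E2 i := derivative_pairr (derive_mul_ch_differentiable ac ac ac (e i, 0) d00).
have E3 i := derivative_scale X
  (differentiable_row_coord i (Ad_differentiable1 Y)) (E2 i).1.
have [_ E4] := derivative_sum (fun i => (E3 i).1) (fun i => (E3 i).2).
have De i : 'D_(e i, 0) m (x0, x0) = e i.
  have [_ E5] := derivative_pairl (mul_ch_differentiable ac ac ac d00).
  rewrite -(E5 (e i)) -[RHS](derive_id x0); apply: near_eq_derive.
  apply: filterS (near_cimg cx0) => y cy.
  by rewrite /mul_ch /= cinvx0 mulg1 cinvK.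
have E6 : 'D_(X, 0) ('D_(0, Y) m) (x0, x0) =
    \sum_i (Y ord0 i *: A i + br X Y ord0 i *: e i).
  rewrite -(E1 X); refine (etrans _ (etrans E4 _)).
    apply: near_eq_derive; apply: filterS (near_cimg cx0) => x cx.
    exact: derive_mul_swap.
  apply: eq_bigr => i _; rewrite (E2 i).2 De cinvx0 Ad1.
  by rewrite (derive_row_coord _ _ (Ad_differentiable1 Y)).
have E7 i := derivative_scale (0, X)
  (differentiable_cst (Y ord0 i : R^o) (x0, x0))
  (derive_mul_ch_differentiable ac ac ac (e i, 0) d00).
have [_ E8] := derivative_sum (fun i => (E7 i).1) (fun i => (E7 i).2).
have E9 : 'D_(0, X) ('D_(Y, 0) m) (x0, x0) = \sum_i Y ord0 i *: A i.
  refine (etrans _ (etrans E8 _)).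
    apply: near_eq_derive; apply: filterS (near_mul_dom d00) => z dz.
    exact: (linear_row_sum (derive_linearl (mul_ch_differentiable ac ac ac dz)) Y).
  by apply: eq_bigr => i _; rewrite derive_cst scale0r addr0.
have E10 (B : g) : \sum_i (Y ord0 i *: A i + B ord0 i *: e i) =
    \sum_i Y ord0 i *: A i + B.
  by rewrite big_split /= -row_sum_delta.
have E11 (D1 D2 B : g) : D1 = D2 + B -> B = D1 - D2.
  by move=> ->; rewrite addrAC subrr add0r.
apply: E11; refine (etrans E6 (etrans (E10 _) _)).
exact: (congr1 (+%R^~ (br X Y)) (esym E9)).
Qed.

(** For equal arguments the two terms of [bracket_mul_ch] are the same mixed
    derivative taken in the two orders. *)
Lemma bracket_alternating X : br X X = 0.
Proof.
have d00 := dom_l cx0; pose u : g * g := (X, 0); pose v : g * g := (0, X).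
have cont w w' i :
    {for (x0, x0), continuous (fun y => 'D_w ('D_w' m) y ord0 i : R^o)}.
  have h := @derive2_mul_ch_continuous _ _ _ _ _ _ ac ac ac w' w _ d00.
  exact: (continuous_comp h (@coord_continuous _ _ _ ord0 i _)).
rewrite bracket_mul_ch; apply/eqP; rewrite subr_eq0; apply/eqP/rowP => i.
apply: (@symmetric_second_derivative R _ (fun y => m y ord0 i : R^o)
  (fun y => 'D_v m y ord0 i) (fun y => 'D_u m y ord0 i)
  (fun y => 'D_u ('D_v m) y ord0 i) (fun y => 'D_v ('D_u m) y ord0 i)
  v u (x0, x0) (mul_dom c c c)).
- exact: near_mul_dom.
- by move=> y dy; apply: differentiable_row_coord; exact: mul_ch_differentiable.
- by move=> y dy; rewrite derive_row_coord//; exact: mul_ch_differentiable.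
- by move=> y dy; rewrite derive_row_coord//; exact: mul_ch_differentiable.
- move=> y dy; apply: differentiable_row_coord.
  exact: derive_mul_ch_differentiable.
- move=> y dy; apply: differentiable_row_coord.
  exact: derive_mul_ch_differentiable.
- by move=> y dy; rewrite derive_row_coord//; exact: derive_mul_ch_differentiable.
- by move=> y dy; rewrite derive_row_coord//; exact: derive_mul_ch_differentiable.
- exact: cont.
- exact: cont.
Qed.

Lemma bracketC X Y : br X Y = - br Y X.
Proof.
exact: (alternating_skew bracket_linearr bracket_linearl bracket_alternating).
Qed.

End AdjointAction.

(** * Invariance under Ad and invariance under ad *)

Lemma invariant_form_comp (V W : zmodType) (Q : V -> V -> W) (f : V -> V)
    (b : V -> V -> V) :
  (forall X Y, f (b X Y) = b (f X) (f Y)) ->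
  (forall X Y Z, Q (b X Y) Z + Q Y (b X Z) = 0) ->
  forall X Y Z, Q (f (b X Y)) (f Z) + Q (f Y) (f (b X Z)) = 0.
Proof. by move=> fb bQ X Y Z; rewrite !fb bQ. Qed.

Section InfinitesimalInvariance.
Variables (R : realType) (n : nat) (G : lieGroupType R n) (c : chart R n G).
Hypothesis hc : chart_at_one c.
Local Notation x0 := (cmap c 1%g).
Local Notation g := 'rV[R]_n.
Local Notation br := (lie_bracket c).

Let ac : atlas c. Proof. by case: hc. Qed.
Let c1 : cdom c 1%g. Proof. by case: hc. Qed.
Let cx0 : cimg c x0. Proof. exact: cimgP. Qed.
Let cinvx0 : cinv c x0 = 1%g. Proof. by rewrite cmapK. Qed.

(** Velocities at 1 of curves in S. The curve f is the coordinate expression,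
    since the derivative is taken in the chart. *)
Definition tangent (S : set G) (X : g) : Prop :=
  exists f : R -> g, [/\ differentiable f (0 : R), f 0 = x0, 'D_(1 : R) f 0 = X &
    \forall t \near (0 : R), S (cinv c (f t))].

Lemma tangent_setT X : tangent setT X.
Proof.
have h := is_diffD (is_diff_cst x0 (0 : R)) (is_diff_scalel (0 : R) X).
rewrite add0r in h; have [h1 h2] := h.
exists (cst x0 + *:%R^~ X); split=> //.
- by rewrite !fctE scale0r addr0.
- by rewrite (deriveE _ h1) h2 scale1r.
- exact: filterE.
Qed.

Lemma one_parameter_subgroup1 (gamma : R -> G) X :
  one_parameter_subgroup c gamma X -> gamma 0 = 1%g.
Proof.
move=> [_ gM _]; have := gM 0 0; rewrite addr0 => e.
by apply: (@mulgI _ (gamma 0)); rewrite -e mulg1.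
Qed.

Lemma tangent_subgroup (S : set G) gamma X :
  one_parameter_subgroup c gamma X -> (forall t, S (gamma t)) -> tangent S X.
Proof.
move=> gX Sg; have g0 := one_parameter_subgroup1 gX.
case: gX => gc _ [dg Dg]; exists (cmap c \o gamma); split=> //.
- exact/derivable1_diffP.
- by rewrite /= g0.
have : \forall t \near (0 : R), cdom c (gamma t).
  by apply: gc; rewrite g0; exact: near_cdom.
by apply: filterS => t ct /=; rewrite cmapK.
Qed.

(** Along a curve in S the form is constant, and the product rule computes its
    derivative at 1. *)
Lemma infinitesimal2 (W : normedModType R) (B : g -> g -> W) S X Y Z :
  (forall u, linear (B u)) -> (forall v, linear (B ^~ v)) ->
  (forall h, S h -> B (Ad c h Y) (Ad c h Z) = B Y Z) -> tangent S X ->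
  B (br X Y) Z + B Y (br X Z) = 0.
Proof.
move=> linr linl BS [f [df f0 Df Sf]].
have [dY DY] := derive_Ad hc (1 : R) Y df f0.
have [dZ DZ] := derive_Ad hc (1 : R) Z df f0.
have [_ DB] := derivative_bilinear linr linl dY dZ.
have <- : 'D_(1 : R) (cst (B Y Z)) 0 = 0 by exact: derive_cst.
have := DB (1 : R); rewrite DY DZ f0 cinvx0 (Ad1 hc Y) (Ad1 hc Z) Df => <-; apply: near_eq_derive.
by apply: filterS Sf => t St; exact: BS.
Qed.

Lemma infinitesimal3 (W : normedModType R) (T : g -> g -> g -> W) S X Y1 Y2 Y3 :
  (forall u v, linear (T u v)) -> (forall u w, linear (T u ^~ w)) ->
  (forall v w, linear (fun u => T u v w)) ->
  (forall h, S h -> T (Ad c h Y1) (Ad c h Y2) (Ad c h Y3) = T Y1 Y2 Y3) ->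
  tangent S X ->
  T (br X Y1) Y2 Y3 + T Y1 (br X Y2) Y3 + T Y1 Y2 (br X Y3) = 0.
Proof.
move=> lin3 lin2 lin1 TS [f [df f0 Df Sf]].
have [dY1 DY1] := derive_Ad hc (1 : R) Y1 df f0.
have [dY2 DY2] := derive_Ad hc (1 : R) Y2 df f0.
have [dY3 DY3] := derive_Ad hc (1 : R) Y3 df f0.
have [_ DT] := derivative_trilinear lin3 lin2 lin1 dY1 dY2 dY3.
have <- : 'D_(1 : R) (cst (T Y1 Y2 Y3)) 0 = 0 by exact: derive_cst.
have := DT (1 : R); rewrite DY1 DY2 DY3 f0 cinvx0.
rewrite (Ad1 hc Y1) (Ad1 hc Y2) (Ad1 hc Y3) Df => <-.
apply: near_eq_derive.
by apply: filterS Sf => t St; exact: TS.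
Qed.

(** Conjugating the one-parameter subgroup of X by h gives the one of Ad h X. *)
Lemma Ad_subgroup_algebra (K : set G) (k : {vspace g}) h X :
  is_subgroup K -> is_lie_algebra_of c K k -> K h -> X \in k -> Ad c h X \in k.
Proof.
move=> [_ KM KV] Kk Kh /Kk[gamma gX Kg]; apply/Kk.
exists (fun t => h * gamma t * h^-1)%g; last first.
  by move=> t; exact: (KM _ _ (KM _ _ Kh (Kg t)) (KV _ Kh)).
have g0 := one_parameter_subgroup1 gX.
case: gX => gc gM [dg Dg]; split.
- move=> t; apply: (@continuous_mulg _ _ _ _ (fun t => h * gamma t)%g
    (fun=> h^-1%g) t); last exact: continuous_cstg.
  by apply: continuous_mulg; [exact: continuous_cstg|exact: gc].
- by move=> s t; rewrite gM !mulgA mulgVK.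
have df : differentiable (cmap c \o gamma) (0 : R) by exact/derivable1_diffP.
have dh : differentiable (conj_ch c h) ((cmap c \o gamma) 0).
  by rewrite /= g0; exact: conj_ch_differentiable.
have nE : \forall t \near (0 : R), (conj_ch c h \o (cmap c \o gamma)) t =
    (cmap c \o (fun t => h * gamma t * h^-1)%g) t.
  have : \forall t \near (0 : R), cdom c (gamma t).
    by apply: gc; rewrite g0; exact: near_cdom.
  by apply: filterS => t ct; rewrite /= /conj_ch cmapK.
have dc := near_eq_differentiable nE (differentiable_comp df dh).
apply: DeriveDef; first exact/derivable1_diffP.
rewrite -(near_eq_derive _ nE); refine (etrans (derive_comp _ df dh) _).
by rewrite Dg /= g0.
Qed.

Section Connected.
Variable Q : g -> g -> R^o.
Hypotheses (linr : forall u, linear (Q u)) (linl : forall v, linear (Q ^~ v)).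
Hypothesis adQ : forall X Y Z, Q (br X Y) Z + Q Y (br X Z) = 0.

Let QAd u A B := Q (Ad c u A) (Ad c u B).

Let QAd_linr u A : linear (QAd u A).
Proof. by move=> k Y Z; rewrite /QAd (Ad_linear hc) linr. Qed.

Let QAd_linl u B : linear (QAd u ^~ B).
Proof. by move=> k Y Z; rewrite /QAd (Ad_linear hc) linl. Qed.

(** Left translation by u^-1 moves the base point u to 1, at the price of
    replacing Q by its transform under Ad u, which is again ad-invariant. *)
Lemma derive_invariant_form y v Y Z : cimg c y ->
  differentiable (fun x => QAd (cinv c x) Y Z) y /\
  'D_v (fun x => QAd (cinv c x) Y Z) y = 0.
Proof.
move=> cy; pose u := cinv c y; have [b ab bu] := atlas_cover u^-1%g.
have cu : cdom c u by exact: cdom_cinv.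
have uy : cmap c u = y by exact: cinvK.
have dy A : differentiable (fun x => Ad c (cinv c x) A) y.
  by rewrite -uy; exact: Ad_differentiable.
split; first by have [] := derivative_bilinear linr linl (dy Y) (dy Z).
pose xi (x : g) := mul_ch b c c (cmap b u^-1%g, x).
have dm : mul_dom b c c (cmap b u^-1%g, y).
  by split=> //=; [exact: cimgP|rewrite cmapK// mulVg].
have dxi : differentiable xi y.
  by have [] := derivative_pairr (mul_ch_differentiable ab ac ac dm).
have xiy : xi y = x0 by rewrite /xi /mul_ch /= cmapK// mulVg.
have [dY DY] := derive_Ad hc v Y dxi xiy.
have [dZ DZ] := derive_Ad hc v Z dxi xiy.
have [_ DB] := derivative_bilinear (QAd_linr u) (QAd_linl u) dY dZ.
have nE : \forall x \near y, QAd u (Ad c (cinv c (xi x)) Y) (Ad c (cinv c (xi x)) Z)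
    = QAd (cinv c x) Y Z.
  have := near_pairr (near_mul_dom dm); apply: filterS => x [/= _ cx cux].
  have e1 : cinv c (xi x) = (u^-1 * cinv c x)%g.
    by move: cux; rewrite /xi /mul_ch /= (cmapK bu) => /cmapK.
  have e2 A : Ad c u (Ad c (cinv c (xi x)) A) = Ad c (cinv c x) A.
    by rewrite -(AdM hc) e1 mulgA mulgV mul1g.
  by rewrite /QAd (e2 Y) (e2 Z).
refine (etrans (esym (near_eq_derive _ nE)) (etrans (DB v) _)).
rewrite DY DZ xiy cinvx0 (Ad1 hc Y) (Ad1 hc Z) /QAd.
exact: (invariant_form_comp (Ad_bracket hc u) adQ).
Qed.

Lemma near_invariant_form Y Z : \forall x \near x0, QAd (cinv c x) Y Z = Q Y Z.
Proof.
have /nbhs_ballP[r /= r0 rc] := near_cimg cx0.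
apply/nbhs_ballP; exists r => // x xr.
have := @derive0_ball_cst R _ (fun x => QAd (cinv c x) Y Z) x0 r.
move=> /(_ _ _ x xr) ->; first by rewrite cinvx0 /QAd (Ad1 hc Y) (Ad1 hc Z).
  by move=> y /rc /(derive_invariant_form 0 Y Z)[].
by move=> y v /rc /(derive_invariant_form v Y Z)[].
Qed.

End Connected.

(** Q (Ad h Y) (Ad h Z) is locally constant in h: near any h0, left translation
    reduces it to [near_invariant_form] for the transform of Q under Ad h0. *)
Lemma Ad_invariant_of_ad_invariant (Q : g -> g -> R^o) :
  connected [set: G] ->
  (forall u, linear (Q u)) -> (forall v, linear (Q ^~ v)) ->
  (forall X Y Z, Q (br X Y) Z + Q Y (br X Z) = 0) ->
  forall h Y Z, Q (Ad c h Y) (Ad c h Z) = Q Y Z.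
Proof.
move=> Gconn linr linl adQ h Y Z.
pose F h := Q (Ad c h Y) (Ad c h Z).
have locF h0 : \forall h \near h0, F h = F h0.
  pose Q0 A B := Q (Ad c h0 A) (Ad c h0 B).
  have linr0 u : linear (Q0 u).
    by move=> k A B; rewrite /Q0 (Ad_linear hc) linr.
  have linl0 v : linear (Q0 ^~ v).
    by move=> k A B; rewrite /Q0 (Ad_linear hc) linl.
  have adQ0 A B C : Q0 (br A B) C + Q0 B (br A C) = 0.
    exact: (invariant_form_comp (Ad_bracket hc h0) adQ A B C).
  have ct : {for h0, continuous (fun h => h0^-1 * h)%g}.
    by apply: continuous_mulg; [exact: continuous_cstg|exact: cvg_id].
  have n1 : \forall h \near h0, cdom c (h0^-1 * h)%g.
    by apply: ct; rewrite mulVg; exact: near_cdom.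
  have n2 : \forall h \near h0, Q0 (Ad c (cinv c (cmap c (h0^-1 * h)%g)) Y)
      (Ad c (cinv c (cmap c (h0^-1 * h)%g)) Z) = Q0 Y Z.
    have ch0 : cdom c (h0^-1 * h0)%g by rewrite mulVg.
    have cc := continuous_comp ct (cmap_continuous_at ch0).
    have e : (cmap c \o (fun k => h0^-1 * k)%g) h0 = x0 by rewrite /= mulVg.
    have hn := near_invariant_form linr0 linl0 adQ0 Y Z.
    by rewrite -e in hn; exact: (cc _ hn).
  apply: filterS2 n1 n2 => k ck; rewrite (cmapK ck) /Q0.
  have e A : Ad c h0 (Ad c (h0^-1 * k)%g A) = Ad c k A.
    by rewrite -(AdM hc) mulgA mulgV mul1g.
  by rewrite (e Y) (e Z).
have oF (v : R) : open [set h | F h = v].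
  by rewrite openE => k /= <-; exact: locF.
have cF (v : R) : closed [set h | F h = v].
  rewrite -openC openE => k /= kv; rewrite /interior.
  by apply: filterS (locF k) => k' e; rewrite /= e.
have -> : Q Y Z = F 1%g by rewrite /F (Ad1 hc Y) (Ad1 hc Z).
have E : [set h | F h = F 1%g] = [set: G].
  apply: Gconn; first by exists 1%g.
  - by exists [set h | F h = F 1%g]; [exact: oF|rewrite setTI].
  - by exists [set h | F h = F 1%g]; [exact: cF|rewrite setTI].
have : [set: G] h by [].
by rewrite -E.
Qed.

Lemma Ad_continuous Y : continuous (fun h => Ad c h Y).
Proof.
move=> h; have [a aa ah] := atlas_cover h.
have da := @differentiable_continuous _ _ _ _ _ (Ad_differentiable hc Y aa ah).
have cc := continuous_comp (cmap_continuous_at ah) da.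
have e : Ad c (cinv a (cmap a h)) Y = Ad c h Y by rewrite cmapK.
move=> P; rewrite /= -e => /cc.
have h2 : nbhs h (cdom a) by exact: near_cdom.
move=> h1; have {}h1 : nbhs h [set k | P (Ad c (cinv a (cmap a k)) Y)] by [].
have : nbhs h [set k | P (Ad c k Y)].
  by apply: filterS2 h1 h2 => k /= + ak; rewrite (cmapK ak).
exact.
Qed.

Lemma Ad_bounded Y : compact [set: G] ->
  exists2 M : R, 0 <= M & forall h, `|Ad c h Y| <= M.
Proof.
move=> Gc; have cf : {within [set: G], continuous (fun h => `|Ad c h Y| : R)}.
  apply: continuous_subspaceT => h.
  have ch := @Ad_continuous Y h.
  exact: (continuous_comp ch (@norm_continuous _ _ _)).
have [|k _ kmax] := compact_EVT_max _ Gc cf; first by exists 1%g.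
by exists `|Ad c k Y| => // h; apply: kmax; rewrite inE.
Qed.

End InfinitesimalInvariance.

(** * Fixed points of bounded groups *)

Section FixedPoint.
Variables (R : realType) (N : nat) (T : groupType) (act : T -> 'rV[R]_N -> 'rV[R]_N).
Hypotheses (act_lin : forall h, linear (act h)) (act1 : forall v, act 1%g v = v).
Hypothesis actM : forall h k v, act (h * k)%g v = act h (act k v).
Hypothesis act_bounded : forall v, exists M : R, forall h, `|act h v| <= M.

Definition sq (v : 'rV[R]_N) : R := \sum_i v ord0 i ^+ 2.

Lemma sq_ge0 v : 0 <= sq v.
Proof. by apply: sumr_ge0 => i _; exact: sqr_ge0. Qed.

Lemma sq_eq0 v : sq v = 0 -> v = 0.
Proof.
move=> v0; apply/rowP => i; rewrite mxE; apply/eqP; rewrite -sqrf_eq0.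
have := v0; rewrite /sq => /eqP; rewrite psumr_eq0 => [/allP/(_ i)|j _].
  by rewrite mem_index_enum => /(_ isT).
exact: sqr_ge0.
Qed.

Lemma sq_parallelogram u v :
  sq (2^-1 *: (u + v)) = (sq u + sq v) / 2 - sq (u - v) / 4.
Proof.
rewrite /sq -big_split /= !mulr_suml -sumrB; apply: eq_bigr => i _.
by rewrite !mxE; field.
Qed.

Lemma entry_le_norm (v : 'rV[R]_N) i : `|v ord0 i| <= `|v|.
Proof.
rewrite [leRHS]/Num.Def.normr /= mx_normrE.
exact: (le_bigmax _ (fun ij => `|v ij.1 ij.2|) (ord0, i)).
Qed.

Lemma norm_le_sq (v : 'rV[R]_N) : `|v| ^+ 2 <= sq v.
Proof.
have h i : `|v ord0 i| ^+ 2 <= sq v.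
  rewrite real_normK ?num_real// /sq (bigD1 i)//= lerDl.
  by apply: sumr_ge0 => j _; exact: sqr_ge0.
rewrite /Num.Def.normr /=; have [->|/mx_norm_neq0[[i j] ->]] := eqVneq (mx_norm v) 0.
  by rewrite expr0n /= sq_ge0.
by rewrite /= ord1.
Qed.

Lemma cauchy_schwarz_sum (I : finType) (a b : I -> R) :
  (\sum_i a i * b i) ^+ 2 <= (\sum_i a i ^+ 2) * (\sum_i b i ^+ 2).
Proof.
set A := \sum_i a i ^+ 2; set B := \sum_i b i ^+ 2; set P := \sum_i a i * b i.
have A0 : 0 <= A by apply: sumr_ge0 => i _; exact: sqr_ge0.
have [A00|An0] := eqVneq A 0.
  have a0 i : a i = 0.
    apply/eqP; rewrite -sqrf_eq0; move/eqP: A00.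
    rewrite psumr_eq0 => [/allP/(_ i)|j _]; last exact: sqr_ge0.
    by rewrite mem_index_enum => /(_ isT).
  by rewrite A00 mul0r /P big1 ?expr0n// => i _; rewrite a0 mul0r.
have Apos : 0 < A by rewrite lt_def An0.
have : 0 <= \sum_i (A * b i - P * a i) ^+ 2.
  by apply: sumr_ge0 => i _; exact: sqr_ge0.
have -> : \sum_i (A * b i - P * a i) ^+ 2 = A * (A * B - P ^+ 2).
  transitivity (\sum_i (A ^+ 2 * b i ^+ 2 - (2 * A * P) * (a i * b i)
      + P ^+ 2 * a i ^+ 2)); first by apply: eq_bigr => i _; ring.
  rewrite big_split /= sumrB -!mulr_sumr -/A -/B -/P; ring.
by rewrite pmulr_rge0// subr_ge0.
Qed.

Lemma sq_act_bounded : exists2 C : R, 0 < C & forall h v, sq (act h v) <= C * sq v.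
Proof.
have [M MP] := choice (fun i : 'I_N => act_bounded (delta_mx ord0 i)).
pose B := \sum_(j < N) \sum_(i < N) M i ^+ 2.
have B0 : 0 <= B by apply: sumr_ge0 => j _; apply: sumr_ge0 => i _; exact: sqr_ge0.
exists (B + 1); first by rewrite ltr_wpDl.
move=> h v; apply: (@le_trans _ _ (B * sq v)); last first.
  by rewrite ler_wpM2r ?sq_ge0// lerDl.
rewrite /B mulr_suml; apply: ler_sum => j _.
rewrite (linear_row_sum (act_lin h)) summxE.
under eq_bigr do rewrite mxE.
apply: (le_trans (cauchy_schwarz_sum _ _)); rewrite mulrC ler_wpM2r ?sq_ge0//.
apply: ler_sum => i _; rewrite -real_normK ?num_real//.
have h1 := le_trans (entry_le_norm (act h (delta_mx ord0 i)) j) (MP i h).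
by rewrite ler_sqr ?nnegrE// (le_trans _ h1).
Qed.

Lemma sq_act_continuous h : continuous (fun v => sq (act h v)).
Proof.
move=> v.
have lin i : linear (fun v => act h v ord0 i : R^o).
  by move=> k u w; rewrite act_lin !mxE.
have d i := derivative_linear (lin i) (ex_diff (is_diff_def := is_diff_id v)).
have d2 i := derivative_scale 0 (d i).1 (d i).1.
have [ds _] := derivative_sum (fun i => (d2 i).1) (fun i => (d2 i).2).
exact: (differentiable_continuous ds).
Qed.

Variable P : set 'rV[R]_N.
Hypotheses (P_mid : forall u v, P u -> P v -> P (2^-1 *: (u + v))).
Hypotheses (P_closed : closed P) (P0 : P !=set0).
Hypothesis P_act : forall h v, P v -> P (act h v).

Let bd (r : R) v := forall h, sq (act h v) <= r.
Let J : set R := [set r | exists2 v, P v & bd r v].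

(** The function v |-> sup_h |act h v|^2 is invariant under the group. The
    parallelogram identity makes it strictly convex, uniformly so because
    |w|^2 <= C |act h w|^2. Hence minimising sequences in P are Cauchy, and the
    minimiser on P is unique and therefore fixed. *)
Lemma fixed_point : exists2 v, P v & forall h, act h v = v.
Proof.
have [C C0 CP] := sq_act_bounded.
have Jinf : has_inf J.
  split; last first.
    exists 0 => r [v _ /(_ 1%g)]; apply: le_trans; exact: sq_ge0.
  by have [v Pv] := P0; exists (C * sq v); exists v => // h; exact: CP.
pose m := inf J.
(* Some h moves the midpoint of u and v to a vector of square length
   almost m or more; the parallelogram identity then bounds the difference
   of act h u and act h v. *)
have key u v r s : P u -> P v -> bd r u -> bd s v ->
    sq (u - v) <= 4 * C * ((r + s) / 2 - m).
  move=> Pu Pv ru sv; apply/ler_addgt0Pr => /= e e0.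
  have d0 : 0 < e / (4 * C) by rewrite divr_gt0// mulr_gt0.
  have /existsNP[h /negP] : ~ bd (m - e / (4 * C)) (2^-1 *: (u + v)).
    move=> b; have : J (m - e / (4 * C)) by exists (2^-1 *: (u + v)) => //; exact: P_mid.
    by move=> /(ge_inf Jinf.2); rewrite -/m leNgt ltrBlDr ltrDl d0.
  rewrite -ltNge => hm.
  have := CP h^-1%g (act h (u - v)); rewrite -actM mulVg act1 => h1.
  have E : act h (2^-1 *: (u + v)) = 2^-1 *: (act h u + act h v).
    have := act_lin h 2^-1 (u + v) 0; have := act_lin h 1 u v.
    have := act_lin h (-1) 0 0; rewrite scaler0 addr0 scaleN1r addrC subrr => a0.
    by rewrite !scale1r => ->; rewrite !addr0 a0 addr0.
  have E' : act h (u - v) = act h u - act h v.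
    by have := act_lin h (-1) v u; rewrite !scaleN1r ![- _ + _]addrC.
  rewrite E sq_parallelogram -E' in hm.
  have h2 : m - e / (4 * C) < (r + s) / 2 - sq (act h (u - v)) / 4.
    by apply: (lt_le_trans hm); rewrite lerB// ler_pM2r ?invr_gt0// lerD.
  have C40 : 0 < 4 * C by rewrite mulr_gt0.
  have : 4 * C * (m - e / (4 * C)) <
      4 * C * ((r + s) / 2 - sq (act h (u - v)) / 4) by rewrite ltr_pM2l.
  have -> : 4 * C * (m - e / (4 * C)) = 4 * C * m - e.
    by rewrite mulrBr [_ * (e / _)]mulrC divfK ?gt_eqF.
  lra.
have approx k : exists v, P v /\ bd (m + k.+1%:R^-1) v.
  have k0 : 0 < k.+1%:R^-1 :> R by rewrite invr_gt0.
  have [r' [v' Pv' rv] rm] := inf_adherent k0 Jinf.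
  by exists v'; split=> // h; exact: le_trans (rv h) (ltW rm).
have [u uP] := choice approx.
have mP k e : k.+1%:R^-1 < e -> bd (m + e) (u k).
  by move=> ke h; apply: (le_trans ((uP k).2 h)); rewrite lerD2l ltW.
have near_bd e : 0 < e -> \forall k \near \oo, bd (m + e) (u k).
  by move=> e0; apply: filterS (near_infty_natSinv_lt (PosNum e0)) => k /mP.
have ucauchy : cauchy (u @ \oo).
  apply/cauchy_ballP => e e0.
  have e1 : 0 < e ^+ 2 / (4 * C) / 2 by rewrite !divr_gt0 ?exprn_gt0// mulr_gt0.
  pose A := [set v | P v /\ bd (m + e ^+ 2 / (4 * C) / 2) v].
  have nA : \forall k \near \oo, A (u k).
    by apply: filterS (near_bd _ e1) => k bk; split=> //; have [] := uP k.
  exists (A, A); first by split.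
  move=> [v w] [/= [Pv bv] [Pw bw]]; rewrite -ball_normE /=.
  rewrite -ltr_sqr ?nnegrE ?normr_ge0 ?(ltW e0)//.
  apply: (le_lt_trans (norm_le_sq _)); apply: (le_lt_trans (key _ _ _ _ Pv Pw bv bw)).
  have -> : 4 * C * ((m + e ^+ 2 / (4 * C) / 2 + (m + e ^+ 2 / (4 * C) / 2)) / 2 - m)
    = e ^+ 2 / 2 by field; lra.
  by rewrite ltr_pdivrMr// ltr_pMr ?exprn_gt0// ltr1n.
have /cauchy_cvgP/cvg_ex[/= v uv] := ucauchy.
have Pv : P v.
  apply: (closed_cvg P P_closed _ _ uv).
  by apply: filterE => k; have [] := uP k.
have bv : bd m v.
  move=> h; apply/ler_addgt0Pr => /= e e0.
  have cl : closed [set w | sq (act h w) <= m + e].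
    have := @closed_comp _ _ (fun w => sq (act h w)) [set x | x <= m + e].
    by apply; [move=> w _; exact: sq_act_continuous|exact: closed_le].
  apply: (closed_cvg _ cl _ _ uv).
  by apply: filterS (near_bd _ e0) => k; exact.
exists v => // h.
have bhv : bd m (act h v) by move=> k; rewrite -actM.
have := key _ _ _ _ Pv (P_act h Pv) bv bhv.
have -> : (m + m) / 2 - m = 0 by lra.
rewrite mulr0 => le0; apply/esym/eqP; rewrite -subr_eq0; apply/eqP/sq_eq0.
by apply/eqP; rewrite eq_le le0 sq_ge0.
Qed.
End FixedPoint.

(** * Invariant inner products *)

Section InvariantInnerProduct.
Variables (R : realType) (n : nat) (T : groupType) (act : T -> 'rV[R]_n -> 'rV[R]_n).
Hypotheses (act_lin : forall h, linear (act h)) (act1 : forall v, act 1%g v = v).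
Hypothesis actM : forall h k v, act (h * k)%g v = act h (act k v).
Hypothesis act_bounded : forall v, exists M : R, forall h, `|act h v| <= M.

Lemma closed_halfspaces (I : Type) (N : nat) (D : set I)
    (L : I -> 'rV[R]_N -> R^o) (t : I -> R) : (forall i, linear (L i)) ->
  closed [set v | forall i, D i -> t i <= L i v].
Proof.
move=> linL.
have -> : [set v | forall i, D i -> t i <= L i v] =
    \bigcap_(i in D) [set v | t i <= L i v].
  by apply/seteqP; split=> v Pv i Di; exact: Pv.
apply: closed_bigI => i _.
have cL : continuous (L i).
  move=> v; have [d _] := derivative_linear (linL i) (ex_diff (is_diff_def := is_diff_id v)).
  exact: (differentiable_continuous d).
have := @closed_comp _ _ (L i) [set x | t i <= x].
by apply; [move=> w _; exact: cL|exact: closed_ge].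
Qed.

Lemma mulmx_norm m p q (A : 'M[R]_(m, p)) (B : 'M[R]_(p, q)) :
  `|A *m B| <= p%:R * `|A| * `|B|.
Proof.
have entry m' q' (C : 'M[R]_(m', q')) i j : `|C i j| <= `|C|.
  rewrite [leRHS]/Num.Def.normr /= mx_normrE.
  exact: (le_bigmax _ (fun ij => `|C ij.1 ij.2|) (i, j)).
have h0 : 0 <= p%:R * `|A| * `|B| by rewrite !mulr_ge0.
rewrite [leLHS]/Num.Def.normr /= mx_normrE; apply: bigmax_le => // -[i j] _ /=.
rewrite mxE (le_trans (ler_norm_sum _ _ _))//.
have -> : p%:R * `|A| * `|B| = \sum_(k < p) `|A| * `|B|.
  by rewrite sumr_const card_ord -mulrA mulr_natl.
by apply: ler_sum => k _; rewrite normrM ler_pM.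
Qed.

(** Row vectors are multiplied by matrices on the right; the inverse makes [A]
    a homomorphism. *)
Let A h := lin1_mx (act h^-1%g).

Let AE h X : X *m A h = act h^-1%g X.
Proof.
pose lM := GRing.isLinear.Build _ _ _ _ _ (act_lin h^-1%g).
pose l : {linear 'rV[R]_n -> 'rV[R]_n} := HB.pack (act h^-1%g) lM.
exact: (mul_rV_lin1 l X).
Qed.

Let AM h k : A (h * k)%g = A h *m A k.
Proof.
by apply/row_matrixP => i; rewrite !rowE mulmxA !AE invgM actM.
Qed.

Let A1 : A 1%g = 1%:M.
Proof. by apply/row_matrixP => i; rewrite !rowE AE invg1 act1 mulmx1. Qed.

Let tau h (v : 'rV[R]_(n * n)) := mxvec (A h *m vec_mx v *m (A h)^T).

Let fm (v : 'rV[R]_(n * n)) (X Y : 'rV[R]_n) : R :=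
  (X *m vec_mx v *m Y^T) ord0 ord0.

Let fm_tau h v X Y : fm (tau h v) X Y = fm v (act h^-1%g X) (act h^-1%g Y).
Proof. by rewrite /fm /tau mxvecK -!AE trmx_mul !mulmxA. Qed.

Let fm_lin X Y : linear (fun v => fm v X Y : R^o).
Proof. by move=> k u v; rewrite /fm linearP mulmxDr mulmxDl -scalemxAr -scalemxAl !mxE. Qed.

Let tau_bounded v : exists M : R, forall h, `|tau h v| <= M.
Proof.
have [M MP] := choice (fun i : 'I_n => act_bounded (delta_mx ord0 i)).
have nA h : `|A h| <= \sum_i `|M i|.
  have S0 : 0 <= \sum_i `|M i| by apply: sumr_ge0.
  rewrite [leLHS]/Num.Def.normr /= mx_normrE; apply: bigmax_le => // -[i j] _ /=.
  have -> : A h i j = act h^-1%g (delta_mx ord0 i) ord0 j.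
    by rewrite mxE.
  rewrite (le_trans (entry_le_norm _ _))// (le_trans (MP i h^-1%g))//.
  by rewrite (bigD1 i)//= (le_trans (ler_norm _))// lerDl sumr_ge0.
have nt m p (B : 'M[R]_(m, p)) : `|B^T| = `|B|.
  have le m' p' (C : 'M[R]_(m', p')) : `|C^T| <= `|C|.
    rewrite [leLHS]/Num.Def.normr /= mx_normrE; apply: bigmax_le => // -[i j] _ /=.
    rewrite mxE [leRHS]/Num.Def.normr /= mx_normrE.
    exact: (le_bigmax _ (fun ij => `|C ij.1 ij.2|) (j, i)).
  by apply/eqP; rewrite eq_le le -{1}(trmxK B) le.
have nv m p (B : 'M[R]_(m, p)) : `|mxvec B| <= `|B|.
  rewrite [leLHS]/Num.Def.normr /= mx_normrE; apply: bigmax_le => // -[i j] _ /=.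
  rewrite ord1; case/mxvec_indexP: j => a b; rewrite mxvecE.
  rewrite [leRHS]/Num.Def.normr /= mx_normrE.
  exact: (le_bigmax _ (fun ij => `|B ij.1 ij.2|) (a, b)).
pose S := \sum_i `|M i|.
exists (n%:R * (n%:R * S * `|vec_mx v|) * S) => h.
apply: (le_trans (nv _ _ _)); apply: (le_trans (mulmx_norm _ _)); rewrite nt.
rewrite ler_pM ?mulr_ge0// ?nA// ler_wpM2l//.
by apply: (le_trans (mulmx_norm _ _)); rewrite ler_wpM2r// ler_wpM2l// nA.
Qed.

(** An invariant form is a fixed point of the action on matrices. Positivity is
    secured by looking for it among the symmetric forms whose value at (X, X)
    is at least inf_h |act h X|^2: this bound is invariant, holds for the
    standard product, and is positive for X <> 0 because the group is
    bounded. *)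
Lemma invariant_inner_product : exists B : 'rV[R]_n -> 'rV[R]_n -> R^o,
  [/\ forall X, linear (B X), forall X Y, B X Y = B Y X,
      forall X, X != 0 -> 0 < B X X &
      forall h X Y, B (act h X) (act h Y) = B X Y].
Proof.
have tau_lin h : linear (tau h).
  by move=> k u v; rewrite /tau linearP mulmxDr mulmxDl -scalemxAr -scalemxAl linearP.
have tau1 v : tau 1%g v = v by rewrite /tau A1 mul1mx trmx1 mulmx1 vec_mxK.
have tauM h k v : tau (h * k)%g v = tau h (tau k v).
  by rewrite /tau mxvecK AM trmx_mul !mulmxA.
(* P1 and P2 are intersections of half-spaces, which makes them closed and
   convex: symmetry is a family of inequalities, and the infimum in the lower
   bound is replaced by all its lower bounds t. *)
pose P1 := [set v | forall XY : 'rV[R]_n * 'rV[R]_n, setT XY ->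
  0 <= fm v XY.1 XY.2 - fm v XY.2 XY.1 :> R].
pose P2 := [set v | forall Xt : 'rV[R]_n * R,
  (forall h, Xt.2 <= sq (act h Xt.1)) -> Xt.2 <= fm v Xt.1 Xt.1].
have P1_sym v : P1 v -> forall X Y, fm v X Y = fm v Y X.
  move=> Pv X Y; apply/eqP; rewrite eq_le -subr_ge0 (Pv (Y, X))//=.
  by rewrite -subr_ge0 (Pv (X, Y)).
have [||||v [Pv1 Pv2] vfix] := @fixed_point R _ T tau tau_lin tau1 tauM tau_bounded (P1 `&` P2).
- move=> u v [u1 u2] [v1 v2]; split=> [XY _|Xt hX] /=.
    have := fm_lin XY.1 XY.2 2^-1 (u + v) 0; have := fm_lin XY.2 XY.1 2^-1 (u + v) 0.
    have := fm_lin XY.1 XY.2 1 u v; have := fm_lin XY.2 XY.1 1 u v.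
    have f0 X Y : fm 0 X Y = 0 by rewrite /fm linear0 mulmx0 mul0mx mxE.
    rewrite !scale1r !addr0 !f0 => -> -> -> ->.
    rewrite (P1_sym _ u1 XY.2 XY.1) (P1_sym _ v1 XY.2 XY.1) subrr//.
  have f0 X Y : fm 0 X Y = 0 by rewrite /fm linear0 mulmx0 mul0mx mxE.
  have := fm_lin Xt.1 Xt.1 2^-1 (u + v) 0; have := fm_lin Xt.1 Xt.1 1 u v.
  rewrite !scale1r !addr0 !f0 addr0 => -> ->.
  have := u2 _ hX; have := v2 _ hX; rewrite /GRing.scale /=; lra.
- apply: closedI.
    apply: (@closed_halfspaces ('rV[R]_n * 'rV[R]_n)%type (n * n) setT
      (fun XY v => fm v XY.1 XY.2 - fm v XY.2 XY.1) (fun=> 0)) => XY k u v.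
    by rewrite !fm_lin scalerBr opprD addrACA.
  exact: (@closed_halfspaces ('rV[R]_n * R)%type (n * n)
    [set Xt | forall h, Xt.2 <= sq (act h Xt.1)]
    (fun Xt v => fm v Xt.1 Xt.1) snd (fun Xt => fm_lin Xt.1 Xt.1)).
- exists (mxvec 1%:M); have fE X Y : fm (mxvec 1%:M) X Y = \sum_i X ord0 i * Y ord0 i.
    by rewrite /fm mxvecK mulmx1 mxE; apply: eq_bigr => i _; rewrite mxE.
  split=> [XY _|Xt /(_ 1%g)] /=.
    by rewrite !fE; under eq_bigr do rewrite mulrC; rewrite subrr.
  by rewrite act1 fE.
- move=> h v [v1 v2]; split=> [XY _|Xt hX] /=; rewrite !fm_tau.
    by rewrite (P1_sym _ v1) subrr.
  by apply: (v2 (act h^-1%g Xt.1, Xt.2)) => k /=; rewrite -actM; exact: hX.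
exists (fm v); split.
- by move=> X k Y Z; rewrite /fm linearP /= mulmxDr -scalemxAr !mxE.
- exact: P1_sym.
- move=> X X0; have [C C0 CP] := sq_act_bounded act_lin act_bounded.
  have sX : 0 < sq X.
    rewrite lt_def sq_ge0 andbT; apply: contra_neq X0; exact: sq_eq0.
  apply: (@lt_le_trans _ _ (sq X / C)); first by rewrite divr_gt0.
  apply: (Pv2 (X, _)) => h /=; rewrite ler_pdivrMr// mulrC.
  by rewrite -{1}(act1 X) -(mulVg h) actM CP.
- by move=> h X Y; rewrite -{1}(vfix h) fm_tau -!actM !mulVg !act1.
Qed.

End InvariantInnerProduct.

(** * Orthogonal projections *)

Section Euclidean.
Variables (R : realType) (V : vectType R).

(** A subspace of maximal dimension among those contained in P is all of P. *)
Lemma subspace_exists (P : set V) : P 0 -> (forall k u v, P u -> P v -> P (k *: u + v)) ->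
  exists U : {vspace V}, forall v, (v \in U) <-> P v.
Proof.
move=> P0 Plin.
pose Q d := `[< exists2 U : {vspace V}, {in U, forall v, P v} & \dim U = d >].
have Q0 : exists d, Q d.
  exists 0%N; apply/asboolP; exists 0%VS; last by rewrite dimv0.
  by move=> v; rewrite memv0 => /eqP->.
have Qb d : Q d -> (d <= \dim {:V})%N.
  by move=> /asboolP[U _ <-]; apply: dimvS; exact: subvf.
case: (ex_maxnP Q0 Qb) => d /asboolP[U UP dU] dmax.
exists U => v; split=> [vU|Pv]; first exact: UP.
have : Q (\dim (U + <[v]>)).
  apply/asboolP; exists (U + <[v]>)%VS => // w /memv_addP[u uU [x /vlineP[k ->] ->]].
  by rewrite addrC; apply: Plin => //; exact: UP.
move=> /dmax; rewrite -dU => le.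
have /eqP -> : U == (U + <[v]>)%VS by rewrite eqEdim addvSl le.
by apply: (subvP (addvSr U <[v]>)); exact: memv_line.
Qed.

Variable ip : V -> V -> R^o.
Hypotheses (ip_lin : forall u, linear (ip u)) (ipC : forall u v, ip u v = ip v u).
Hypothesis ip_pos : forall u, u != 0 -> 0 < ip u u.

Lemma ipD u v w : ip u (v + w) = ip u v + ip u w.
Proof. by have := ip_lin u 1 v w; rewrite !scale1r. Qed.

Lemma ip0 u : ip u 0 = 0.
Proof. by apply: (addrI (ip u 0)); rewrite -ipD !addr0. Qed.

Lemma ipZ u k v : ip u (k *: v) = k * ip u v.
Proof. by have := ip_lin u k v 0; rewrite !addr0 ip0 addr0. Qed.

Lemma ipN u v : ip u (- v) = - ip u v.
Proof. by rewrite -scaleN1r ipZ mulN1r. Qed.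

Lemma ipB u v w : ip u (v - w) = ip u v - ip u w.
Proof. by rewrite ipD ipN. Qed.

Lemma ipDl u v w : ip (v + w) u = ip v u + ip w u.
Proof. by rewrite ipC ipD !(ipC u). Qed.

Lemma ipZl u k v : ip (k *: v) u = k * ip v u.
Proof. by rewrite ipC ipZ (ipC u). Qed.

Lemma ipBl u v w : ip (v - w) u = ip v u - ip w u.
Proof. by rewrite ipC ipB !(ipC u). Qed.

Lemma ip_sumr (I : Type) (r : seq I) (P : pred I) (f : I -> V) u :
  ip u (\sum_(i <- r | P i) f i) = \sum_(i <- r | P i) ip u (f i).
Proof. by elim/big_rec2: _ => [|i x y _ <-]; rewrite ?ip0// ipD. Qed.

Lemma ip_suml (I : Type) (r : seq I) (P : pred I) (f : I -> V) u :
  ip (\sum_(i <- r | P i) f i) u = \sum_(i <- r | P i) ip (f i) u.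
Proof. by rewrite ipC ip_sumr; apply: eq_bigr => i _; rewrite ipC. Qed.

Lemma ip_eq0 u : ip u u = 0 -> u = 0.
Proof.
move=> u0; apply/eqP; apply: contraPT (ltxx (0 : R)) => /ip_pos.
by rewrite u0 => ->.
Qed.

(** By induction on the dimension: split off a unit vector and pass to its
    orthogonal complement. *)
Lemma orthonormal_basis (U : {vspace V}) : exists N (e : 'I_N -> V),
  [/\ forall i, e i \in U, forall i j, ip (e i) (e j) = (i == j)%:R &
      forall v, v \in U -> v = \sum_i ip v (e i) *: e i].
Proof.
have [m] := ubnP (\dim U); elim: m U => // m IH U; rewrite ltnS => dU.
have [->|U0] := eqVneq U 0%VS.
  exists 0%N, (fun _ => 0); split=> [[]//|[]//|v].
  by rewrite memv0 big_ord0 => /eqP.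
pose w := vpick U; have wU : w \in U by exact: memv_pick.
have w0 : w != 0 by rewrite vpick0.
have wp := ip_pos w0; pose u := (Num.sqrt (ip w w))^-1 *: w.
have uU : u \in U by rewrite memvZ.
have uu : ip u u = 1.
  rewrite ipZ ipZl mulrA -invfM -expr2 sqr_sqrtr ?mulVf ?gt_eqF//; exact: ltW.
have [U' U'P] := @subspace_exists [set v | v \in U /\ ip v u = 0]
  ltac:(by split; [exact: mem0v|rewrite ipC ip0])
  ltac:(by move=> k x y [xU x0] [yU y0]; split;
    [rewrite memvD ?memvZ|rewrite ipDl ipZl x0 y0 mulr0 addr0]).
have sub : (U' <= U)%VS by apply/subvP => v /U'P[].
have lt : (\dim U' < m)%N.
  apply: leq_trans dU; rewrite ltn_neqAle dimvS// andbT.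
  apply/negP => /eqP dE; have UE : U' = U.
    by apply/eqP; rewrite eqEdim sub dE leqnn.
  have /U'P[_ /eqP] : u \in U' by rewrite UE.
  by rewrite uu oner_eq0.
have [N [e [eU ee eE]]] := IH U' lt.
exists N.+1, (fun i => oapp e u (unlift ord0 i)); split.
- by move=> i; case: unliftP => [j _|_] //=; exact: (subvP sub).
- move=> i j; case: unliftP => [i' ->|->]; case: unliftP => [j' ->|->] /=.
  + by rewrite ee (inj_eq lift_inj).
  + by have /U'P[_ ->] := eU i'.
  + by have /U'P[_] := eU j'; rewrite ipC => ->.
  + by rewrite uu.
- move=> v vU; rewrite big_ord_recl unlift_none /=.
  under eq_bigr do rewrite liftK /=.
  have v'U : v - ip v u *: u \in U'.
    apply/U'P; split; first by rewrite memvB ?memvZ.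
    by rewrite ipBl ipZl uu mulr1 subrr.
  have := eE _ v'U; move/eqP; rewrite subr_eq addrC => /eqP {1}->.
  congr (_ + _); apply: eq_bigr => i _; rewrite ipBl ipZl.
  by have /U'P[_] := eU i; rewrite ipC => ->; rewrite mulr0 subr0.
Qed.

Lemma orthogonal_projection (U : {vspace V}) v :
  exists2 u, u \in U & forall w, w \in U -> ip (v - u) w = 0.
Proof.
have [N [e [eU ee eE]]] := orthonormal_basis U.
exists (\sum_i ip v (e i) *: e i); first by apply: memv_suml => i _; exact: memvZ.
have h j : ip (v - \sum_i ip v (e i) *: e i) (e j) = 0.
  rewrite ipBl ip_suml (bigD1 j)//= ipZl ee eqxx mulr1 big1 ?addr0 ?subrr// => i ij.
  by rewrite ipZl ee (negPf ij) mulr0.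
move=> w /eE ->; rewrite ip_sumr big1// => j _.
by rewrite ipZ h mulr0.
Qed.

End Euclidean.

Section CoordinateProduct.
Variables (R : realType) (I : finType).

Definition ipf (a b : {ffun I -> R^o}) : R^o := \sum_i a i * b i.

Lemma ipf_lin a : linear (ipf a).
Proof.
move=> k u v; rewrite /ipf scaler_sumr -big_split /=; apply: eq_bigr => i _.
by rewrite !ffunE /GRing.scale /=; ring.
Qed.

Lemma ipfC a b : ipf a b = ipf b a.
Proof. by apply: eq_bigr => i _; rewrite mulrC. Qed.

Lemma ipf_pos a : a != 0 -> 0 < ipf a a.
Proof.
move=> a0; rewrite lt_def; apply/andP; split; last first.
  by apply: sumr_ge0 => i _; rewrite -expr2 sqr_ge0.
apply: contra_neq a0 => /eqP; rewrite psumr_eq0 => [/allP z|i _]; last first.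
  by rewrite -expr2 sqr_ge0.
apply/ffunP => i; rewrite ffunE; apply/eqP.
by have := z i; rewrite mem_index_enum => /(_ isT); rewrite -expr2 sqrf_eq0.
Qed.

End CoordinateProduct.

(** * Forms of degree at most three on a Lie algebra *)

Section LieAlgebraForms.
Variables (R : realType) (V : vectType R) (br : V -> V -> V).
Hypotheses (brr : forall X, linear (br X)) (brl : forall Y, linear (br ^~ Y)).
Hypothesis brC : forall X Y, br X Y = - br Y X.
Hypothesis jac : forall X Y Z, br X (br Y Z) = br (br X Y) Z + br Y (br X Z).

Definition bilinear_form (s : V -> V -> R^o) : Prop :=
  (forall X, linear (s X)) /\ (forall Y, linear (s ^~ Y)).

Definition alt2 (s : V -> V -> R^o) : Prop :=
  bilinear_form s /\ forall X, s X X = 0.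

Definition alt3 (b : V -> V -> V -> R^o) : Prop :=
  [/\ forall X Y, linear (b X Y), forall X Z, linear (fun Y => b X Y Z),
      forall Y Z, linear (fun X => b X Y Z),
      forall X Y, b X X Y = 0 & forall X Y, b Y X X = 0].

(** The differential of left-invariant forms, in degrees 1, 2 and 3 and on
    curried forms. *)
Definition d1 (l : V -> R^o) X Y : R^o := - l (br X Y).

Definition d2 (s : V -> V -> R^o) X Y Z : R^o :=
  - s (br X Y) Z + s (br X Z) Y - s (br Y Z) X.

Definition d3 (b : V -> V -> V -> R^o) X Y Z W : R^o :=
  - b (br X Y) Z W + b (br X Z) Y W - b (br X W) Y Z
  - b (br Y Z) X W + b (br Y W) X Z - b (br Z W) X Y.

(** The Lie derivative along X, up to sign. *)
Definition lie2 X (s : V -> V -> R^o) Y Z : R^o := s (br X Y) Z + s Y (br X Z).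

Definition lie3 X (b : V -> V -> V -> R^o) Y Z W : R^o :=
  b (br X Y) Z W + b Y (br X Z) W + b Y Z (br X W).

Lemma linear_comb (W W' : lmodType R) (f : W -> W') : linear f ->
  [/\ forall u v, f (u + v) = f u + f v, f 0 = 0, forall u, f (- u) = - f u &
      forall k u, f (k *: u) = k *: f u].
Proof.
move=> fl; have fD u v : f (u + v) = f u + f v.
  by have := fl 1 u v; rewrite !scale1r.
have f0 : f 0 = 0 by apply: (addrI (f 0)); rewrite -fD !addr0.
have fZ k u : f (k *: u) = k *: f u by have := fl k u 0; rewrite !addr0 f0 addr0.
by split=> // u; rewrite -scaleN1r fZ scaleN1r.
Qed.

Lemma alt2_skew s X Y : alt2 s -> s X Y = - s Y X.
Proof. by move=> [[sr sl] sa]; exact: (alternating_skew sr sl sa). Qed.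

Lemma alt3_skew12 b X Y Z : alt3 b -> b X Y Z = - b Y X Z.
Proof.
move=> [b3 b2 b1 ba ba'].
exact: (alternating_skew (b := fun X Y => b X Y Z) (fun X => b2 X Z) (fun Y => b1 Y Z)
  (fun X => ba X Z)).
Qed.

Lemma alt3_skew23 b X Y Z : alt3 b -> b X Y Z = - b X Z Y.
Proof.
move=> [b3 b2 b1 ba ba'].
exact: (alternating_skew (b := b X) (fun Y => b3 X Y) (fun Z => b2 X Z)
  (fun Y => ba' Y X)).
Qed.

Lemma alt2_comb k s t : alt2 s -> alt2 t -> alt2 (fun X Y => k *: s X Y + t X Y).
Proof.
move=> [[sr sl] sa] [[tr tl] ta]; split; first split.
- by move=> X c Y Z; rewrite sr tr !scalerDr !scalerA [k * c]mulrC addrACA.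
- by move=> X c Y Z; rewrite sl tl !scalerDr !scalerA [k * c]mulrC addrACA.
- by move=> X; rewrite sa ta scaler0 addr0.
Qed.

Lemma alt2_sub s t : alt2 s -> alt2 t -> alt2 (fun X Y => s X Y - t X Y).
Proof.
move=> sa ta; have := alt2_comb (-1) ta sa.
have -> // : (fun X Y => -1 *: t X Y + s X Y) = (fun X Y => s X Y - t X Y).
by apply/funext => X; apply/funext => Y; rewrite scaleN1r addrC.
Qed.

Lemma alt3_comb k b a : alt3 b -> alt3 a ->
  alt3 (fun X Y Z => k *: b X Y Z + a X Y Z).
Proof.
move=> [b3 b2 b1 ba ba'] [a3 a2 a1 aa aa']; split.
- by move=> X Y c Z W; rewrite b3 a3 !scalerDr !scalerA [k * c]mulrC addrACA.
- by move=> X Y c Z W; rewrite b2 a2 !scalerDr !scalerA [k * c]mulrC addrACA.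
- by move=> X Y c Z W; rewrite b1 a1 !scalerDr !scalerA [k * c]mulrC addrACA.
- by move=> X Y; rewrite ba aa scaler0 addr0.
- by move=> X Y; rewrite ba' aa' scaler0 addr0.
Qed.

Lemma alt3_sub b a : alt3 b -> alt3 a -> alt3 (fun X Y Z => b X Y Z - a X Y Z).
Proof.
move=> bA aA; have := alt3_comb (-1) aA bA.
have -> // : (fun X Y Z => -1 *: a X Y Z + b X Y Z) = (fun X Y Z => b X Y Z - a X Y Z).
by apply/funext => X; apply/funext => Y; apply/funext => Z; rewrite scaleN1r addrC.
Qed.

Lemma br_alt X : br X X = 0.
Proof.
have /eqP : br X X = - br X X by exact: brC.
by rewrite -subr_eq0 opprK -mulr2n -scaler_nat scaler_eq0 pnatr_eq0 => /eqP.
Qed.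

Lemma alt2_interior b X : alt3 b -> alt2 (b X).
Proof. by move=> [b3 b2 b1 ba ba']; split; [split|move=> Y; exact: ba']. Qed.

Lemma alt2_d1 l : linear l -> alt2 (d1 l).
Proof.
move=> ll; split; first split.
- by move=> X k Y Z; rewrite /d1 brr ll opprD scalerN.
- by move=> X k Y Z; rewrite /d1 brl ll opprD scalerN.
- by move=> X; rewrite /d1 br_alt; have [_ -> _ _] := linear_comb ll; rewrite oppr0.
Qed.

Lemma alt3_d2 s : alt2 s -> alt3 (d2 s).
Proof.
move=> sA; have [[sr sl] sa] := sA; have s0 Z : s 0 Z = 0.
  by have [_ -> _ _] := linear_comb (sl Z).
split.
- move=> X Y k Z W; rewrite /d2 ?brr ?brl ?sl ?sr /GRing.scale /=; ring.
- move=> X Y k Z W; rewrite /d2 ?brr ?brl ?sl ?sr /GRing.scale /=; ring.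
- move=> X Y k Z W; rewrite /d2 ?brr ?brl ?sl ?sr /GRing.scale /=; ring.
- by move=> X Y; rewrite /d2 br_alt s0; ring.
- by move=> X Y; rewrite /d2 br_alt s0; ring.
Qed.

Lemma d2_comb k s t X Y Z :
  d2 (fun A B => k *: s A B + t A B) X Y Z = k *: d2 s X Y Z + d2 t X Y Z.
Proof. by rewrite /d2 /GRing.scale /=; ring. Qed.

Lemma d2_sub s t X Y Z :
  d2 (fun A B => s A B - t A B) X Y Z = d2 s X Y Z - d2 t X Y Z.
Proof. by rewrite /d2; ring. Qed.

Lemma d3_sub b a X Y Z W :
  d3 (fun A B C => b A B C - a A B C) X Y Z W = d3 b X Y Z W - d3 a X Y Z W.
Proof. by rewrite /d3; ring. Qed.

Lemma jacobi_left (s : V -> R^o) A B C : linear s ->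
  s (br (br A B) C) - s (br (br A C) B) + s (br (br B C) A) = 0.
Proof.
move=> sl; have [sD s0 sN _] := linear_comb sl.
rewrite [br (br A C) B]brC [br (br B C) A]brC (jac A B C) !sN sD opprK; ring.
Qed.

Lemma d2d1 l X Y Z : linear l -> d2 (d1 l) X Y Z = 0.
Proof.
by move=> ll; rewrite /d2 /d1; have := jacobi_left X Y Z ll; lra.
Qed.

Lemma d3d2 s X Y Z W : alt2 s -> d3 (d2 s) X Y Z W = 0.
Proof.
move=> sA; have [[sr sl] sa] := sA.
have j A B C D := jacobi_left A B C (sl D).
have k A B := alt2_skew A B sA.
rewrite /d3 /d2.
have := j X Y Z W; have := j X Y W Z; have := j X Z W Y; have := j Y Z W X.
rewrite (k (br Z W) (br X Y)) (k (br Y W) (br X Z)) (k (br Y Z) (br X W)); lra.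
Qed.

(** Cartan's formula on closed forms: the Lie derivative is exact. *)
Lemma lie2_exact s X Y Z : alt2 s -> (forall X Y Z, d2 s X Y Z = 0) ->
  lie2 X s Y Z = - d1 (s X) Y Z.
Proof.
move=> sA cl; have := cl X Y Z; rewrite /d2 /lie2 /d1 opprK.
by rewrite (alt2_skew Y _ sA) (alt2_skew X _ sA); lra.
Qed.

Lemma lie3_exact b X Y Z W : alt3 b -> (forall X Y Z W, d3 b X Y Z W = 0) ->
  lie3 X b Y Z W = - d2 (b X) Y Z W.
Proof.
move=> bA cl; have := cl X Y Z W; rewrite /d3 /lie3 /d2.
rewrite (alt3_skew12 Y (br X Z) W bA) (alt3_skew23 Y Z (br X W) bA).
rewrite (alt3_skew12 Y (br X W) Z bA).
rewrite (alt3_skew12 X (br Y Z) W bA) (alt3_skew12 X (br Y W) Z bA).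
rewrite (alt3_skew12 X (br Z W) Y bA); lra.
Qed.

(** * Harmonic forms *)

Variable ip : V -> V -> R^o.
Hypotheses (ip_lin : forall u, linear (ip u)) (ipC : forall u v, ip u v = ip v u).
Hypothesis ip_pos : forall u, u != 0 -> 0 < ip u u.
Hypothesis ip_ad : forall X Y Z, ip (br X Y) Z + ip Y (br X Z) = 0.
Hypothesis centerless : forall X, (forall Y, br X Y = 0) -> X = 0.

Variables (N : nat) (e : 'I_N -> V).
Hypothesis eE : forall v, v = \sum_i ip v (e i) *: e i.

Lemma linear_sumZ (u : V -> R^o) (c : 'I_N -> R) (f : 'I_N -> V) : linear u ->
  u (\sum_i c i *: f i) = \sum_i c i * u (f i).
Proof.
move=> ul; have [uD u0 _ uZ] := linear_comb ul.
elim/big_rec2: _ => [//|i x y _ <-]; by rewrite uD uZ.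
Qed.

(** The Riesz representative of a linear form. *)
Definition rep (u : V -> R^o) : V := \sum_i u (e i) *: e i.

Lemma repE (u : V -> R^o) Y : linear u -> u Y = ip (rep u) Y.
Proof.
move=> ul; rewrite {1}(eE Y) (linear_sumZ _ _ ul) /rep ipC (ip_sumr ip_lin).
by apply: eq_bigr => i _; rewrite (ipZ ip_lin) mulrC.
Qed.

Lemma sum_rep (u w : V -> R^o) : linear u -> linear w ->
  \sum_i u (e i) * w (e i) = ip (rep u) (rep w).
Proof.
by move=> ul wl; rewrite -(repE _ ul) (linear_sumZ _ _ ul); under eq_bigr do rewrite mulrC.
Qed.

Lemma ip_nondeg Y Z : (forall X, ip X Y = ip X Z) -> Y = Z.
Proof.
move=> h; apply/eqP; rewrite -subr_eq0; apply/eqP/(ip_eq0 ip_pos).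
by rewrite (ipB ip_lin) h subrr.
Qed.

Lemma sum_skew (u w : V -> R^o) X : linear u -> linear w ->
  \sum_i u (e i) * w (br X (e i)) = - \sum_i u (br X (e i)) * w (e i).
Proof.
move=> ul wl.
have lin (f : V -> R^o) : linear f -> linear (fun Y => f (br X Y) : R^o).
  by move=> fl k Y Z; rewrite brr fl.
have r (f : V -> R^o) : linear f -> rep (fun Y => f (br X Y)) = - br X (rep f).
  move=> fl; apply: ip_nondeg => Y; rewrite (ipN ip_lin) ipC -(repE _ (lin _ fl)).
  by rewrite (repE _ fl) (ipC Y); apply/eqP; rewrite -addr_eq0 addrC ip_ad.
rewrite (sum_rep ul (lin _ wl)) (sum_rep (lin _ ul) wl) !r//.
rewrite (ipN ip_lin) [ip (- _) _]ipC (ipN ip_lin) opprK ipC; apply/eqP.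
by rewrite eq_sym -addr_eq0 addrC ip_ad.
Qed.

(** A linear form that vanishes on brackets is represented by a central vector,
    by invariance of the inner product. *)
Lemma perfect (u : V -> R^o) : linear u -> (forall X Y, u (br X Y) = 0) ->
  forall X, u X = 0.
Proof.
move=> ul u0 X; rewrite (repE _ ul).
have -> : rep u = 0; last by rewrite ipC (ip0 ip_lin).
apply: centerless => Y; rewrite brC; apply/eqP; rewrite oppr_eq0; apply/eqP.
apply: ip_nondeg => Z; rewrite (ip0 ip_lin) ipC; apply/eqP.
rewrite -[_ == _]/(ip (br Y (rep u)) Z == 0).
have /eqP := ip_ad Y (rep u) Z; rewrite -(repE _ ul) u0 addr0; exact.
Qed.

(** By invariance s([X, Y], Z) is symmetric in Y and Z, and it is skew in X and
    Y, so it vanishes; brackets span the algebra. *)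
Lemma invariant_alt2_eq0 s : alt2 s -> (forall X Y Z, lie2 X s Y Z = 0) ->
  forall X Y, s X Y = 0.
Proof.
move=> sA inv X Z; have [[sr sl] sa] := sA.
apply: (perfect (sl Z)) => {}X Y.
have h1 := inv X Y Z; have h2 := inv Y X Z; have h3 := inv Z X Y.
move: h1 h2 h3; rewrite /lie2.
have [_ _ sN _] := linear_comb (sl Z); have [_ _ sN' _] := linear_comb (sl Y).
have [_ _ sN'' _] := linear_comb (sr X).
rewrite (brC Y X) sN (brC Z X) (brC Z Y) sN' sN''.
rewrite (alt2_skew Y _ sA); lra.
Qed.

(** Coordinates place forms in a finite-dimensional space with an inner product,
    where orthogonal projections exist. *)
Definition coord2 (s : V -> V -> R^o) : {ffun 'I_N * 'I_N -> R^o} :=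
  [ffun p => s (e p.1) (e p.2)].

Definition coord3 (b : V -> V -> V -> R^o) : {ffun 'I_N * 'I_N * 'I_N -> R^o} :=
  [ffun p => b (e p.1.1) (e p.1.2) (e p.2)].

Lemma ipf_coord2 s t : ipf (coord2 s) (coord2 t) =
  \sum_i \sum_j s (e i) (e j) * t (e i) (e j).
Proof. by rewrite pair_bigA; apply: eq_bigr => -[i j] _; rewrite !ffunE. Qed.

Lemma ipf_coord3 b a : ipf (coord3 b) (coord3 a) =
  \sum_i \sum_j \sum_k b (e i) (e j) (e k) * a (e i) (e j) (e k).
Proof.
rewrite pair_bigA /= pair_bigA /=.
by apply: eq_bigr => -[[i j] k] _; rewrite !ffunE.
Qed.

Lemma linear_ext0 (u : V -> R^o) : linear u -> (forall i, u (e i) = 0) ->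
  forall X, u X = 0.
Proof.
move=> ul u0 X; rewrite (eE X) (linear_sumZ _ _ ul) big1// => i _.
by rewrite u0 mulr0.
Qed.

Lemma coord2_eq0 s : bilinear_form s -> coord2 s = 0 -> forall X Y, s X Y = 0.
Proof.
move=> [sr sl] s0 X Y; apply: (linear_ext0 (sl Y)) => i.
apply: (linear_ext0 (sr (e i))) => j.
by have /ffunP/(_ (i, j)) := s0; rewrite !ffunE.
Qed.

Lemma coord3_eq0 b : alt3 b -> coord3 b = 0 -> forall X Y Z, b X Y Z = 0.
Proof.
move=> [b3 b2 b1 _ _] s0 X Y Z; apply: (linear_ext0 (b1 Y Z)) => i.
apply: (linear_ext0 (b2 (e i) Z)) => j; apply: (linear_ext0 (b3 (e i) (e j))) => k.
by have /ffunP/(_ (i, j, k)) := s0; rewrite !ffunE.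
Qed.

(** Since ad X is skew, so is the Lie derivative on forms. *)
Lemma lie2_skew X s t : bilinear_form s -> bilinear_form t ->
  ipf (coord2 s) (coord2 (lie2 X t)) = - ipf (coord2 (lie2 X s)) (coord2 t).
Proof.
move=> [sr sl] [tr tl]; rewrite !ipf_coord2 /lie2.
transitivity (\sum_i \sum_j s (e i) (e j) * t (br X (e i)) (e j) +
    \sum_i \sum_j s (e i) (e j) * t (e i) (br X (e j))).
  rewrite -big_split; apply: eq_bigr => i _; rewrite -big_split; apply: eq_bigr => j _.
  by rewrite mulrDr.
transitivity (- (\sum_i \sum_j s (br X (e i)) (e j) * t (e i) (e j) +
    \sum_i \sum_j s (e i) (br X (e j)) * t (e i) (e j))); last first.
  rewrite -big_split; congr (- _); apply: eq_bigr => i _; rewrite -big_split.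
  by apply: eq_bigr => j _; rewrite mulrDl.
rewrite opprD; congr (_ + _).
  rewrite exchange_big /= [in RHS]exchange_big /= -sumrN.
  by apply: eq_bigr => j _; exact: (sum_skew X (sl (e j)) (tl (e j))).
by rewrite -sumrN; apply: eq_bigr => i _; exact: (sum_skew X (sr (e i)) (tr (e i))).
Qed.

Lemma lie3_skew X b a : alt3 b -> alt3 a ->
  ipf (coord3 b) (coord3 (lie3 X a)) = - ipf (coord3 (lie3 X b)) (coord3 a).
Proof.
move=> [b3 b2 b1 _ _] [a3 a2 a1 _ _]; rewrite !ipf_coord3 /lie3.
transitivity (
    \sum_i \sum_j \sum_k b (e i) (e j) (e k) * a (br X (e i)) (e j) (e k) +
    \sum_i \sum_j \sum_k b (e i) (e j) (e k) * a (e i) (br X (e j)) (e k) +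
    \sum_i \sum_j \sum_k b (e i) (e j) (e k) * a (e i) (e j) (br X (e k))).
  rewrite -!big_split; apply: eq_bigr => i _; rewrite -!big_split.
  apply: eq_bigr => j _; rewrite -!big_split; apply: eq_bigr => k _ /=.
  by rewrite !mulrDr.
transitivity (- (
    \sum_i \sum_j \sum_k b (br X (e i)) (e j) (e k) * a (e i) (e j) (e k) +
    \sum_i \sum_j \sum_k b (e i) (br X (e j)) (e k) * a (e i) (e j) (e k) +
    \sum_i \sum_j \sum_k b (e i) (e j) (br X (e k)) * a (e i) (e j) (e k)));
  last first.
  rewrite -!big_split; congr (- _); apply: eq_bigr => i _; rewrite -!big_split.
  apply: eq_bigr => j _; rewrite -!big_split; apply: eq_bigr => k _ /=.
  by rewrite !mulrDl.
rewrite !opprD; congr (_ + _ + _).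
- rewrite exchange_big /= [in RHS]exchange_big /= -sumrN; apply: eq_bigr => j _.
  rewrite exchange_big /= [in RHS]exchange_big /= -sumrN; apply: eq_bigr => k _.
  exact: (sum_skew X (b1 (e j) (e k)) (a1 (e j) (e k))).
- rewrite -sumrN; apply: eq_bigr => i _.
  rewrite exchange_big /= [in RHS]exchange_big /= -sumrN; apply: eq_bigr => k _.
  exact: (sum_skew X (b2 (e i) (e k)) (a2 (e i) (e k))).
- rewrite -sumrN; apply: eq_bigr => i _; rewrite -sumrN; apply: eq_bigr => j _.
  exact: (sum_skew X (b3 (e i) (e j)) (a3 (e i) (e j))).
Qed.

(** The element t of the cohomology class orthogonal to the exact forms is
    invariant: L_X t is exact, and so is L_X L_X t, whence
    |L_X t|^2 = - <t, L_X L_X t> = 0. *)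
Lemma harmonic2 s : alt2 s -> (forall X Y Z, d2 s X Y Z = 0) ->
  exists2 l : V -> R^o, linear l &
    forall X Y Z, lie2 X (fun A B => s A B - d1 l A B) Y Z = 0.
Proof.
move=> sA scl.
have [U UP] := @subspace_exists R {ffun 'I_N * 'I_N -> R^o}
  [set v | exists2 l : V -> R^o, linear l & v = coord2 (d1 l)]
  ltac:(by exists (fun=> 0); [move=> k u v; rewrite scaler0 addr0|
    apply/ffunP => p; rewrite !ffunE /d1 oppr0])
  ltac:(by move=> k _ _ [l ll ->] [m ml ->];
    exists (fun X => k *: l X + m X);
    [move=> c u v; rewrite ll ml !scalerDr !scalerA [k * c]mulrC addrACA|
     apply/ffunP => p; rewrite !ffunE /d1 scalerN opprD]).
have [_ /UP[l ll ->] orth] :=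
  orthogonal_projection (@ipf_lin _ _) (@ipfC _ _) (@ipf_pos _ _) U (coord2 s).
exists l => // X.
set t := fun A B => s A B - d1 l A B.
have tA : alt2 t by exact: alt2_sub sA (alt2_d1 ll).
have tcl A B C : d2 t A B C = 0 by rewrite d2_sub scl d2d1// subrr.
have lexact t' : alt2 t' -> (forall A B C, d2 t' A B C = 0) ->
    lie2 X t' = d1 (fun A => - t' X A).
  move=> t'A t'cl; apply/funext => Y; apply/funext => Z.
  by rewrite lie2_exact// /d1 opprK.
have nl t' : alt2 t' -> linear (fun A => - t' X A).
  by move=> [[tr _] _] k u v; rewrite tr opprD scalerN.
have wA : alt2 (lie2 X t) by rewrite lexact//; apply: alt2_d1; exact: nl.
have wcl A B C : d2 (lie2 X t) A B C = 0 by rewrite lexact// d2d1//; exact: nl.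
have cE : coord2 s - coord2 (d1 l) = coord2 t.
  by apply/ffunP => p; rewrite !ffunE.
have : ipf (coord2 t) (coord2 (lie2 X (lie2 X t))) = 0.
  rewrite -cE; apply: orth; apply/UP; exists (fun A => - (lie2 X t) X A).
    exact: nl.
  by rewrite lexact.
rewrite lie2_skew; [|by case: tA|by case: wA].
move/eqP; rewrite oppr_eq0 => /eqP /(ip_eq0 (@ipf_pos _ _)).
by move/(coord2_eq0 wA.1) => h Y Z; exact: h.
Qed.

(** The argument of [harmonic2], one degree higher. *)
Lemma harmonic3 b : alt3 b -> (forall X Y Z W, d3 b X Y Z W = 0) ->
  exists2 s, alt2 s &
    forall X Y Z W, lie3 X (fun A B C => b A B C - d2 s A B C) Y Z W = 0.
Proof.
move=> bA bcl.
have alt20 : alt2 (fun _ _ => 0).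
  by split; [split=> X k u v; rewrite scaler0 addr0|].
have [U UP] := @subspace_exists R {ffun 'I_N * 'I_N * 'I_N -> R^o}
  [set v | exists2 s, alt2 s & v = coord3 (d2 s)]
  ltac:(by exists (fun _ _ => 0); [|apply/ffunP => p; rewrite !ffunE /d2; ring])
  ltac:(by move=> k _ _ [s sA ->] [t tA ->];
    exists (fun X Y => k *: s X Y + t X Y); [exact: alt2_comb|
     apply/ffunP => p; rewrite !ffunE d2_comb]).
have [_ /UP[s sA ->] orth] :=
  orthogonal_projection (@ipf_lin _ _) (@ipfC _ _) (@ipf_pos _ _) U (coord3 b).
exists s => // X.
set t := fun A B C => b A B C - d2 s A B C.
have tA : alt3 t by exact: alt3_sub bA (alt3_d2 sA).
have tcl A B C D : d3 t A B C D = 0 by rewrite d3_sub bcl d3d2// subrr.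
have nl t' : alt3 t' -> alt2 (fun A B => - t' X A B).
  move=> t'A; have := alt2_comb (-1) (alt2_interior X t'A) alt20.
  have -> // : (fun A B => -1 *: t' X A B + 0) = (fun A B => - t' X A B).
  by apply/funext => A; apply/funext => B; rewrite scaleN1r addr0.
have lexact t' : alt3 t' -> (forall A B C D, d3 t' A B C D = 0) ->
    lie3 X t' = d2 (fun A B => - t' X A B).
  move=> t'A t'cl; apply/funext => Y; apply/funext => Z; apply/funext => W.
  by rewrite lie3_exact// /d2; ring.
have wA : alt3 (lie3 X t) by rewrite lexact//; apply: alt3_d2; exact: nl.
have wcl A B C D : d3 (lie3 X t) A B C D = 0 by rewrite lexact// d3d2//; exact: nl.
have cE : coord3 b - coord3 (d2 s) = coord3 t.
  by apply/ffunP => p; rewrite !ffunE.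
have : ipf (coord3 t) (coord3 (lie3 X (lie3 X t))) = 0.
  rewrite -cE; apply: orth; apply/UP; exists (fun A B => - (lie3 X t) X A B).
    exact: nl.
  by rewrite lexact.
rewrite lie3_skew//.
move/eqP; rewrite oppr_eq0 => /eqP /(ip_eq0 (@ipf_pos _ _)).
by move/(coord3_eq0 wA) => h Y Z W; exact: h.
Qed.

(** The harmonic part is an invariant 2-form, and those vanish. *)
Lemma closed_alt2_exact s : alt2 s -> (forall X Y Z, d2 s X Y Z = 0) ->
  exists2 l : V -> R^o, linear l & forall X Y, s X Y = l (br X Y).
Proof.
move=> sA scl; have [l ll inv] := harmonic2 sA scl.
have tA : alt2 (fun A B => s A B - d1 l A B) by exact: alt2_sub sA (alt2_d1 ll).
exists (fun X => - l X) => [k u v|X Y]; first by rewrite ll opprD scalerN.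
by have /eqP := invariant_alt2_eq0 tA inv X Y; rewrite subr_eq0 => /eqP.
Qed.

Definition ad_invariant (Q : V -> V -> R^o) : Prop :=
  forall X Y Z, lie2 X Q Y Z = 0.

(** The harmonic part t is invariant and closed, so by Cartan each t(X, ., .) is
    a closed 2-form, hence of the form Q(X, [., .]). Linearity, invariance and
    symmetry of Q hold because brackets span the algebra and invariant 2-forms
    vanish. *)
Lemma closed_alt3_decomposition b : alt3 b ->
  (forall X Y Z W, d3 b X Y Z W = 0) ->
  exists Q s, [/\ bilinear_form Q, forall X Y, Q X Y = Q Y X, ad_invariant Q,
    alt2 s & forall X Y Z, b X Y Z = Q (br X Y) Z + d2 s X Y Z].
Proof.
move=> bA bcl; have [s sA inv] := harmonic3 bA bcl.
set t := fun A B C => b A B C - d2 s A B C in inv.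
have tA : alt3 t by exact: alt3_sub bA (alt3_d2 sA).
have tcl A B C D : d3 t A B C D = 0 by rewrite d3_sub bcl d3d2// subrr.
have icl X Y Z W : d2 (t X) Y Z W = 0.
  by apply/eqP; rewrite -oppr_eq0 -lie3_exact// inv.
have /choice[Q QP] X : exists l : V -> R^o, linear l /\ forall Y Z, t X Y Z = l (br Y Z).
  by have [l] := closed_alt2_exact (alt2_interior X tA) (icl X); exists l.
have Qr X : linear (Q X) by case: (QP X).
have tQ X Y Z : t X Y Z = Q X (br Y Z) by case: (QP X).
have [_ _ t1 _ _] := tA.
have Ql Z : linear (Q ^~ Z).
  move=> k X Y /=; apply/eqP; rewrite -subr_eq0; apply/eqP.
  apply: (@perfect (fun Z => Q (k *: X + Y) Z - (k *: Q X Z + Q Y Z))) => [c u v|A B].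
    by rewrite !Qr /GRing.scale /=; ring.
  by rewrite -!tQ t1 subrr.
have Qinv : ad_invariant Q.
  move=> X Y Z; rewrite /lie2.
  apply: (@perfect (fun Z => Q (br X Y) Z + Q Y (br X Z))) => [c u v|A B].
    by rewrite brr !Qr /GRing.scale /=; ring.
  have := inv X Y A B; rewrite /lie3 !tQ (jac X A B).
  have [QD _ _ _] := linear_comb (Qr Y); rewrite QD; lra.
have Qsym X Y : Q X Y = Q Y X.
  apply/eqP; rewrite -subr_eq0; apply/eqP.
  apply: (@invariant_alt2_eq0 (fun X Y => Q X Y - Q Y X)) => [|A B C].
    split; last by move=> A; rewrite subrr.
    split=> [A c u v|A c u v]; rewrite (Qr A) (Ql A) /GRing.scale /=; ring.
  by have := Qinv A B C; have := Qinv A C B; rewrite /lie2; lra.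
exists Q, s; split=> // X Y Z.
have : t X Y Z = Q (br X Y) Z.
  rewrite tQ; have := Qinv Y X Z; rewrite /lie2 (brC Y X).
  by have [_ _ QN _] := linear_comb (Ql Z); rewrite QN; lra.
by rewrite /t => <-; rewrite subrK.
Qed.

(** * Forms invariant under a group of isometries *)
Section GroupInvariance.
Variables (T : Type) (act : T -> V -> V).
Hypotheses (act_lin : forall h, linear (act h)).
Hypothesis act_br : forall h X Y, act h (br X Y) = br (act h X) (act h Y).
Hypothesis act_ip : forall h X Y, ip (act h X) (act h Y) = ip X Y.
Hypothesis act_inv : forall h, exists k, forall X, act h (act k X) = X.

Lemma sum_act (u w : V -> R^o) h : linear u -> linear w ->
  \sum_i u (act h (e i)) * w (act h (e i)) = \sum_i u (e i) * w (e i).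
Proof.
move=> ul wl; have [k hk] := act_inv h.
have lin (f : V -> R^o) : linear f -> linear (fun Y => f (act h Y) : R^o).
  by move=> fl c Y Z; rewrite act_lin fl.
have r (f : V -> R^o) : linear f -> rep (fun Y => f (act h Y)) = act k (rep f).
  move=> fl; apply: ip_nondeg => Y.
  by rewrite ipC -(repE _ (lin _ fl)) -(act_ip h) hk ipC -repE.
by rewrite (sum_rep (lin _ ul) (lin _ wl)) !r// act_ip -sum_rep.
Qed.

Lemma ipf_coord2_act s t h : bilinear_form s -> bilinear_form t ->
  ipf (coord2 (fun X Y => s (act h X) (act h Y)))
      (coord2 (fun X Y => t (act h X) (act h Y))) = ipf (coord2 s) (coord2 t).
Proof.
move=> [sr sl] [tr tl]; rewrite !ipf_coord2.
transitivity (\sum_i \sum_j s (act h (e i)) (e j) * t (act h (e i)) (e j)).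
  apply: eq_bigr => i _; exact: (sum_act h (sr (act h (e i))) (tr (act h (e i)))).
rewrite exchange_big /= [RHS]exchange_big /=; apply: eq_bigr => j _.
exact: (sum_act h (sl (e j)) (tl (e j))).
Qed.

(** The primitive orthogonal to the closed 2-forms is unique, so it inherits
    every isometric symmetry of the 3-form. *)
Lemma invariant_primitive (S : set T) s : alt2 s ->
  (forall h, S h -> forall X Y Z,
     d2 s (act h X) (act h Y) (act h Z) = d2 s X Y Z) ->
  exists t, [/\ alt2 t, forall X Y Z, d2 t X Y Z = d2 s X Y Z &
    forall h, S h -> forall X Y, t (act h X) (act h Y) = t X Y].
Proof.
move=> sA sinv.
have alt20 : alt2 (fun _ _ => 0).
  by split; [split=> X k u v; rewrite scaler0 addr0|].
have [U UP] := @subspace_exists R {ffun 'I_N * 'I_N -> R^o}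
  [set v | exists t, [/\ alt2 t, forall X Y Z, d2 t X Y Z = 0 & v = coord2 t]]
  ltac:(by exists (fun _ _ => 0); split;
    [|move=> *; rewrite /d2; ring|apply/ffunP => p; rewrite !ffunE])
  ltac:(by move=> k _ _ [s1 [s1A c1 ->]] [t1 [t1A c2 ->]];
    exists (fun X Y => k *: s1 X Y + t1 X Y); split; [exact: alt2_comb|
     move=> X Y Z; rewrite d2_comb c1 c2 scaler0 addr0|
     apply/ffunP => p; rewrite !ffunE]).
have [_ /UP[z [zA zcl ->]] orth] :=
  orthogonal_projection (@ipf_lin _ _) (@ipfC _ _) (@ipf_pos _ _) U (coord2 s).
pose t X Y := s X Y - z X Y.
have tA : alt2 t by exact: alt2_sub.
have tE X Y Z : d2 t X Y Z = d2 s X Y Z by rewrite d2_sub zcl subr0.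
exists t; split=> // h Sh.
pose ta X Y := t (act h X) (act h Y).
have taA : alt2 ta.
  have [[tr tl] t0] := tA; split; first split.
  - by move=> X k Y Z; rewrite /ta act_lin tr.
  - by move=> X k Y Z; rewrite /ta act_lin tl.
  - by move=> X; exact: t0.
have dA : alt2 (fun X Y => ta X Y - t X Y) by exact: alt2_sub.
have dcl X Y Z : d2 (fun X Y => ta X Y - t X Y) X Y Z = 0.
  rewrite d2_sub tE -(sinv h Sh) -tE.
  by rewrite /d2 /ta !act_br subrr.
have cE : coord2 s - coord2 z = coord2 t by apply/ffunP => p; rewrite !ffunE.
set d := fun X Y => ta X Y - t X Y in dA dcl.
have td : ipf (coord2 t) (coord2 d) = 0.
  by rewrite -cE; apply: orth; apply/UP; exists d.
have := ipf_coord2_act h tA.1 tA.1; rewrite -/ta.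
have -> : coord2 ta = coord2 t + coord2 d.
  by apply/ffunP => p; rewrite !ffunE /d addrC subrK.
have il := @ipf_lin R ('I_N * 'I_N)%type; have ic := @ipfC R ('I_N * 'I_N)%type.
rewrite (ipD il) !(ipDl il ic) td (ic (coord2 d)) td addr0 add0r.
move/eqP; rewrite -subr_eq0 addrAC subrr add0r => /eqP /(ip_eq0 (@ipf_pos _ _)).
move/(coord2_eq0 dA.1) => h0 X Y.
by apply/eqP; rewrite -subr_eq0 -/(ta X Y); apply/eqP; exact: h0.
Qed.

(** A primitive of an invariant 3-form can be chosen invariant, and invariant
    2-forms vanish. *)
Lemma exact_invariant_eq0 (Q : V -> V -> R^o) s : bilinear_form Q ->
  (forall h X Y, Q (act h X) (act h Y) = Q X Y) ->
  (forall t : V -> V -> R^o, bilinear_form t ->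
     (forall h X Y, t (act h X) (act h Y) = t X Y) ->
     forall X Y Z, lie2 X t Y Z = 0) ->
  alt2 s -> (forall X Y Z, Q (br X Y) Z = d2 s X Y Z) ->
  forall X Y, Q X Y = 0.
Proof.
move=> [Qr Ql] Qinv inf sA sQ X Z.
have [t [tA tE tinv]] : exists t, [/\ alt2 t, forall X Y Z, d2 t X Y Z = d2 s X Y Z &
    forall h, setT h -> forall X Y, t (act h X) (act h Y) = t X Y].
  by apply: invariant_primitive => // h _ A B C; rewrite -!sQ -act_br Qinv.
have t0 := invariant_alt2_eq0 tA (inf t tA.1 (fun h => tinv h I)).
apply: (perfect (Ql Z)) => A B /=.
by rewrite sQ -tE /d2 !t0; ring.
Qed.

End GroupInvariance.

(** * Simple ideals and invariant symmetric forms *)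
Section Ideals.
Hypothesis semisimple : is_semisimple br.

Lemma perp_exists (P : set V) : exists U : {vspace V},
  forall v, v \in U <-> forall w, P w -> ip v w = 0.
Proof.
apply: (@subspace_exists R V [set v | forall w, P w -> ip v w = 0]).
  by move=> w _; rewrite ipC (ip0 ip_lin).
move=> k u v u0 v0 w Pw.
by rewrite (ipDl ip_lin ipC) (ipZl ip_lin ipC) u0// v0// mulr0 addr0.
Qed.

Lemma ideal_perp (a : {vspace V}) X Y : is_ideal br a ->
  (forall w, w \in a -> ip Y w = 0) -> forall w, w \in a -> ip (br X Y) w = 0.
Proof.
move=> ia Y0 w wa; have /eqP := ip_ad X Y w; rewrite (Y0 (br X w)) ?addr0 => [/eqP//|].
exact: ia.
Qed.

Lemma br_perp (a : {vspace V}) X Y : is_ideal br a -> X \in a ->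
  (forall w, w \in a -> ip Y w = 0) -> br X Y = 0.
Proof.
move=> ia Xa Y0; apply: (ip_eq0 ip_pos); apply: ideal_perp Y0 _ _ => //.
by rewrite brC memvN; exact: ia.
Qed.

Lemma br_mem0 (a : {vspace V}) X Y : is_ideal br a -> X \in a -> br X Y \in a.
Proof. by move=> ia Xa; rewrite brC memvN; exact: ia. Qed.

(** What is orthogonal to the ideal a commutes with it, so only brackets inside a
    matter. *)
Lemma subideal_ideal (a b : {vspace V}) : is_ideal br a -> (b <= a)%VS ->
  (forall X Y, X \in a -> Y \in b -> br X Y \in b) -> is_ideal br b.
Proof.
move=> ia ba stab X Y Yb.
have [X1 X1a orth] := orthogonal_projection ip_lin ipC ip_pos a X.
rewrite -(subrK X1 X).
have -> : br (X - X1 + X1) Y = br (X - X1) Y + br X1 Y.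
  by have := brl Y 1 (X - X1) X1; rewrite !scale1r.
rewrite memvD//; last exact: stab.
by rewrite brC (br_perp ia) ?oppr0 ?mem0v//; exact: (subvP ba).
Qed.

Lemma simple_ideal_exists (a : {vspace V}) : is_ideal br a -> a != 0%VS ->
  exists2 b : {vspace V}, (b <= a)%VS & is_simple_ideal br b.
Proof.
have [m] := ubnP (\dim a); elim: m a => // m IH a; rewrite ltnS => dam ia a0.
have [[b [bi b0 ba bna]]|nex] := pselect (exists b : {vspace V},
    [/\ is_ideal br b, b != 0%VS, (b <= a)%VS & b <> a]).
  have lt : (\dim b < m)%N.
    apply: leq_trans dam; rewrite ltn_neqAle dimvS// andbT.
    by apply/negP => /eqP dE; apply: bna; apply/eqP; rewrite eqEdim ba dE leqnn.
  by have [d db dS] := IH b lt bi b0; exists d => //; exact: subv_trans ba.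
exists a => //; split=> //.
  by move=> ab; move: a0; rewrite (semisimple ia ab) eqxx.
move=> b ba stab; have bi := subideal_ideal ia ba stab.
have [b0|b0] := eqVneq b 0%VS; [by left|right].
by apply: contrapT => bna; apply: nex; exists b.
Qed.

Lemma simple_ideal_neq0 a : is_simple_ideal br a -> a != 0%VS.
Proof.
move=> [_ nab _]; apply/eqP => a0; apply: nab => X Y.
rewrite a0 !memv0 => /eqP-> /eqP->; exact: br_alt.
Qed.

Lemma simple_ideal_cap a b : is_simple_ideal br a -> is_simple_ideal br b ->
  a <> b -> (a :&: b = 0)%VS.
Proof.
move=> [ia _ sa] [ib _ sb] ab.
have st X Y : Y \in (a :&: b)%VS -> br X Y \in (a :&: b)%VS.
  by rewrite !memv_cap => /andP[Ya Yb]; rewrite ia ?ib.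
have [//|ea] := sa _ (capvSl a b) (fun X Y _ => st X Y).
have [//|eb] := sb _ (capvSr a b) (fun X Y _ => st X Y).
by case: ab; rewrite -ea eb.
Qed.

(** A simple ideal is spanned by its brackets: the orthogonal complement of the
    brackets in it is its center. *)
Lemma simple_perfect a (u : V -> R^o) : is_simple_ideal br a -> linear u ->
  (forall X Y, X \in a -> Y \in a -> u (br X Y) = 0) ->
  forall X, X \in a -> u X = 0.
Proof.
move=> [ia nab sa] ul u0 X Xa.
have [C CP] := @subspace_exists R V [set v | v \in a /\ forall w, w \in a -> br w v = 0]
  ltac:(by split; [exact: mem0v|move=> w _; have [_ -> _ _] := linear_comb (brr w)])
  ltac:(by move=> k x y [xa x0] [ya y0]; split;
    [rewrite memvD ?memvZ|move=> w wa; rewrite brr x0// y0// scaler0 addr0]).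
have Ca : (C <= a)%VS by apply/subvP => v /CP[].
have [v Y va /CP[_ Y0]|C0|CE] := sa C Ca.
- by rewrite Y0//; exact: mem0v.
- have [r ra orth] := orthogonal_projection ip_lin ipC ip_pos a (rep u).
  have ur Y : Y \in a -> u Y = ip r Y.
    move=> Ya; rewrite (repE _ ul); apply/eqP; rewrite -subr_eq0 -(ipBl ip_lin ipC).
    by rewrite orth.
  rewrite ur//; have : r \in C.
    apply/CP; split=> // w wa; apply: (ip_eq0 ip_pos).
    have /eqP := ip_ad w r (br w r); rewrite -(ur (br w (br w r))); last first.
      by rewrite ia// ia.
    by rewrite u0 ?addr0 ?ia// => /eqP.
  by rewrite C0 memv0 => /eqP->; rewrite ipC (ip0 ip_lin).
- by case: nab => A B Aa; rewrite -CE => /CP[_ ->].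
Qed.

(** Brackets span a, and [a, b] lies in the intersection of a and b, which is
    0. *)
Lemma simple_ideals_orthogonal (Q : V -> V -> R^o) a b X Y :
  bilinear_form Q -> ad_invariant Q ->
  is_simple_ideal br a -> is_simple_ideal br b -> a <> b ->
  X \in a -> Y \in b -> Q X Y = 0.
Proof.
move=> [Qr Ql] Qad sa sb ab Xa Yb.
have [ia _ _] := sa; have [ib _ _] := sb.
apply: (simple_perfect sa (Ql Y)) => // A B Aa Ba /=.
have /eqP := Qad A B Y; rewrite /lie2.
have -> : br A Y = 0.
  apply/eqP; rewrite -memv0 -(simple_ideal_cap sa sb ab) memv_cap ib// andbT.
  exact: br_mem0.
by have [_ -> _ _] := linear_comb (Qr B); rewrite addr0 => /eqP.
Qed.

Lemma simple_ideal_vector a : is_simple_ideal br a ->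
  exists2 x, x \in a & x != 0.
Proof.
move=> /simple_ideal_neq0 a0; exists (vpick a); first exact: memv_pick.
by rewrite vpick0.
Qed.

Lemma ip_form : bilinear_form ip.
Proof. by split=> // Y k u v; rewrite /= ipC ip_lin !(ipC Y). Qed.

(** Distinct simple ideals are orthogonal, so vectors chosen in them are
    independent. *)
Lemma simple_ideals_bounded (t : seq {vspace V}) : uniq t ->
  {in t, forall a, is_simple_ideal br a} -> (size t <= \dim {:V})%N.
Proof.
move=> ut st.
have x_ i : {x | x \in tnth (in_tuple t) i & x != 0}.
  by apply: cid2; apply: simple_ideal_vector; apply: st; exact: mem_tnth.
pose x i := s2val (x_ i).
have xa i : x i \in tnth (in_tuple t) i by rewrite /x; case: (x_ i).
have xn0 i : x i != 0 by rewrite /x; case: (x_ i).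
have xo i j : i != j -> ip (x i) (x j) = 0.
  move=> ij; apply: (simple_ideals_orthogonal ip_form ip_ad _ _ _ (xa i) (xa j)).
  - by apply: st; exact: mem_tnth.
  - by apply: st; exact: mem_tnth.
  - by apply/eqP; move: ij; apply: contra_neq; exact: (elimT (tuple_uniqP (in_tuple t)) ut _ _).
pose X := [tuple x i | i < size t].
have XE (i : 'I_(size t)) : X`_i = x i by rewrite -tnth_nth tnth_mktuple.
have fX : free X.
  apply/freeP => k kX i; have := congr1 (ip (x i)) kX.
  under eq_bigr do rewrite XE.
  rewrite (ip0 ip_lin) (ip_sumr ip_lin) (bigD1 i)//= big1 ?addr0 => [|j ji].
    rewrite (ipZ ip_lin) => /eqP; rewrite mulf_eq0.
    by rewrite (gt_eqF (ip_pos (xn0 i))) orbF => /eqP.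
  by rewrite (ipZ ip_lin) xo ?mulr0// eq_sym.
move: fX; rewrite /free => /eqP; rewrite size_tuple => <-.
by apply: dimvS; exact: subvf.
Qed.

Lemma simple_ideals_enum : exists t : seq {vspace V},
  uniq t /\ forall a, a \in t <-> is_simple_ideal br a.
Proof.
pose P d := `[< exists t : seq {vspace V}, [/\ uniq t, size t = d &
  {in t, forall a, is_simple_ideal br a}] >].
have P0 : exists d, P d by exists 0%N; apply/asboolP; exists [::].
have Pb d : P d -> (d <= \dim {:V})%N.
  by move=> /asboolP[t [ut <- st]]; exact: simple_ideals_bounded.
case: (ex_maxnP P0 Pb) => d /asboolP[t [ut td st]] dmax.
exists t; split=> // a; split; first exact: st.
move=> sa; apply: contrapT => /negP at_.
have : P (size (a :: t)).
  apply/asboolP; exists (a :: t); split=> //=; first by rewrite at_.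
  by move=> b; rewrite inE => /orP[/eqP->|/st].
by move=> /dmax /=; rewrite td ltnn.
Qed.

Lemma quadratic_continuous d (B : 'rV[R]_d -> 'rV[R]_d -> R^o) :
  (forall u, linear (B u)) -> (forall v, linear (B ^~ v)) ->
  continuous (fun t => B t t).
Proof.
move=> Br Bl t; have idd := ex_diff (is_diff_def := is_diff_id t).
have [dB _] := derivative_bilinear Br Bl idd idd.
exact: (differentiable_continuous dB).
Qed.

Lemma sphere_compact d : compact [set t : 'rV[R]_d | sq t = 1].
Proof.
apply: bounded_closed_compact.
  exists 1; split; first exact: num_real.
  move=> M M1 t /= t1; apply: le_trans (ltW M1).
  by rewrite -[leRHS]sqrtr1 -t1 -ler_sqr ?nnegrE ?sqrtr_ge0// sqr_sqrtr ?sq_ge0// norm_le_sq.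
pose B (t u : 'rV[R]_d) : R^o := \sum_i t ord0 i * u ord0 i.
have Br u : linear (B u).
  move=> k v w; rewrite /B scaler_sumr -big_split; apply: eq_bigr => i _.
  by rewrite !mxE /GRing.scale /=; ring.
have Bl u : linear (B ^~ u).
  move=> k v w; rewrite /B scaler_sumr -big_split; apply: eq_bigr => i _.
  by rewrite !mxE /GRing.scale /=; ring.
have := @closed_comp _ _ (fun t => B t t) [set x | x = 1].
by apply; [move=> t _; exact: quadratic_continuous|exact: closed_eq].
Qed.

(** The maximum of the quadratic form on the unit sphere of the ideal is an
    eigenvalue; its eigenspace is a nonzero subideal. *)
Lemma simple_ideal_scalar (a : {vspace V}) (Q : V -> V -> R^o) :
  is_simple_ideal br a -> bilinear_form Q -> (forall X Y, Q X Y = Q Y X) ->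
  ad_invariant Q ->
  exists lam : R, forall X Y, X \in a -> Y \in a -> Q X Y = lam * ip X Y.
Proof.
move=> sa [Qr Ql] Qsym Qad.
have [d [f [fa ff fE]]] := orthonormal_basis ip_lin ipC ip_pos a.
pose w (t : 'rV[R]_d) := \sum_i t ord0 i *: f i.
have wlin k s t : w (k *: s + t) = k *: w s + w t.
  rewrite /w scaler_sumr -big_split; apply: eq_bigr => i _.
  by rewrite !mxE scalerDl scalerA.
have wa t : w t \in a by apply: memv_suml => i _; exact: memvZ.
have ipw s t : ip (w s) (w t) = \sum_i s ord0 i * t ord0 i.
  rewrite /w (ip_sumr ip_lin); apply: eq_bigr => i _.
  rewrite (ip_suml ip_lin ipC) (bigD1 i)//= big1 => [|j ji].
    by rewrite (ipZ ip_lin) (ipZl ip_lin ipC) ff eqxx mulr1 addr0 mulrC.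
  by rewrite (ipZ ip_lin) (ipZl ip_lin ipC) ff (negPf ji) mulr0 mulr0.
have wsurj X : X \in a -> X = w (\row_i ip X (f i)).
  by move=> Xa; rewrite {1}(fE X Xa); apply: eq_bigr => i _; rewrite mxE.
have cF : continuous (fun t => Q (w t) (w t)).
  apply: (@quadratic_continuous d (fun s t => Q (w s) (w t))).
    by move=> s k t u; rewrite wlin Qr.
  by move=> s k t u; rewrite wlin Ql.
have normal X : X \in a -> X != 0 -> exists t, sq t = 1 /\ w t = (Num.sqrt (ip X X))^-1 *: X.
  move=> Xa X0; have XX := ip_pos X0.
  exists ((Num.sqrt (ip X X))^-1 *: \row_i ip X (f i)).
  have wE : w ((Num.sqrt (ip X X))^-1 *: \row_i ip X (f i)) = (Num.sqrt (ip X X))^-1 *: X.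
    have := wlin (Num.sqrt (ip X X))^-1 (\row_i ip X (f i)) 0.
    rewrite addr0 -wsurj// => ->.
    have -> : w 0 = 0 by rewrite /w big1// => i _; rewrite mxE scale0r.
    by rewrite addr0.
  split=> //.
  rewrite /sq; under eq_bigr do rewrite expr2; rewrite -ipw wE (ipZ ip_lin) (ipZl ip_lin ipC).
  by rewrite mulrA -invfM -expr2 sqr_sqrtr ?mulVf ?gt_eqF//; exact: ltW.
have [x xa x0] := simple_ideal_vector sa.
have [t0 t01 tmax] : exists2 c, sq c = 1 & forall t, sq t = 1 -> Q (w t) (w t) <= Q (w c) (w c).
  have [|c] := EVT_max_rV _ (@sphere_compact d) (continuous_subspaceT cF).
    by have [t [t1 _]] := normal x xa x0; exists t.
  by rewrite inE => c1 cmax; exists c => // t t1; apply: cmax; rewrite inE.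
pose lam := Q (w t0) (w t0); exists lam.
pose P X Y : R^o := lam * ip X Y - Q X Y.
have Pr X : linear (P X).
  by move=> k Y Z; rewrite /P ip_lin Qr /GRing.scale /=; ring.
have Psym X Y : P X Y = P Y X by rewrite /P ipC Qsym.
have Ppsd X : X \in a -> 0 <= P X X.
  move=> Xa; have [->|X0] := eqVneq X 0.
    by have [_ -> _ _] := linear_comb (Pr 0).
  have [t [t1 wt]] := normal X Xa X0; have := tmax t t1; rewrite wt -/lam.
  have [_ _ _ QZ] := linear_comb (Qr ((Num.sqrt (ip X X))^-1 *: X)).
  have [_ _ _ QZ'] := linear_comb (Ql X).
  rewrite QZ QZ' /GRing.scale /= mulrA -invfM -expr2 sqr_sqrtr ?(ltW (ip_pos X0))//.
  by rewrite /P subr_ge0 ler_pdivrMl ?(ip_pos X0)// mulrC.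
have P0 : P (w t0) (w t0) = 0.
  rewrite /P ipw; under eq_bigr do rewrite -expr2.
  by rewrite -/(sq t0) t01 mulr1 subrr.
have Prad Y : Y \in a -> P (w t0) Y = 0.
  move=> Ya; have quad s : 0 <= 2 * s * P (w t0) Y + s ^+ 2 * P Y Y.
    have := Ppsd (s *: Y + w t0); rewrite memvD ?memvZ// => /(_ isT).
    rewrite Pr [P _ Y]Psym [P _ (w t0)]Psym !Pr P0 [P Y (w t0)]Psym /GRing.scale /=.
    by congr (_ <= _); ring.
  have PY := Ppsd Y Ya; set b := P (w t0) Y in quad *; set q := P Y Y in quad PY.
  have := quad (- b / (q + 1)); have q1 : 0 < q + 1 by lra.
  have -> : 2 * (- b / (q + 1)) * b + (- b / (q + 1)) ^+ 2 * q =
      - (b ^+ 2 * ((q + 2) / (q + 1) ^+ 2)) by field; lra.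
  rewrite oppr_ge0 pmulr_lle0; last by rewrite divr_gt0 ?exprn_gt0//; lra.
  by move=> h; apply/eqP; rewrite -sqrf_eq0 eq_le h sqr_ge0.
have [C CP] := @subspace_exists R V
  [set X | X \in a /\ forall Y, Y \in a -> P X Y = 0]
  ltac:(by split; [exact: mem0v|move=> Y _; rewrite Psym; have [_ -> _ _] := linear_comb (Pr Y)])
  ltac:(by move=> k X Y [Xa X0] [Ya Y0]; split; [rewrite memvD ?memvZ|
    move=> Z Za; rewrite Psym Pr ![P Z _]Psym X0// Y0// scaler0 addr0]).
have [ia _ sub] := sa.
have Ca : (C <= a)%VS by apply/subvP => v /CP[].
have [X Y Xa /CP[Ya Y0]|C0|CE] := sub C Ca.
- apply/CP; split=> [|Z Za]; first exact: ia.
  have := Y0 (br X Z) (ia _ _ Za); have := Qad X Y Z; have := ip_ad X Y Z.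
  rewrite /P /lie2 => e1 e2 e3.
  have -> : ip (br X Y) Z = - ip Y (br X Z) by lra.
  lra.
- have /CP : w t0 \in a /\ forall Y, Y \in a -> P (w t0) Y = 0 by [].
  rewrite C0 memv0 => /eqP w0; move: P0.
  have := ipw t0 t0; under eq_bigr do rewrite -expr2.
  rewrite -/(sq t0) t01 w0 (ip0 ip_lin) => /eqP.
  by rewrite eq_sym oner_eq0.
- move=> X Y; rewrite -{1}CE => /CP[_ X0] Ya; have := X0 Y Ya.
  by rewrite /P => /eqP; rewrite subr_eq0 => /eqP ->.
Qed.

(** E is the inner product preceded by the orthogonal projection to the ideal,
    which commutes with ad. *)
Lemma ideal_form (a : {vspace V}) : is_ideal br a ->
  exists E : V -> V -> R^o,
    [/\ bilinear_form E, forall X Y, E X Y = E Y X, ad_invariant E,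
        forall X Y, X \in a -> E X Y = ip X Y &
        forall X Y, (forall w, w \in a -> ip X w = 0) -> E X Y = 0].
Proof.
move=> ia.
have [d [f [fa ff fE]]] := orthonormal_basis ip_lin ipC ip_pos a.
pose pr X := \sum_i ip X (f i) *: f i.
have pra X : pr X \in a by apply: memv_suml => i _; exact: memvZ.
have prlin k X Y : pr (k *: X + Y) = k *: pr X + pr Y.
  rewrite /pr scaler_sumr -big_split; apply: eq_bigr => i _.
  by rewrite (ipDl ip_lin ipC) (ipZl ip_lin ipC) scalerDl scalerA.
have prK X : X \in a -> pr X = X by move=> /fE {2}->.
have pr0 X : (forall w, w \in a -> ip X w = 0) -> pr X = 0.
  by move=> X0; rewrite /pr big1// => i _; rewrite X0// scale0r.
have orth X w : w \in a -> ip (X - pr X) w = 0.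
  move=> wa; rewrite (fE w wa) (ip_sumr ip_lin) big1// => j _.
  rewrite (ipZ ip_lin) (ipBl ip_lin ipC) /pr (ip_suml ip_lin ipC) (bigD1 j)//=.
  rewrite big1 => [|i ij]; last by rewrite (ipZl ip_lin ipC) ff (negPf ij) mulr0.
  by rewrite (ipZl ip_lin ipC) ff eqxx mulr1 addr0 subrr mulr0.
have prbr Z X : pr (br Z X) = br Z (pr X).
  have e1 : br Z X = 1 *: br Z (X - pr X) + br Z (pr X).
    by rewrite -[in RHS]brr scale1r subrK.
  have e2 : pr (br Z (X - pr X)) = 0.
    by apply: pr0; exact: (ideal_perp Z ia (orth X)).
  by rewrite e1 prlin e2 scaler0 add0r prK// ia.
exists (fun X Y => ip (pr X) Y).
have Esym X Y : ip (pr X) Y = ip (pr Y) X.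
  have e1 : ip (Y - pr Y) (pr X) = 0 by exact: orth.
  have e2 : ip (X - pr X) (pr Y) = 0 by exact: orth.
  move: e1 e2; rewrite !(ipBl ip_lin ipC) [ip (pr X) Y]ipC [ip (pr Y) X]ipC.
  by rewrite [ip (pr X) _]ipC; lra.
split=> //.
- split=> [X|Y k X Z /=]; first exact: ip_lin.
  by rewrite prlin (ipDl ip_lin ipC) (ipZl ip_lin ipC).
- by move=> X Y Z; rewrite /lie2 prbr; exact: ip_ad.
- by move=> X Y Xa; rewrite prK.
- by move=> X Y X0; rewrite pr0// ipC (ip0 ip_lin).
Qed.

(** The vectors orthogonal to all simple ideals form an ideal without simple
    ideals, which is 0: the algebra is the orthogonal sum of its simple ideals.
    An invariant form is block diagonal for this sum, and a multiple of the
    inner product on each block. *)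
Lemma ad_invariant_forms_basis : exists (s : nat) (a : 'I_s -> {vspace V})
    (E : 'I_s -> V -> V -> R^o),
  [/\ injective a, forall b, is_simple_ideal br b <-> exists i, a i = b,
      forall i, [/\ bilinear_form (E i), forall X Y, E i X Y = E i Y X &
                    ad_invariant (E i)],
      forall Q, bilinear_form Q -> (forall X Y, Q X Y = Q Y X) -> ad_invariant Q ->
        exists lam : 'I_s -> R, forall X Y, Q X Y = \sum_i lam i * E i X Y &
      forall lam : 'I_s -> R, (forall X Y, \sum_i lam i * E i X Y = 0) ->
        forall i, lam i = 0].
Proof.
have [t [ut tP]] := simple_ideals_enum.
pose a := tnth (in_tuple t).
have sa i : is_simple_ideal br (a i) by apply/tP; exact: mem_tnth.
have ia i : is_ideal br (a i) by case: (sa i).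
have ainj : injective a by exact: (elimT (tuple_uniqP (in_tuple t)) ut).
have /choice[E EP] i := ideal_form (ia i).
have Eon i X Y : X \in a i -> E i X Y = ip X Y by have [_ _ _ + _] := EP i; exact.
have orth i j X Y : i != j -> X \in a i -> Y \in a j -> ip X Y = 0.
  move=> ij; apply: (simple_ideals_orthogonal ip_form ip_ad (sa i) (sa j)).
  by move=> /ainj eij; rewrite eij eqxx in ij.
have Eoff i j X Y : i != j -> X \in a i -> E j X Y = 0.
  move=> ij Xi; have [_ _ _ _] := EP j; apply => w wj.
  exact: orth ij Xi wj.
exists (size t), a, E; split=> //.
- move=> b; split=> [/tP bt|[i <-]//].
  by have /tnthP[i ->] : b \in in_tuple t by []; exists i.
- by move=> i; have [? ? ? _ _] := EP i.
- move=> Q [Qr Ql] Qsym Qad.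
  have /choice[lam lamP] i := simple_ideal_scalar (sa i) (conj Qr Ql) Qsym Qad.
  exists lam => X Y.
  have /choice[pr prP] i : exists u, u \in a i /\ forall w, w \in a i -> ip (Y - u) w = 0.
    by have [u ua uo] := orthogonal_projection ip_lin ipC ip_pos (a i) Y; exists u.
  have YE : Y = \sum_i pr i.
    apply/eqP; rewrite -subr_eq0.
    have [W WP] := perp_exists [set w | exists i, w \in a i].
    have wi : is_ideal br W.
      move=> A B /WP B0; apply/WP => w [i wa].
      by apply: (ideal_perp A (ia i)) => // w' w'a; apply: B0; exists i.
    have [W0|W0] := eqVneq W 0%VS.
      rewrite -memv0 -W0; apply/WP => w [i wa].
      rewrite (ipBl ip_lin ipC) (ip_suml ip_lin ipC) (bigD1 i)//= big1 => [|j ji].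
        have [_ /(_ w wa)] := prP i; rewrite (ipBl ip_lin ipC) addr0.
        exact.
      by apply: (orth j i) => //; case: (prP j).
    have [b bW /[dup] sb /tP bt] := simple_ideal_exists wi W0.
    have [x xb /eqP[]] := simple_ideal_vector sb.
    apply: (ip_eq0 ip_pos); have /WP := subvP bW _ xb; apply.
    have /tnthP[i bi] : b \in in_tuple t by [].
    by exists i; rewrite /a -bi.
  have both (F : V -> R^o) : linear F -> F Y = \sum_i F (pr i).
    by move=> /linear_comb[FD F0 _ _]; rewrite {1}YE; elim/big_rec2: _ => // i x y _ <-.
  rewrite (both _ (Qr X)); apply: eq_bigr => i _.
  have pa : pr i \in a i by case: (prP i).
  have [[_ El] Es _ _ _] := EP i.
  have -> : E i X Y = ip X (pr i).
    rewrite Es (both _ (El X)) (bigD1 i)//= big1 => [|j ji].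
      by rewrite addr0 Eon// ipC.
    by apply: (@Eoff j) => //; case: (prP j).
  have [u ua orthu] := orthogonal_projection ip_lin ipC ip_pos (a i) X.
  have Qv0 : Q (X - u) (pr i) = 0.
    apply: (simple_perfect (sa i) (Qr (X - u))) => // A B Aa Ba.
    have /eqP := Qad A (X - u) B; rewrite /lie2 (br_perp (ia i) Aa orthu).
    by have [_ -> _ _] := linear_comb (Ql B); rewrite add0r => /eqP.
  have [QD _ _ _] := linear_comb (Ql (pr i)).
  rewrite -[in LHS](subrK u X) QD Qv0 add0r (lamP i u _ ua pa); congr (_ * _).
  by apply/eqP; rewrite eq_sym -subr_eq0 -(ipBl ip_lin ipC) orthu.
- move=> lam lam0 i; have [x xa x0] := simple_ideal_vector (sa i).
  have := lam0 x x; rewrite (bigD1 i)//= big1 => [|j ji].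
    by rewrite addr0 Eon// => /eqP; rewrite mulf_eq0 (gt_eqF (ip_pos x0)) orbF => /eqP.
  by rewrite (@Eoff i) ?mulr0// eq_sym.
Qed.

End Ideals.

End LieAlgebraForms.

(** * Dimensions of subspaces and quotients *)

Section Dimension.
Variable R : realType.
Implicit Types W : lmodType R.

Definition linear_set W (A : set W) : Prop :=
  A 0 /\ forall k u v, A u -> A v -> A (k *: u + v).

Lemma linear_set_sum W (A : set W) d (e : 'I_d -> W) (t : 'rV[R]_d) :
  linear_set A -> (forall i, A (e i)) -> A (\sum_i t ord0 i *: e i).
Proof.
move=> [A0 Alin] Ae; elim/big_rec: _ => // i w _ Aw; exact: Alin.
Qed.

Lemma has_dim_basis W (A : set W) d (e : 'I_d -> W) :
  (forall i, A (e i)) ->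
  (forall w, A w -> exists t : 'rV[R]_d, w = \sum_i t ord0 i *: e i) ->
  (forall t : 'rV[R]_d, \sum_i t ord0 i *: e i = 0 -> t = 0) ->
  has_dim A d.
Proof.
move=> Ae gen fre; exists e; split=> // w /gen[t ->]; exists t; split.
  by rewrite /= subrr.
move=> s /= /eqP; rewrite subr_eq0 => /eqP ts; apply/eqP.
rewrite -subr_eq0; apply/eqP/fre.
under eq_bigr do rewrite !mxE scalerBl.
by rewrite sumrB ts subrr.
Qed.

(** The uniqueness of coordinates at 0 is linear independence. *)
Lemma has_dimP W (A : set W) d : has_dim A d -> A 0 ->
  exists e : 'I_d -> W, [/\ forall i, A (e i),
    forall w, A w -> exists t : 'rV[R]_d, w = \sum_i t ord0 i *: e i &
    forall t : 'rV[R]_d, \sum_i t ord0 i *: e i = 0 -> t = 0].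
Proof.
move=> [e [Ae un]] A0; exists e; split=> // [w Aw|t t0].
  have [t [/= /eqP + _]] := un w Aw; rewrite subr_eq0 => /eqP ->.
  by exists t.
have [s [_ us]] := un 0 A0; rewrite -(us t); last by rewrite /= t0 subrr.
apply: us; rewrite /= big1 ?subrr// => i _; by rewrite mxE scale0r.
Qed.

Lemma rank_nullity W W' (A : set W) s (f : W -> W') : linear f ->
  linear_set A -> has_dim A s ->
  exists b d, [/\ has_dim [set w | A w /\ f w = 0] b,
    has_dim [set f w | w in A] d & s = (b + d)%N].
Proof.
move=> fl Al dA; have [fD f0 fN fZ] := linear_comb fl.
have [e [Ae gen fre]] := has_dimP dA Al.1.
pose E (t : 'rV[R]_s) := \sum_i t ord0 i *: e i.
have El k t u : E (k *: t + u) = k *: E t + E u.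
  rewrite /E scaler_sumr -big_split; apply: eq_bigr => i _.
  by rewrite !mxE scalerDl scalerA.
have [ED E0 EN EZ] := linear_comb El.
have AE t : A (E t) by exact: linear_set_sum.
have Einj t : E t = 0 -> t = 0 by exact: fre.
have [U UP] := @subspace_exists R _ [set t : 'rV[R]_s | f (E t) = 0]
  ltac:(by rewrite /= E0)
  ltac:(by move=> k u v /= u0 v0; rewrite El fl u0 v0 scaler0 addr0).
have sumE d (b : d.-tuple 'rV[R]_s) (t : 'I_d -> R) :
    E (\sum_i t i *: b`_i) = \sum_i t i *: E b`_i.
  by elim/big_rec2: _ => // i x y _ <-; rewrite El.
exists (\dim U), (\dim U^C); split.
- apply: (@has_dim_basis _ _ _ (fun i => E (vbasis U)`_i)).
  + move=> i; split=> //; apply/UP; apply: vbasis_mem; apply: mem_nth.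
    by rewrite size_tuple.
  + move=> w [/gen[t ->] ft]; have tU : t \in U by apply/UP.
    exists (\row_i coord (vbasis U) i t); rewrite -/(E t) {1}(coord_vbasis tU) sumE.
    by apply: eq_bigr => i _; rewrite mxE.
  + move=> t; rewrite -(sumE _ _ (fun i => t ord0 i)) => /Einj t0; apply/rowP => i; rewrite mxE.
    have /freeP := basis_free (vbasisP U); exact.
- apply: (@has_dim_basis _ _ _ (fun i => f (E (vbasis U^C)`_i))).
  + by move=> i; exists (E (vbasis U^C)`_i).
  + move=> _ [w /gen[t ->] <-].
    have : t \in (U + U^C)%VS by rewrite addv_complf memvf.
    move=> /memv_addP[u uU [v vU tE]].
    exists (\row_i coord (vbasis U^C) i v).
    have -> : \sum_i t ord0 i *: e i = E t by [].
    rewrite tE ED fD; have /UP -> := uU; rewrite add0r {1}(coord_vbasis vU).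
    rewrite sumE; elim/big_rec2: _ => // i x y _ <-.
    by rewrite fl mxE.
  + move=> t; have -> : \sum_i t ord0 i *: f (E (vbasis U^C)`_i) =
        f (E (\sum_i t ord0 i *: (vbasis U^C)`_i)).
      by rewrite sumE; elim/big_rec2: _ => // i x y _ ->; rewrite fl.
    move=> t0; set v := \sum_i _ in t0.
    have vU : v \in U by apply/UP.
    have vC : v \in (U^C)%VS.
      apply: memv_suml => i _; apply: memvZ; apply: vbasis_mem; apply: mem_nth.
      by rewrite size_tuple.
    have v0 : v = 0.
      by apply/eqP; rewrite -memv0 -(capv_compl U) memv_cap vU.
    apply/rowP => i; rewrite mxE.
    have /freeP := basis_free (vbasisP U^C); exact.
- have dU := dimv_disjoint_sum (capv_compl U).
  by rewrite -dU addv_complf dimvf /dim /= mul1n.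
Qed.

(** A complement of B in C, parametrised by f, has the dimension of the
    quotient. *)
Lemma has_dim_quot_image W W' (A : set W) (C B : set W') d (f : W -> W') :
  linear f -> linear_set A -> has_dim A d -> (forall w, A w -> C (f w)) ->
  (forall w, C w -> exists! Q, A Q /\ B (w - f Q)) ->
  has_dim_quot C B d.
Proof.
move=> fl Al dA AC un; have [fD f0 fN fZ] := linear_comb fl.
have [e [Ae gen fre]] := has_dimP dA Al.1.
have fsum (t : 'rV[R]_d) : \sum_i t ord0 i *: f (e i) = f (\sum_i t ord0 i *: e i).
  by elim/big_rec2: _ => // i x y _ ->; rewrite fl.
exists (fun i => f (e i)); split=> [i|w Cw]; first exact: AC.
have [Q [[AQ BQ] uQ]] := un w Cw; have [t tQ] := gen Q AQ.
exists t; split; first by rewrite fsum -tQ.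
move=> s; rewrite fsum => Bs.
have Qs : Q = \sum_i s ord0 i *: e i.
  by apply: uQ; split=> //; exact: linear_set_sum.
apply/eqP; rewrite -subr_eq0; apply/eqP/fre.
under eq_bigr do rewrite !mxE scalerBl.
by rewrite sumrB -tQ -Qs subrr.
Qed.

End Dimension.

(** * Alternating forms in degrees two and three *)

Section ExtForms.
Variables (R : realType) (V : vectType R).

Definition tup2 (X Y : V) : 'I_2 -> V := fun i => if i == 0 :> nat then X else Y.

Definition tup3 (X Y Z : V) : 'I_3 -> V :=
  fun i => if i == 0 :> nat then X else if i == 1 :> nat then Y else Z.

Definition uncurry2 (s : V -> V -> R^o) : ext_form R V 2 :=
  fun x => s (x ord0) (x (inord 1)).

Lemma tup2E (x : 'I_2 -> V) : x = tup2 (x ord0) (x (inord 1)).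
Proof.
apply/funext => i; rewrite /tup2; case: i => -[|[|//]] Hi /=; congr x; apply: val_inj => //=.
by rewrite inordK.
Qed.

Lemma tup3E (x : 'I_3 -> V) : x = tup3 (x ord0) (x (inord 1)) (x (inord 2)).
Proof.
apply/funext => i; rewrite /tup3; case: i => -[|[|[|//]]] Hi /=; congr x;
  by apply: val_inj; rewrite //= inordK.
Qed.

Lemma uncurry2E (a : ext_form R V 2) : a = uncurry2 (fun X Y => a (tup2 X Y)).
Proof. by apply/funext => x; rewrite /uncurry2 -tup2E. Qed.

Lemma form3E (a : ext_form R V 3) : a = form3 (fun X Y Z => a (tup3 X Y Z)).
Proof. by apply/funext => x; rewrite /form3 -tup3E. Qed.

Lemma alt2_of_alternating (a : ext_form R V 2) : is_alternating_form a ->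
  alt2 (fun X Y => a (tup2 X Y)).
Proof.
move=> [lin alt].
have e0 X Y : tup2 X Y = [eta tup2 0 Y with ord0 |-> X].
  by apply/funext => -[[|[|//]] Hi].
have e1 X Y : tup2 X Y = [eta tup2 X 0 with inord 1 |-> Y].
  apply/funext => i /=; rewrite -val_eqE /= inordK//.
  by case: i => [[|[|//]] Hi].
split; first split.
- by move=> X k Y Z; have := lin (tup2 X 0) (inord 1) k Y Z; rewrite -!e1.
- by move=> Y k X Z; have := lin (tup2 0 Y) ord0 k X Z; rewrite -!e0.
- move=> X; apply: (alt _ ord0 (inord 1)); last by rewrite /tup2 /= if_same.
  by rewrite -val_eqE /= inordK.
Qed.

Lemma alternating_uncurry2 s : alt2 s -> is_alternating_form (uncurry2 s).
Proof.
move=> [[sr sl] s0]; rewrite /uncurry2; split=> [x i k u v|x i j] /=.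
  rewrite -!val_eqE /= inordK//.
  case: i => [[|[|//]] Hi] /=; [exact: sl|exact: sr].
move=> ij e; have -> : x ord0 = x (inord 1); last exact: s0.
have [h1|h1] : i = ord0 /\ j = inord 1 \/ j = ord0 /\ i = inord 1.
- case: i j ij {e} => [[|[|//]] Hi] [[|[|//]] Hj] //= _; [left|right];
    by split; apply: val_inj; rewrite //= inordK.
- by case: h1 => <- <-.
- by case: h1 => <- <-.
Qed.

Lemma alt3_of_alternating (a : ext_form R V 3) : is_alternating_form a ->
  alt3 (fun X Y Z => a (tup3 X Y Z)).
Proof.
move=> [lin alt].
have e0 X Y Z : tup3 X Y Z = [eta tup3 0 Y Z with ord0 |-> X].
  by apply/funext => -[[|[|[|//]]] Hi].
have e1 X Y Z : tup3 X Y Z = [eta tup3 X 0 Z with inord 1 |-> Y].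
  apply/funext => i /=; rewrite -val_eqE /= inordK//.
  by case: i => [[|[|[|//]]] Hi].
have e2 X Y Z : tup3 X Y Z = [eta tup3 X Y 0 with inord 2 |-> Z].
  apply/funext => i /=; rewrite -val_eqE /= inordK//.
  by case: i => [[|[|[|//]]] Hi].
split.
- by move=> X Y k Z W; have := lin (tup3 X Y 0) (inord 2) k Z W; rewrite -!e2.
- by move=> X Z k Y W; have := lin (tup3 X 0 Z) (inord 1) k Y W; rewrite -!e1.
- by move=> Y Z k X W; have := lin (tup3 0 Y Z) ord0 k X W; rewrite -!e0.
- move=> X Y; apply: (alt _ ord0 (inord 1)); first by rewrite -val_eqE /= inordK.
  by rewrite /tup3 /= inordK.
- move=> X Y; apply: (alt _ (inord 1) (inord 2)); first by rewrite -val_eqE /= !inordK.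
  by rewrite /tup3 /= !inordK.
Qed.

Lemma alternating_form3 b : alt3 b ->
  is_alternating_form (form3 b : ext_form R V 3).
Proof.
move=> bA; have [b3 b2 b1 ba ba'] := bA; rewrite /form3; split=> [x i k u v|x i j] /=.
  rewrite -!val_eqE /= !inordK//.
  case: i => [[|[|[|//]]] Hi] /=; [exact: b1|exact: b2|exact: b3].
wlog : i j / (i < j)%N.
  move=> h ij e; have := ij; rewrite -val_eqE neq_ltn => /orP[lt|lt].
    exact: (h i j).
  by apply: (h j i) => //; rewrite eq_sym.
move=> lt _ e; set X := x ord0; set Y := x (inord 1); set Z := x (inord 2).
have x0 (H : (0 < 3)%N) : x (Ordinal H) = X by congr x; apply: val_inj.
have x1 (H : (1 < 3)%N) : x (Ordinal H) = Y.
  by congr x; apply: val_inj; rewrite /= inordK.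
have x2 (H : (2 < 3)%N) : x (Ordinal H) = Z.
  by congr x; apply: val_inj; rewrite /= inordK.
case: i j lt e => [[|[|[|//]]] Hi] [[|[|[|//]]] Hj] //= _.
- by rewrite x0 x1 => <-; exact: ba.
- by rewrite x0 x2 => <-; rewrite (alt3_skew23 _ _ _ bA) ba oppr0.
- by rewrite x1 x2 => <-; exact: ba'.
Qed.

Variable br : V -> V -> V.

(** Sums over ranges of natural numbers unfold by computation, with explicit
    indices. *)
Lemma ext_diff_nat k (a : ext_form R V k) (x : 'I_k.+1 -> V) :
  ext_diff br a x = \sum_(0 <= i < k.+1) \sum_(0 <= j < k.+1 | (i < j)%N)
    (-1) ^+ (i + j) *
    a (fun l : 'I_k => if l == 0 :> nat then br (x (inord i)) (x (inord j))
                       else x (inord (bump j (bump i l.-1)))).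
Proof.
rewrite /ext_diff big_mkord; apply: eq_bigr => i _.
rewrite big_mkord; apply: eq_bigr => j _; congr (_ * a _).
by apply/funext => l; rewrite !inord_val.
Qed.

Lemma ext_diff2 s (x : 'I_3 -> V) : ext_diff br (uncurry2 s) x =
  d2 br s (x ord0) (x (inord 1)) (x (inord 2)).
Proof.
have x0 : x ord0 = x (inord 0) by congr x; apply: val_inj; rewrite /= inordK.
have sg m : (-1) ^+ m = (if odd m then -1 else 1) :> R.
  by rewrite -signr_odd; case: odd.
rewrite ext_diff_nat x0 /uncurry2 /= inordK//= /d2.
rewrite /index_iota /= !(big_cons, big_nil) /= !addr0 !sg /= /bump /=.
by rewrite !mulN1r mul1r.
Qed.

Lemma ext_diff3 b (x : 'I_4 -> V) : ext_diff br (form3 b) x =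
  d3 br b (x ord0) (x (inord 1)) (x (inord 2)) (x (inord 3)).
Proof.
have x0 : x ord0 = x (inord 0) by congr x; apply: val_inj; rewrite /= inordK.
have sg m : (-1) ^+ m = (if odd m then -1 else 1) :> R.
  by rewrite -signr_odd; case: odd.
rewrite ext_diff_nat x0 /form3 /= !inordK//= /d3.
rewrite /index_iota /= !(big_cons, big_nil) /= !addr0 !sg /= /bump /=.
by rewrite !mulN1r !mul1r ?addrA.
Qed.

End ExtForms.

(** * Invariant forms on a reductive pair *)

(** The bracket and the adjoint action enter only through the identities assumed
    here. [act_infinitesimal], [K_infinitesimal] and [K_infinitesimal2] express
    differentiation along curves in the group, [act_integral] its
    connectedness. *)
Section ReductivePair.
Variables (R : realType) (n : nat).
Local Notation g := 'rV[R]_n.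
Variables (br : g -> g -> g) (T : Type) (act : T -> g -> g).
Variables (K : set T) (k p : {vspace g}).
Hypotheses (brr : forall X, linear (br X)) (brl : forall Y, linear (br ^~ Y)).
Hypothesis brC : forall X Y, br X Y = - br Y X.
Hypothesis jac : forall X Y Z, br X (br Y Z) = br (br X Y) Z + br Y (br X Z).
Hypothesis act_lin : forall h, linear (act h).
Hypothesis act_br : forall h X Y, act h (br X Y) = br (act h X) (act h Y).
Hypothesis act_inv : forall h, exists k, forall X, act h (act k X) = X.
Hypothesis act_infinitesimal : forall t : g -> g -> R^o, bilinear_form t ->
  (forall h X Y, t (act h X) (act h Y) = t X Y) -> ad_invariant br t.
Hypothesis act_integral : forall t : g -> g -> R^o, bilinear_form t ->
  ad_invariant br t -> forall h X Y, t (act h X) (act h Y) = t X Y.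
Hypothesis semisimple : is_semisimple br.
Variable ip : g -> g -> R^o.
Hypotheses (ip_lin : forall u, linear (ip u)) (ipC : forall u v, ip u v = ip v u).
Hypothesis ip_pos : forall u, u != 0 -> 0 < ip u u.
Hypothesis ip_act : forall h X Y, ip (act h X) (act h Y) = ip X Y.
Hypotheses (kp_full : (k + p)%VS = fullv) (kp_disj : (k :&: p)%VS = 0%VS).
Hypothesis act_k : forall h X, K h -> X \in k -> act h X \in k.
Hypothesis act_p : forall h X, K h -> X \in p -> act h X \in p.
Hypothesis K_infinitesimal : forall (b : g -> g -> g -> R^o) Z, alt3 b ->
  (forall h, K h -> forall X Y W, b (act h X) (act h Y) (act h W) = b X Y W) ->
  Z \in k -> forall X Y W, lie3 br Z b X Y W = 0.
Hypothesis K_infinitesimal2 : forall (s : g -> g -> R^o) Z, bilinear_form s ->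
  (forall h, K h -> forall X Y, s (act h X) (act h Y) = s X Y) ->
  Z \in k -> forall X Y, lie2 br Z s X Y = 0.

Local Notation ck := (comp_k k p).
Local Notation cp := (comp_p k p).
Local Notation W := (subvs_of p).

Let pk_disj : (p :&: k)%VS = 0%VS. Proof. by rewrite capvC. Qed.

Lemma ck_cp X : ck X + cp X = X.
Proof. by apply: daddv_pi_add => //; rewrite kp_full memvf. Qed.

Lemma ck_mem X : ck X \in k. Proof. exact: memv_pi. Qed.

Lemma cp_mem X : cp X \in p. Proof. exact: memv_pi. Qed.

Lemma ck_id X : X \in k -> ck X = X. Proof. exact: daddv_pi_id. Qed.

Lemma cp_id X : X \in p -> cp X = X. Proof. exact: daddv_pi_id. Qed.

Lemma ck_p X : X \in p -> ck X = 0.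
Proof. by move=> Xp; apply: (addIr (cp X)); rewrite ck_cp add0r cp_id. Qed.

Lemma cp_k X : X \in k -> cp X = 0.
Proof. by move=> Xk; apply: (addrI (ck X)); rewrite ck_cp addr0 ck_id. Qed.

Lemma ck_lin : linear ck. Proof. by move=> a X Y; rewrite /comp_k linearP. Qed.

Lemma cp_lin : linear cp. Proof. by move=> a X Y; rewrite /comp_p linearP. Qed.

Definition to_p (X : g) : W := vsproj p (cp X).

Lemma to_pK X : vsval (to_p X) = cp X.
Proof. by rewrite vsprojK// cp_mem. Qed.

Lemma vsval_to_p (x : W) : to_p (vsval x) = x.
Proof. by apply: val_inj; rewrite /= to_pK cp_id// subvsP. Qed.

Lemma to_p_lin : linear to_p.
Proof.
by move=> a X Y; rewrite /to_p cp_lin linearP.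
Qed.

Lemma to_p_k X : X \in k -> to_p X = 0.
Proof. by move=> Xk; apply: val_inj; rewrite /= to_pK cp_k. Qed.

Lemma to_p_cp X : to_p (cp X) = to_p X.
Proof. by apply: val_inj; rewrite /= !to_pK cp_id// cp_mem. Qed.

Lemma cp_act h X : K h -> cp (act h X) = act h (cp X).
Proof.
move=> Kh; have [aD _ _ _] := linear_comb (act_lin h).
have [cD _ _ _] := linear_comb cp_lin.
rewrite -{1}(ck_cp X) aD cD (cp_k (act_k Kh (ck_mem X))) add0r cp_id//.
by apply: act_p => //; exact: cp_mem.
Qed.

Definition brp (x y : W) : W := vsproj p (cp (br (vsval x) (vsval y))).

Definition actp h (x : W) : W := vsproj p (act h (vsval x)).

Lemma to_p_act h X : K h -> to_p (act h X) = actp h (to_p X).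
Proof. by move=> Kh; rewrite /to_p cp_act// /actp -/(to_p X) to_pK. Qed.

Lemma actp_val h x : K h -> vsval (actp h x) = act h (vsval x).
Proof. by move=> Kh; rewrite /actp vsprojK// act_p// subvsP. Qed.

Lemma brp_to_p X Y : X \in p -> Y \in p -> brp (to_p X) (to_p Y) = to_p (br X Y).
Proof. by move=> Xp Yp; rewrite /brp !to_pK (cp_id Xp) (cp_id Yp). Qed.

(** The pullback to g of a form on p. *)
Definition lift2 (s : W -> W -> R^o) X Y := s (to_p X) (to_p Y).

Definition lift3 (b : W -> W -> W -> R^o) X Y Z := b (to_p X) (to_p Y) (to_p Z).

Lemma alt2_lift s : alt2 s -> alt2 (lift2 s).
Proof.
move=> [[sr sl] s0]; split; first split.
- by move=> X a Y Z; rewrite /lift2 to_p_lin sr.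
- by move=> X a Y Z; rewrite /lift2 to_p_lin sl.
- by move=> X; exact: s0.
Qed.

Lemma alt3_lift b : alt3 b -> alt3 (lift3 b).
Proof.
move=> [b3 b2 b1 ba ba']; split.
- by move=> X Y a Z U; rewrite /lift3 to_p_lin b3.
- by move=> X Y a Z U; rewrite /lift3 to_p_lin b2.
- by move=> X Y a Z U; rewrite /lift3 to_p_lin b1.
- by move=> X Y; exact: ba.
- by move=> X Y; exact: ba'.
Qed.

(** A form annihilated by k in one slot depends on the p-components only. *)
Lemma horizontal3 (A : g -> g -> g -> R^o) : alt3 A ->
  (forall Z X Y, Z \in k -> A Z X Y = 0) ->
  forall X Y Z, A X Y Z = A (cp X) (cp Y) (cp Z).
Proof.
move=> AA Ak; have [_ _ A1 _ _] := AA.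
have first X Y Z : A X Y Z = A (cp X) Y Z.
  have [AD _ _ _] := linear_comb (A1 Y Z).
  by rewrite -{1}(ck_cp X) AD Ak ?add0r// ck_mem.
have s12 X Y Z := alt3_skew12 X Y Z AA; have s23 X Y Z := alt3_skew23 X Y Z AA.
have second X Y Z : A X Y Z = A X (cp Y) Z by rewrite s12 first [RHS]s12.
have third X Y Z : A X Y Z = A X Y (cp Z) by rewrite s23 second [RHS]s23.
by move=> X Y Z; rewrite first second third.
Qed.

Lemma horizontal4 (D : g -> g -> g -> g -> R^o) :
  (forall X Y Z U, D X Y Z U = - D Y X Z U) ->
  (forall X Y Z U, D X Y Z U = - D X Z Y U) ->
  (forall X Y Z U, D X Y Z U = - D X Y U Z) ->
  (forall Y Z U, linear (fun X => D X Y Z U)) ->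
  (forall Z X Y U, Z \in k -> D Z X Y U = 0) ->
  forall X Y Z U, D X Y Z U = D (cp X) (cp Y) (cp Z) (cp U).
Proof.
move=> s12 s23 s34 D1 Dk.
have first X Y Z U : D X Y Z U = D (cp X) Y Z U.
  have [DD _ _ _] := linear_comb (D1 Y Z U).
  by rewrite -{1}(ck_cp X) DD Dk ?add0r// ck_mem.
have second X Y Z U : D X Y Z U = D X (cp Y) Z U by rewrite s12 first [RHS]s12.
have third X Y Z U : D X Y Z U = D X Y (cp Z) U by rewrite s23 second [RHS]s23.
have fourth X Y Z U : D X Y Z U = D X Y Z (cp U) by rewrite s34 third [RHS]s34.
by move=> X Y Z U; rewrite first second third fourth.
Qed.

Lemma lift3_inv (b : W -> W -> W -> R^o) :
  (forall h, K h -> forall x y z, b (actp h x) (actp h y) (actp h z) = b x y z) ->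
  forall h, K h -> forall X Y Z,
    lift3 b (act h X) (act h Y) (act h Z) = lift3 b X Y Z.
Proof. by move=> binv h Kh X Y Z; rewrite /lift3 !to_p_act// binv. Qed.

Lemma lift2_inv (s : W -> W -> R^o) :
  (forall h, K h -> forall x y, s (actp h x) (actp h y) = s x y) ->
  forall h, K h -> forall X Y, lift2 s (act h X) (act h Y) = lift2 s X Y.
Proof. by move=> sinv h Kh X Y; rewrite /lift2 !to_p_act// sinv. Qed.

Lemma lift3_k b Z X Y : alt3 b -> Z \in k -> lift3 b Z X Y = 0.
Proof.
move=> [_ _ b1 _ _] Zk; rewrite /lift3 to_p_k//.
by have [_ -> _ _] := linear_comb (b1 (to_p X) (to_p Y)).
Qed.

Lemma lift2_k s Z X : alt2 s -> Z \in k -> lift2 s Z X = 0.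
Proof.
move=> [[_ sl] _] Zk; rewrite /lift2 to_p_k//.
by have [_ -> _ _] := linear_comb (sl (to_p X)).
Qed.

Lemma d2_lift_p s X Y Z : X \in p -> Y \in p -> Z \in p ->
  d2 br (lift2 s) X Y Z = d2 brp s (to_p X) (to_p Y) (to_p Z).
Proof. by move=> Xp Yp Zp; rewrite /d2 !brp_to_p. Qed.

Lemma d3_lift_p b X Y Z U : X \in p -> Y \in p -> Z \in p -> U \in p ->
  d3 br (lift3 b) X Y Z U = d3 brp b (to_p X) (to_p Y) (to_p Z) (to_p U).
Proof. by move=> Xp Yp Zp Up; rewrite /d3 !brp_to_p. Qed.

(** On invariant forms the differential of the complex of G/K agrees with the
    one of left-invariant forms on G; invariance gives the vanishing on k. *)
Lemma d2_lift s : alt2 s ->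
  (forall h, K h -> forall x y, s (actp h x) (actp h y) = s x y) ->
  forall X Y Z, d2 br (lift2 s) X Y Z = lift3 (d2 brp s) X Y Z.
Proof.
move=> sA sinv X Y Z; have lA := alt2_lift sA.
rewrite (@horizontal3 (d2 br (lift2 s))) => [||{X Y Z} Z X Y Zk].
- by rewrite d2_lift_p ?cp_mem// !to_p_cp.
- exact: alt3_d2.
- have inv := K_infinitesimal2 lA.1 (lift2_inv sinv) Zk X Y.
  have k0 := lift2_k (br X Y) sA Zk.
  move: inv; rewrite /lie2 /d2 (alt2_skew (br X Y) Z lA) k0.
  by rewrite (alt2_skew X (br Z Y) lA); lra.
Qed.

Lemma d3_lift b : alt3 b ->
  (forall h, K h -> forall x y z, b (actp h x) (actp h y) (actp h z) = b x y z) ->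
  (forall x y z u, d3 brp b x y z u = 0) ->
  forall X Y Z U, d3 br (lift3 b) X Y Z U = 0.
Proof.
move=> bA binv bcl; have lA := alt3_lift bA.
set B := lift3 b in lA *.
have [B3 B2 B1 _ _] := lA.
have s12 X Y Z := alt3_skew12 X Y Z lA; have s23 X Y Z := alt3_skew23 X Y Z lA.
have BN X Y Z : B (- X) Y Z = - B X Y Z by have [_ _ -> _] := linear_comb (B1 Y Z).
move=> X Y Z U; rewrite (@horizontal4 (d3 br B)).
- by rewrite d3_lift_p ?cp_mem.
- move=> {}X {}Y {}Z {}U; rewrite /d3 (brC Y X) BN (s23 (br Z U) X Y); lra.
- move=> {}X {}Y {}Z {}U; rewrite /d3 (brC Z Y) BN (s23 (br X U) Y Z); lra.
- move=> {}X {}Y {}Z {}U; rewrite /d3 (brC U Z) BN (s23 (br X Y) Z U); lra.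
- move=> {}Y {}Z {}U a {}X X'; rewrite /d3 ?brl ?B1 ?B2 ?B3 /GRing.scale /=; ring.
- move=> {}Z {}X {}Y {}U Zk; have inv := K_infinitesimal lA (lift3_inv binv) Zk X Y U.
  have k0 A C := lift3_k A C bA Zk.
  move: inv; rewrite /lie3 /d3 -/B (s12 (br X Y) Z) (s12 (br X U) Z) (s12 (br Y U) Z).
  rewrite /B !k0 -/B (s12 X (br Z Y)) (s23 X Y) (s12 X (br Z U)); lra.
Qed.

Section Form.
Variable Q : g -> g -> R^o.
Hypotheses (Qb : bilinear_form Q) (Qsym : forall X Y, Q X Y = Q Y X).
Hypothesis Qact : forall h X Y, Q (act h X) (act h Y) = Q X Y.
Hypothesis Qk : forall X Y, X \in k -> Y \in k -> Q X Y = 0.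

Let Qad : ad_invariant br Q. Proof. exact: act_infinitesimal. Qed.

Let Qr X := linear_comb (Qb.1 X).
Let Ql Y := linear_comb (Qb.2 Y).

Lemma QD X Y Z : Q X (Y + Z) = Q X Y + Q X Z.
Proof. by have [-> _ _ _] := Qr X. Qed.

Lemma QDl X Y Z : Q (X + Y) Z = Q X Z + Q Y Z.
Proof. by have [-> _ _ _] := Ql Z. Qed.

Lemma Q0 X : Q X 0 = 0.
Proof. by have [_ -> _ _] := Qr X. Qed.

Lemma alt3_Qbar : alt3 (fun X Y Z => Q (br X Y) Z).
Proof.
split.
- by move=> X Y; exact: Qb.1.
- by move=> X Z a Y U; rewrite brr Qb.2.
- by move=> Y Z a X U; rewrite brl Qb.2.
- by move=> X Y; rewrite br_alt// Qsym Q0.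
- by move=> X Y; have := Qad Y X X; rewrite /lie2 (Qsym X); lra.
Qed.

(** An invariant 3-form Q([.,.],.) is closed, by the Jacobi identity. *)
Lemma d3_Qbar X Y Z U : d3 br (fun X Y Z => Q (br X Y) Z) X Y Z U = 0.
Proof.
have j := jacobi_left brC jac X Y Z (Qb.2 U).
have i A B C : Q (br A B) C = - Q B (br A C).
  by apply/eqP; rewrite -addr_eq0; apply/eqP; exact: Qad.
have QNl A B : Q (- A) B = - Q A B by have [_ _ -> _] := Ql B.
have QN A B : Q A (- B) = - Q A B by have [_ _ -> _] := Qr A.
have f A B C : Q (br (br A U) B) C = - Q U (br A (br B C)).
  by rewrite [br (br A U) B]brC QNl i opprK i.
have e : Q U (br X (br Y Z)) = Q U (br (br X Y) Z) + Q U (br Y (br X Z)).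
  by rewrite (jac X Y Z) QD.
have e' : Q U (br Z (br X Y)) = - Q U (br (br X Y) Z) by rewrite brC QN.
by move: j; rewrite /d3 /= (f X Y Z) (f Y X Z) (f Z X Y) e e'; lra.
Qed.

Definition alphaQ X Y : R^o := Q (cp X) (ck Y) - Q (cp Y) (ck X).

(** The pullback of H_Q is Q([., .], .) + d alpha_Q, and this is its value. *)
Definition Hbar X Y Z : R^o := Q (br X Y) Z + d2 br alphaQ X Y Z.

Lemma alt2_alphaQ : alt2 alphaQ.
Proof.
split; first split.
- by move=> X a Y Z; rewrite /alphaQ ck_lin cp_lin Qb.1 Qb.2 /GRing.scale /=; ring.
- by move=> X a Y Z; rewrite /alphaQ ck_lin cp_lin Qb.1 Qb.2 /GRing.scale /=; ring.
- by move=> X; rewrite /alphaQ subrr.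
Qed.

Lemma alt3_Hbar : alt3 Hbar.
Proof.
have := alt3_comb 1 alt3_Qbar (alt3_d2 brr brl brC alt2_alphaQ).
have -> // : (fun X Y Z => 1 *: Q (br X Y) Z + d2 br alphaQ X Y Z) = Hbar.
by apply/funext => X; apply/funext => Y; apply/funext => Z; rewrite scale1r.
Qed.

Lemma d3_Hbar X Y Z U : d3 br Hbar X Y Z U = 0.
Proof.
have := d3_Qbar X Y Z U; have := d3d2 brC jac X Y Z U alt2_alphaQ.
by rewrite /Hbar /d3 => e1 e2; lra.
Qed.

(** On k in the second slot, alpha_Q is Q itself because Q vanishes on k x k. *)
Lemma alphaQ_k X Z : Z \in k -> alphaQ X Z = Q X Z.
Proof.
move=> Zk; rewrite /alphaQ (ck_id Zk) (cp_k Zk) [Q 0 _]Qsym Q0 subr0.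
by rewrite -{2}(ck_cp X) QDl (Qk (ck_mem X) Zk) add0r.
Qed.

Lemma alphaQ_p X Y : X \in p -> Y \in p -> alphaQ X Y = 0.
Proof. by move=> Xp Yp; rewrite /alphaQ !ck_p// !Q0 subrr. Qed.

Lemma ck_act h X : K h -> ck (act h X) = act h (ck X).
Proof.
move=> Kh; have [aD _ _ _] := linear_comb (act_lin h).
apply: (addIr (cp (act h X))); by rewrite ck_cp cp_act// -aD ck_cp.
Qed.

(** For Z in k, the K-invariance of alpha_Q turns d alpha_Q (Z, X, Y) into
    - alpha_Q([X, Y], Z) = - Q([X, Y], Z), which cancels the other term. *)
Lemma Hbar_k Z X Y : Z \in k -> Hbar Z X Y = 0.
Proof.
move=> Zk; have aA := alt2_alphaQ.
have inv := @K_infinitesimal2 alphaQ Z aA.1 _ Zk X Y.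
have {inv} : lie2 br Z alphaQ X Y = 0.
  by apply: inv => h Kh A B; rewrite /alphaQ !ck_act// !cp_act// !Qact.
have := Qad X Z Y.
have [_ _ QNl _] := Ql Y.
rewrite /Hbar /d2 /lie2 (alphaQ_k (br X Y) Zk) (alt2_skew (br Z Y) X aA).
rewrite (brC X Z) QNl (Qsym Z); lra.
Qed.

Lemma Hbar_horizontal X Y Z : Hbar X Y Z = Hbar (cp X) (cp Y) (cp Z).
Proof. exact: (horizontal3 alt3_Hbar (fun Z X Y => @Hbar_k Z X Y)). Qed.

Definition Hfun X Y Z : R := 4 * Q (br X Y) Z - Q (cp (br X Y)) Z
  + Q (cp (br X Z)) Y - Q (cp (br Y Z)) X.

Definition Hform : ext_form R W 3 :=
  form3 (fun x y z : W => Hfun (vsval x) (vsval y) (vsval z)).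

Lemma Q_cyclic X Y Z : Q (br X Z) Y = - Q (br X Y) Z.
Proof. by have := Qad X Y Z; rewrite /lie2 (Qsym Y); lra. Qed.

Lemma Q_cyclic' X Y Z : Q (br Y Z) X = Q (br X Y) Z.
Proof.
have := Qad Y X Z; have [_ _ QNl _] := Ql Z.
by rewrite /lie2 (brC Y X) QNl (Qsym X); lra.
Qed.

Lemma Hfun_k X Y Z : Hfun X Y Z =
  Q (br X Y) Z + Q (ck (br X Y)) Z - Q (ck (br X Z)) Y + Q (ck (br Y Z)) X.
Proof.
have e A B : Q A B = Q (ck A) B + Q (cp A) B by rewrite -QDl ck_cp.
have := e (br X Y) Z; have := e (br X Z) Y; have := e (br Y Z) X.
rewrite /Hfun (Q_cyclic X Y Z) (Q_cyclic' X Y Z); lra.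
Qed.

Lemma Hbar_p X Y Z : X \in p -> Y \in p -> Z \in p -> Hbar X Y Z = Hfun X Y Z.
Proof.
move=> Xp Yp Zp; have a A B : B \in p -> alphaQ A B = - Q (ck A) B.
  by move=> Bp; rewrite /alphaQ ck_p// Q0 cp_id// sub0r Qsym.
rewrite Hfun_k /Hbar /d2 !a//; lra.
Qed.

Lemma HformE : Hform = form3 (fun x y z => Hbar (vsval x) (vsval y) (vsval z)).
Proof.
by apply/funext => x; rewrite /Hform /form3 Hbar_p ?subvsP.
Qed.

Lemma alt3_H : alt3 (fun x y z : W => Hbar (vsval x) (vsval y) (vsval z)).
Proof.
have [b3 b2 b1 ba ba'] := alt3_Hbar; split.
- by move=> X Y a Z U; rewrite linearP b3.
- by move=> X Y a Z U; rewrite linearP b2.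
- by move=> X Y a Z U; rewrite linearP b1.
- by move=> X Y; exact: ba.
- by move=> X Y; exact: ba'.
Qed.

Lemma lift3_H X Y Z :
  lift3 (fun x y z : W => Hbar (vsval x) (vsval y) (vsval z)) X Y Z = Hbar X Y Z.
Proof. by rewrite /lift3 !to_pK -Hbar_horizontal. Qed.

End Form.

(** Written for abstract [br] and [act], these unfold to the complex of G/K and
    the spaces of bi-invariant forms when [br] is the bracket and [act] the
    adjoint action. *)
Definition rp_invariant m : set (ext_form R W m) :=
  [set a | is_alternating_form a /\ is_invariant_form actp K a].

Definition rp_closed m : set (ext_form R W m) :=
  [set a | rp_invariant a /\ ext_diff brp a = 0].

Definition rp_exact3 : set (ext_form R W 3) :=
  [set ext_diff brp b | b in @rp_invariant 2].

Definition rp_biinvariant : set (g -> g -> R^o) :=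
  [set Q | [/\ forall X, scalar (Q X), forall Y, scalar (Q ^~ Y),
               forall X Y, Q X Y = Q Y X &
               forall h X Y, Q (act h X) (act h Y) = Q X Y]].

Definition rp_biinvariant_k0 : set (g -> g -> R^o) :=
  [set Q | rp_biinvariant Q /\ (forall X Y, X \in k -> Y \in k -> Q X Y = 0)].

(** The pullback Q([., .], .) + d alpha_Q is closed, and on basic forms the two
    differentials agree. *)
Lemma Hform_closed Q : rp_biinvariant_k0 Q -> rp_closed (Hform Q).
Proof.
move=> [[Qr Ql Qsym Qact] Qk].
have Qb : bilinear_form Q by split.
have HE := HformE Qb Qsym Qact.
have HA := alt3_H Qb Qsym Qact.
split; first split.
- rewrite HE; exact: alternating_form3.
- move=> h Kh x; rewrite HE /form3 /Hbar /d2 /alphaQ !actp_val// -!act_br.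
  by rewrite !cp_act// !ck_act// !Qact.
- apply/funext => x; rewrite HE ext_diff3.
  set b := fun _ _ _ => _.
  have lE : lift3 b = Hbar Q.
    apply/funext => X; apply/funext => Y; apply/funext => Z.
    exact: lift3_H.
  have := d3_lift_p b (subvsP (x ord0)) (subvsP (x (inord 1)))
    (subvsP (x (inord 2))) (subvsP (x (inord 3))).
  by rewrite !vsval_to_p lE => <-; exact: d3_Hbar.
Qed.

Lemma Hform_linear (a : R) Q Q' : Hform (a *: Q + Q') = a *: Hform Q + Hform Q'.
Proof.
apply/funext => x; rewrite /Hform /form3 /Hfun !fctE /GRing.scale /=; ring.
Qed.

Lemma rp_biinvariant_linear : linear_set rp_biinvariant.
Proof.
split.
  split=> // [X c Y Z|X c Y Z]; exact: (esym (etrans (addr0 _) (mulr0 c))).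
move=> a Q Q' [Qr Ql Qs Qa] [Qr' Ql' Qs' Qa'].
have E X Y : (a *: Q + Q') X Y = a * Q X Y + Q' X Y by [].
split.
- by move=> X c Y Z; rewrite !E Qr Qr'; ring.
- move=> X c Y Z; rewrite /= !E.
  by have := Ql X c Y Z; have := Ql' X c Y Z; rewrite /= => -> ->; ring.
- by move=> X Y; rewrite !E Qs Qs'.
- by move=> h X Y; rewrite !E Qa Qa'.
Qed.

Lemma rp_biinvariant_k0_linear : linear_set rp_biinvariant_k0.
Proof.
have [B0 Bl] := rp_biinvariant_linear; split; first by split.
move=> a Q Q' [Qb Qk] [Qb' Qk']; split; first exact: Bl.
move=> X Y Xk Yk; have E : (a *: Q + Q') X Y = a * Q X Y + Q' X Y by [].
by rewrite E Qk// Qk'// mulr0 addr0.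
Qed.

Lemma rp_exact3P (a : ext_form R W 3) : rp_exact3 a <->
  exists s, [/\ alt2 s, forall h, K h -> forall x y, s (actp h x) (actp h y) = s x y
    & a = form3 (d2 brp s)].
Proof.
split=> [[b [bA binv] <-]|[s [sA sinv ->]]].
  exists (fun X Y => b (tup2 X Y)); split; first exact: alt2_of_alternating.
    move=> h Kh x y; rewrite -(binv h Kh (tup2 x y)); congr b.
    by apply/funext => i; rewrite /tup2; case: ifP.
  by apply/funext => x; rewrite {1}(uncurry2E b) ext_diff2.
exists (uncurry2 s); last by apply/funext => x; rewrite ext_diff2.
by split; [exact: alternating_uncurry2|move=> h Kh x; exact: sinv].
Qed.

Lemma rp_exact3_linear : linear_set rp_exact3.
Proof.
split.
  apply/rp_exact3P; exists (fun _ _ => 0); split=> //.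
    by split; [split=> X c u v; rewrite scaler0 addr0|].
  by apply/funext => x; rewrite /form3 /d2 oppr0 !addr0.
move=> c _ _ /rp_exact3P[s [sA sinv ->]] /rp_exact3P[t [tA tinv ->]].
apply/rp_exact3P; exists (fun X Y => c *: s X Y + t X Y); split.
- exact: alt2_comb.
- by move=> h Kh x y; rewrite sinv// tinv.
- by apply/funext => x; rewrite /form3 d2_comb.
Qed.

Section Alpha.
Variable Q : g -> g -> R^o.
Hypothesis Qbi : rp_biinvariant_k0 Q.

Let Qb : bilinear_form Q. Proof. by case: Qbi => -[]. Qed.
Let Qsym : forall X Y, Q X Y = Q Y X. Proof. by case: Qbi => -[]. Qed.
Let Qact : forall h X Y, Q (act h X) (act h Y) = Q X Y.
Proof. by case: Qbi => -[]. Qed.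
Let Qk : forall X Y, X \in k -> Y \in k -> Q X Y = 0.
Proof. by case: Qbi. Qed.

Lemma is_alphaQ_alphaQ : is_alphaQ k p Q (uncurry2 (alphaQ Q)).
Proof.
split.
- exact: alternating_uncurry2 (alt2_alphaQ Qb).
- by move=> x xk; rewrite /uncurry2 (alphaQ_k Qb Qsym Qk)// Qk.
- by move=> x xp; rewrite /uncurry2 (alphaQ_p Qb).
- by move=> x xp xk; rewrite /uncurry2 (alphaQ_k Qb Qsym Qk).
Qed.

Lemma is_alphaQ_uniq alpha : is_alphaQ k p Q alpha -> alpha = uncurry2 (alphaQ Q).
Proof.
move=> [aA ak ap apk]; rewrite (uncurry2E alpha); congr uncurry2.
have sA := alt2_of_alternating aA; set s := fun X Y => alpha (tup2 X Y) in sA *.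
have skk A B : A \in k -> B \in k -> s A B = 0.
  by move=> Ak Bk; apply: ak => i; rewrite /tup2; case: ifP.
have spp A B : A \in p -> B \in p -> s A B = 0.
  by move=> Ap Bp; apply: ap => i; rewrite /tup2; case: ifP.
have spk A B : A \in p -> B \in k -> s A B = Q A B.
  move=> Ap Bk; rewrite /s apk /tup2 /= ?inordK//.
apply/funext => X; apply/funext => Y.
have [[sr sl] _] := sA.
have [D1 _ _ _] := linear_comb (sr X); have D2 B := let: And4 D _ _ _ := linear_comb (sl B) in D.
rewrite -{1}(ck_cp Y) D1 -{1 2}(ck_cp X) (D2 (ck Y)) (D2 (cp Y)).
rewrite (skk _ _ (ck_mem X) (ck_mem Y)) (spp _ _ (cp_mem X) (cp_mem Y)).
rewrite (alt2_skew (ck X) (cp Y) sA) (spk _ _ (cp_mem X) (ck_mem Y)).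
by rewrite (spk _ _ (cp_mem Y) (ck_mem X)) /alphaQ; ring.
Qed.

Lemma pullback_H_iff alpha (H : ext_form R W 3) : is_alphaQ k p Q alpha ->
  pullback k H = form3 (fun X Y Z => Q (br X Y) Z) + ext_diff br alpha <->
  H = Hform Q.
Proof.
move=> /is_alphaQ_uniq ->.
have -> : form3 (fun X Y Z => Q (br X Y) Z) + ext_diff br (uncurry2 (alphaQ Q)) =
    form3 (Hbar Q) :> ext_form R g 3.
  by apply/funext => x; rewrite !fctE ext_diff2.
rewrite (HformE Qb Qsym Qact); split=> [e|->].
  apply/funext => x.
  have := congr1 (fun F => F (fun i => vsval (x i))) e; rewrite /pullback /form3 => <-.
  by congr H; apply/funext => i; rewrite -/(to_p _) vsval_to_p.
apply/funext => x.
exact: (lift3_H Qb Qsym Qact Qk (x ord0) (x (inord 1)) (x (inord 2))).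
Qed.

End Alpha.

(** The center is an abelian ideal. *)
Lemma centerless X : (forall Y, br X Y = 0) -> X = 0.
Proof.
move=> X0.
have [C CP] := @subspace_exists R _ [set v | forall Y, br v Y = 0]
  ltac:(by move=> Y; have [_ -> _ _] := linear_comb (brl Y))
  ltac:(by move=> c u v u0 v0 Y; rewrite brl u0 v0 scaler0 addr0).
have C0 : C = 0%VS.
  apply: semisimple => [A B /CP B0|A B /CP A0 _]; last exact: A0.
  by rewrite brC B0 oppr0 mem0v.
by apply/eqP; rewrite -memv0 -C0; apply/CP.
Qed.

Let ip_ad : ad_invariant br ip.
Proof. exact: act_infinitesimal (ip_form ip_lin ipC) ip_act. Qed.

Let basis : exists N (e : 'I_N -> g), forall v, v = \sum_i ip v (e i) *: e i.
Proof.
have [N [e [_ _ eE]]] := orthonormal_basis ip_lin ipC ip_pos fullv.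
by exists N, e => v; apply: eE; exact: memvf.
Qed.

(** The pullback of a is Q([., .], .) + d t with Q bi-invariant, and t can be
    taken K-invariant. For Z in k the pullback vanishes, which together with the
    infinitesimal invariance of t gives t(., Z) = Q(., Z) on brackets, hence
    everywhere. On k x k the form Q is then both symmetric and skew, so it
    vanishes, and alpha_Q - t descends to p with differential H_Q - a. *)
Lemma rp_class_representative (a : ext_form R W 3) : rp_closed a ->
  exists2 Q, rp_biinvariant_k0 Q & rp_exact3 (Hform Q - a).
Proof.
have [N [e eE]] := basis.
move=> [[aA ainv] acl]; pose b x y z := a (tup3 x y z).
have bA : alt3 b by exact: alt3_of_alternating.
have binv h : K h -> forall x y z, b (actp h x) (actp h y) (actp h z) = b x y z.
  move=> Kh x y z; rewrite /b -(ainv h Kh (tup3 x y z)); congr a.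
  by apply/funext => i; rewrite /tup3; case: ifP => // _; case: ifP.
have bcl x y z u : d3 brp b x y z u = 0.
  have := ext_diff3 brp b (fun i : 'I_4 => nth 0 [:: x; y; z; u] i).
  by rewrite -(form3E a) acl /= !inordK.
have BA := alt3_lift bA; have Binv := lift3_inv binv; have Bcl := d3_lift bA binv bcl.
have [Q [s [Qb Qsym Qad sA BE]]] := closed_alt3_decomposition brr brl brC jac
  ip_lin ipC ip_pos ip_ad centerless eE BA Bcl.
have Qact := act_integral Qb Qad.
have [t [tA tE tinv]] := invariant_primitive ip_lin ipC ip_pos eE act_lin act_br
  ip_act act_inv sA (S := K) ltac:(by move=> h Kh X Y Z; apply: (addrI (Q (br X Y) Z));
    rewrite -BE -{1}(Qact h) act_br -BE Binv).
have {BE}BE X Y Z : lift3 b X Y Z = Q (br X Y) Z + d2 br t X Y Z by rewrite tE.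
have tQ Z A : Z \in k -> t A Z = Q A Z.
  move=> Zk; apply/eqP; rewrite -subr_eq0; apply/eqP.
  apply: (perfect brC ip_lin ipC ip_pos ip_ad centerless eE
    (u := fun A => t A Z - Q A Z)) => [c X Y|X Y].
    have [[_ tl] _] := tA; have [_ Ql] := Qb.
    by rewrite (tl Z) (Ql Z) /GRing.scale /=; ring.
  have := lift3_k X Y bA Zk; rewrite BE /d2.
  have := K_infinitesimal2 tA.1 tinv Zk X Y; rewrite /lie2.
  rewrite (alt2_skew (br Z Y) X tA).
  rewrite (Q_cyclic' Qb Qsym Qact Y Z X) (Q_cyclic' Qb Qsym Qact X Y Z); lra.
have Qk X Y : X \in k -> Y \in k -> Q X Y = 0.
  move=> Xk Yk; have := tQ Y X Yk; have := tQ X Y Xk.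
  by rewrite (alt2_skew X Y tA) (Qsym Y X); lra.
have Qbi : rp_biinvariant_k0 Q by case: Qb => *; split.
exists Q => //; apply/rp_exact3P.
pose u X Y := alphaQ Q X Y - t X Y.
have uA : alt2 u by exact: alt2_sub (alt2_alphaQ Qb) tA.
have uk X Z : Z \in k -> u X Z = 0.
  by move=> Zk; rewrite /u (alphaQ_k Qb Qsym Qk)// tQ// subrr.
exists (fun x y : W => u (vsval x) (vsval y)).
have lE : lift2 (fun x y : W => u (vsval x) (vsval y)) = u.
  apply/funext => X; apply/funext => Y; rewrite /lift2 !to_pK.
  have [[ur ul] _] := uA.
  have [D1 _ _ _] := linear_comb (ur X); have [D2 _ _ _] := linear_comb (ul (cp Y)).
  rewrite -{2}(ck_cp Y) D1 (uk X _ (ck_mem Y)) add0r -{2}(ck_cp X) D2.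
  by rewrite (alt2_skew (ck X) (cp Y) uA) (uk _ _ (ck_mem X)) oppr0 add0r.
split.
- have [[ur ul] u0] := uA; split; first split.
  + by move=> x c y z; rewrite linearP ur.
  + by move=> x c y z; rewrite linearP ul.
  + by move=> x; exact: u0.
- move=> h Kh x y; rewrite !actp_val// /u tinv//; congr (_ - _).
  by rewrite /alphaQ !cp_act// !ck_act// !Qact.
- apply/funext => x; rewrite /form3.
  set X := x ord0; set Y := x (inord 1); set Z := x (inord 2).
  have := d2_lift_p (fun x y : W => u (vsval x) (vsval y)) (subvsP X) (subvsP Y) (subvsP Z).
  rewrite !vsval_to_p lE => <-; rewrite d2_sub.
  have := BE (vsval X) (vsval Y) (vsval Z); rewrite /lift3 !vsval_to_p => bE.
  rewrite !fctE (HformE Qb Qsym Qact) /form3 -/X -/Y -/Z.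
  have -> : a x = b X Y Z by rewrite /b /X /Y /Z -tup3E.
  by rewrite bE /Hbar; ring.
Qed.

(** If H_Q = d s, then Q([., .], .) is the differential of the pullback of s minus
    alpha_Q, and [exact_invariant_eq0] applies. *)
Lemma Hform_exact_eq0 Q : rp_biinvariant_k0 Q -> rp_exact3 (Hform Q) -> Q = 0.
Proof.
have [N [e eE]] := basis.
move=> Qbi /rp_exact3P[s [sA sinv HE]].
have [[Qr Ql Qsym Qact] Qk] := Qbi; have Qb : bilinear_form Q by split.
have dE X Y Z : Q (br X Y) Z = d2 br (fun A B => lift2 s A B - alphaQ Q A B) X Y Z.
  rewrite d2_sub (d2_lift sA sinv); apply/eqP; rewrite eq_sym subr_eq eq_sym.
  rewrite -/(Hbar Q X Y Z) -(lift3_H Qb Qsym Qact Qk) /lift3; apply/eqP.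
  have := congr1 (fun F => F (tup3 (to_p X) (to_p Y) (to_p Z))) HE.
  by rewrite (HformE Qb Qsym Qact) /form3 /tup3 /= !inordK.
apply/funext => X; apply/funext => Y.
apply: (exact_invariant_eq0 brC ip_lin ipC ip_pos ip_ad centerless eE act_lin act_br
  ip_act act_inv Qb Qact act_infinitesimal _ dE).
exact: alt2_sub (alt2_lift sA) (alt2_alphaQ Qb).
Qed.

Lemma rp_class_unique (a : ext_form R W 3) Q Q' :
  rp_biinvariant_k0 Q -> rp_biinvariant_k0 Q' ->
  rp_exact3 (Hform Q - a) -> rp_exact3 (Hform Q' - a) -> Q = Q'.
Proof.
move=> Qbi Qbi' ea ea'; have [_ Bl] := rp_biinvariant_k0_linear.
have [_ El] := rp_exact3_linear.
have : (-1) *: Q' + Q = 0.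
  apply: Hform_exact_eq0; first exact: Bl.
  have := El (-1) _ _ ea' ea; rewrite Hform_linear !scaleN1r opprB.
  by rewrite addrC subrKA addrC.
by move/eqP; rewrite scaleN1r addrC subr_eq0 => /eqP.
Qed.

Lemma rp_biinvariant_dim : exists (s : nat) (a : 'I_s -> {vspace g}),
  [/\ injective a, forall b, is_simple_ideal br b <-> exists i, a i = b &
      has_dim rp_biinvariant s].
Proof.
have [N [e eE]] := basis.
have [s [a [E [ai aP EP gen fre]]]] :=
  ad_invariant_forms_basis brr brl brC ip_lin ipC ip_pos ip_ad eE semisimple.
have sumE (t : 'rV[R]_s) X Y :
    (\sum_i t ord0 i *: E i) X Y = \sum_i t ord0 i * E i X Y.
  by rewrite !fct_sumE; apply: eq_bigr => i _.
exists s, a; split=> //; apply: (has_dim_basis (e := E)).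
- by move=> i; have [[? ?] ? ?] := EP i; split=> //; exact: act_integral.
- move=> Q [Qr Ql Qs Qa]; have Qb : bilinear_form Q by split.
  have [lam lamE] := gen Q Qb Qs (act_infinitesimal Qb Qa).
  exists (\row_i lam i); apply/funext => X; apply/funext => Y.
  by rewrite sumE lamE; apply: eq_bigr => i _; rewrite mxE.
- move=> t t0; apply/rowP => i; rewrite mxE.
  by apply: (fre (fun i => t ord0 i)) => X Y; rewrite -sumE t0.
Qed.

Definition rp_class (a : ext_form R W 3) : set (ext_form R W 3) :=
  [set b | rp_exact3 (b - a)].

Let exactB (a b : ext_form R W 3) : rp_exact3 (a - b) -> rp_exact3 (b - a).
Proof.
have [E0 El] := rp_exact3_linear; move=> e; have := El (-1) _ _ e E0.
by rewrite scaleN1r addr0 opprB.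
Qed.

Let exactD (a b d : ext_form R W 3) :
  rp_exact3 (a - b) -> rp_exact3 (b - d) -> rp_exact3 (a - d).
Proof.
have [_ El] := rp_exact3_linear; move=> e e'; have := El 1 _ _ e e'.
by rewrite scale1r subrKA.
Qed.

Lemma rp_class_repr_unique a : rp_closed a ->
  exists! Q, rp_biinvariant_k0 Q /\ rp_class a (Hform Q).
Proof.
move=> /rp_class_representative[Q Qbi Qa]; exists Q; split=> // Q' [Qbi' Qa'].
exact: rp_class_unique Qbi Qbi' Qa Qa'.
Qed.

Lemma rp_class_bij : set_bij rp_biinvariant_k0
  [set rp_class a | a in @rp_closed 3] (fun Q => rp_class (Hform Q)).
Proof.
split.
- by move=> Q Qbi; exists (Hform Q) => //; exact: Hform_closed.
- move=> Q Q' /set_mem Qbi /set_mem Qbi' e.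
  have HQQ : rp_exact3 (Hform Q - Hform Q) by rewrite subrr; exact: rp_exact3_linear.1.
  apply: (rp_class_unique Qbi Qbi' HQQ); apply: exactB.
  exact: (eq_ind (rp_class (Hform Q)) (fun C => C (Hform Q)) HQQ _ e).
- move=> _ [a acl <-]; have [Q Qbi Qa] := rp_class_representative acl.
  exists Q => //; apply/seteqP; split=> b /= e; apply: exactD e _ => //.
  exact: exactB.
Qed.

(** H_Q identifies the cohomology with the kernel of the restriction of
    bi-invariant forms to k; the restriction has rank d on a space of
    dimension s. *)
Lemma rp_betti : exists b3 s d : nat,
  [/\ has_dim_quot (@rp_closed 3) rp_exact3 b3,
      ([set a | is_simple_ideal br a] #= `I_s)%card,
      has_dim [set restr_k k Q | Q in rp_biinvariant] d &
      b3%:Z = s%:Z - d%:Z].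
Proof.
have [s [a [ai aP dimB]]] := rp_biinvariant_dim.
have rl : linear (restr_k (R:=R) (n:=n) k) by move=> c Q Q'; apply/funext => x.
have [b [d [dimk dimr sE]]] := rank_nullity rl rp_biinvariant_linear dimB.
exists b, s, d; split=> //; last by rewrite sE PoszD addrK.
  apply: (has_dim_quot_image (A := rp_biinvariant_k0) (f := Hform)).
  - by move=> c Q Q'; exact: Hform_linear.
  - exact: rp_biinvariant_k0_linear.
  - have -> // : rp_biinvariant_k0 = [set Q | rp_biinvariant Q /\ restr_k k Q = 0].
    apply/seteqP; split=> Q [Qbi Qk]; split=> //.
      by apply/funext => x; apply/funext => y; apply: Qk; exact: subvsP.
    move=> X Y Xk Yk; have := congr1 (fun F => F (vsproj k X) (vsproj k Y)) Qk.
    by rewrite /restr_k !vsprojK.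
  - by move=> Q; exact: Hform_closed.
  - move=> w wcl; have [Q [[Qbi Qw] Qu]] := rp_class_repr_unique wcl.
    exists Q; split; first by split=> //; exact: exactB.
    by move=> Q' [Qbi' Qw']; apply: Qu; split=> //; exact: exactB.
have -> : [set a | is_simple_ideal br a] = a @` [set: 'I_s].
  apply/seteqP; split=> x /=; rewrite aP; first by case=> i <-; exists i.
  by case=> i _ <-; exists i.
apply: card_eq_trans (inj_card_eq _) _; first by move=> ? ? _ _; exact: ai.
by rewrite card_eq_sym; exact: card_II.
Qed.

End ReductivePair.

(** * Degree three cohomology of G/K *)

Theorem proposition4p1 (R : realType) (n : nat) (G : lieGroupType R n)
  (c : chart R n G) (K : set G) (k p : {vspace 'rV[R]_n})
  (hc : chart_at_one c)
  (G_compact : compact [set: G])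
  (G_connected : connected [set: G])
  (G_semisimple : is_semisimple (lie_bracket c))
  (K_subgroup : is_subgroup K)
  (K_closed : closed K)
  (K_connected : connected K)
  (GK_almost_effective : almost_effective K)
  (GK_reductive : reductive_decomposition c K k p) :
  (forall Q, biinvariant_form_k0 c k Q ->
    [/\ closed_forms c K k p 3 (H_form c k p Q),
        forall X Y Z, X \in p -> Y \in p -> Z \in p ->
          H_fun c k p Q X Y Z =
            Q (lie_bracket c X Y) Z
            + Q (comp_k k p (lie_bracket c X Y)) Z
            - Q (comp_k k p (lie_bracket c X Z)) Y
            + Q (comp_k k p (lie_bracket c Y Z)) X,
        is_alternating_form (Qbar c Q),
        exists! alpha, is_alphaQ k p Q alpha &
        forall alpha, is_alphaQ k p Q alpha ->
          forall H : ext_form R (subvs_of p) 3,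
            pullback k H = Qbar c Q + ext_diff (lie_bracket c) alpha <->
            H = H_form c k p Q]) /\
  [/\ forall C, cohomology c K k p 3 C ->
        exists! Q, biinvariant_form_k0 c k Q /\ C (H_form c k p Q),
      forall (a : R) Q Q', biinvariant_form_k0 c k Q ->
        biinvariant_form_k0 c k Q' ->
        H_form c k p (a *: Q + Q') = a *: H_form c k p Q + H_form c k p Q',
      set_bij (biinvariant_form_k0 c k) (cohomology c K k p 3)
        (fun Q => coh_class c K k (H_form c k p Q)) &
      exists b3 s d : nat,
        [/\ is_betti c K k p 3 b3,
            ([set a | is_simple_ideal (lie_bracket c) a] #= `I_s)%card,
            has_dim [set restr_k k Q | Q in biinvariant_form c] d &
            b3%:Z = s%:Z - d%:Z]].

Proof.
have [kK kp_full kp_disj act_p] := GK_reductive.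
have brr := bracket_linearr hc; have brl := bracket_linearl hc.
have brC := bracketC hc; have jac := jacobi hc.
have act_lin := Ad_linear hc; have act_br := Ad_bracket hc.
have act_inv (h : G) : exists h', forall X, Ad c h (Ad c h' X) = X.
  by exists h^-1%g => X; rewrite -(AdM hc) mulgV (Ad1 hc).
have act_inf (t : 'rV[R]_n -> 'rV[R]_n -> R^o) : bilinear_form t ->
    (forall h X Y, t (Ad c h X) (Ad c h Y) = t X Y) ->
    ad_invariant (lie_bracket c) t.
  move=> [tr tl] tinv X Y Z.
  exact: (infinitesimal2 hc tr tl (fun h _ => tinv h Y Z) (tangent_setT c X)).
have act_int (t : 'rV[R]_n -> 'rV[R]_n -> R^o) : bilinear_form t ->
    ad_invariant (lie_bracket c) t ->
    forall h X Y, t (Ad c h X) (Ad c h Y) = t X Y.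
  by move=> [tr tl] tad; exact: (Ad_invariant_of_ad_invariant hc G_connected tr tl tad).
have tanK Z : Z \in k -> tangent c K Z.
  by move=> /kK[gamma gZ gK]; exact: (tangent_subgroup hc gZ gK).
have K_inf2 (s : 'rV[R]_n -> 'rV[R]_n -> R^o) Z : bilinear_form s ->
    (forall h, K h -> forall X Y, s (Ad c h X) (Ad c h Y) = s X Y) ->
    Z \in k -> forall X Y, lie2 (lie_bracket c) Z s X Y = 0.
  move=> [sr sl] sinv Zk X Y.
  exact: (infinitesimal2 hc sr sl (fun h Kh => sinv h Kh X Y) (tanK Z Zk)).
have K_inf3 (b : 'rV[R]_n -> 'rV[R]_n -> 'rV[R]_n -> R^o) Z : alt3 b ->
    (forall h, K h -> forall X Y W,
       b (Ad c h X) (Ad c h Y) (Ad c h W) = b X Y W) ->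
    Z \in k -> forall X Y W, lie3 (lie_bracket c) Z b X Y W = 0.
  move=> [b3 b2 b1 _ _] binv Zk X Y W.
  exact: (infinitesimal3 hc b3 b2 b1 (fun h Kh => binv h Kh X Y W) (tanK Z Zk)).
have act_k h X : K h -> X \in k -> Ad c h X \in k.
  by move=> Kh Xk; exact: (Ad_subgroup_algebra hc K_subgroup kK Kh Xk).
have [ip [ip_lin ipC ip_pos ip_act]] := invariant_inner_product act_lin (Ad1 hc)
  (AdM hc) (fun v => let: ex_intro2 M _ MP := Ad_bounded hc v G_compact in
                     ex_intro _ M MP).
split.
  move=> Q Qbi; have [[Qr Ql Qsym Qact] Qk] := Qbi.
  have Qb : bilinear_form Q by split.
  split.
  - exact: (Hform_closed brr brl brC jac act_lin act_br act_inf kp_full kp_disj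
      act_k act_p K_inf2 Qbi).
  - by move=> X Y Z _ _ _; exact: (Hfun_k brC act_inf kp_full kp_disj Qb Qsym Qact X Y Z).
  - exact: (alternating_form3 (alt3_Qbar brr brl brC act_inf Qb Qsym Qact)).
  - exists (uncurry2 (alphaQ k p Q)); split.
      exact: (is_alphaQ_alphaQ kp_full kp_disj Qbi).
    by move=> alpha alphaP; rewrite (is_alphaQ_uniq kp_full kp_disj alphaP).
  - move=> alpha alphaP H.
    exact: (pullback_H_iff brr brl brC act_lin act_inf kp_full kp_disj act_k act_p
      K_inf2 Qbi H alphaP).
split.
- move=> _ [a acl <-].
  exact: (rp_class_repr_unique brr brl brC jac act_lin act_br act_inv act_inf act_int
    G_semisimple ip_lin ipC ip_pos ip_act kp_full kp_disj act_k act_p K_inf3 K_inf2 acl).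
- by move=> a Q Q' _ _; exact: Hform_linear.
- exact: (rp_class_bij brr brl brC jac act_lin act_br act_inv act_inf act_int
    G_semisimple ip_lin ipC ip_pos ip_act kp_full kp_disj act_k act_p K_inf3 K_inf2).
- exact: (rp_betti brr brl brC jac act_lin act_br act_inv act_inf act_int
    G_semisimple ip_lin ipC ip_pos ip_act kp_full kp_disj act_k act_p K_inf3 K_inf2).
Qed.
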